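(* Fix $d\ge1$ and $\alpha\in(0,2]$. Let $\Lambda_L=(\mathbb Z/L\mathbb Z)^d$, $x_0\in\Lambda_L$, and let $p_n(x,y)$ be the $n$-step transition probability of the symmetric Markov chain on $\Lambda_L$ with Hankel-type one-step kernel $$p_1(x,y)=\frac1M\sum_{k\in\mathbb Z^d}f_\alpha\Big(\frac{x+y-x_0+kL}{W}\Big),\qquad M=\sum_{k\in\mathbb Z^d}f_\alpha\Big(\frac kW\Big),$$ (that is, the variance profile $\sigma_{xy}^2=p_1(x,y)$ of a Hankel-profile random matrix of size $N=L^d$ with $\alpha$-stable profile). Suppose that $W\ll L$ and $n(W/L)^\alpha\to\tau$ as $N\to\infty$. Then the following asymptotics hold, for some constant $c>0$. (i) Even steps, $n=2k$: $$p_{2k}(x,y)=\frac1{L^d}\,\theta_\alpha\Big(\frac{y-x}{L},\,2k\big(\tfrac WL\big)^\alpha\Big)+O\big(ke^{-cW^\alpha}\big).$$ (ii) Odd steps, $n=2k+1$: $$p_{2k+1}(x,y)=\frac1{L^d}\,\theta_\alpha\Big(\frac{y+x-x_0}{L},\,(2k+1)\big(\tfrac WL\big)^\alpha\Big)+O\big(ke^{-cW^\alpha}\big).$$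
   Context: $f_\alpha$ is the density on $\mathbb R^d$ whose characteristic function is $e^{-c_\alpha\|t\|^\alpha}$ for $0<\alpha<2$ and $e^{-\frac{\sigma^2}2\|t\|^2}$ for $\alpha=2$, with $c_\alpha>0$, $\sigma>0$ fixed. $f_\alpha(x,\tau)=\tau^{-d/\alpha}f_\alpha(\tau^{-1/\alpha}x)$, and the $\alpha$-stable theta function is $\theta_\alpha(x,\tau)=\sum_{k\in\mathbb Z^d}f_\alpha(x+k,\tau)$ for $\tau>0$. $W\ll L$ means $W/L\to0$. *)

(* Defs.v *)
From HB Require Import structures.
From mathcomp Require Import all_boot all_order all_algebra.
From mathcomp Require Import all_classical all_reals all_analysis.
From mathcomp Require Import complex.

Set Implicit Arguments.
Unset Strict Implicit.
Unset Printing Implicit Defensive.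

Import Order.TTheory GRing.Theory Num.Theory.
Import numFieldNormedType.Exports.

Local Open Scope classical_set_scope.
Local Open Scope ring_scope.

(** * Lebesgue measure on R^d

    The library only has a measurable structure on [d.-tuple T] (the product
    sigma-algebra); row vectors ['rV[R]_d] carry the topology.  Lebesgue measure
    is therefore built on tuples, as the d-fold product of the one-dimensional
    one, and functions on ['rV[R]_d] are integrated through [row_of_tuple]. *)

Definition pair_cons (R : realType) (d : nat)
    (z : measurableTypeR R * d.-tuple (measurableTypeR R)) :
    d.+1.-tuple (measurableTypeR R) :=
  [the d.+1.-tuple (measurableTypeR R) of z.1 :: z.2].

Section PairCons.
Context (R : realType) (d : nat).

Let pair_cons_measurable : measurable_fun setT (@pair_cons R d).
Proof. exact: measurable_cons. Qed.

HB.instance Definition _ :=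
  isMeasurableFun.Build _ _ _ _ (@pair_cons R d) pair_cons_measurable.

End PairCons.

Definition lebesgue_cons (R : realType) (d : nat)
    (mu : {sigma_finite_measure set (d.-tuple (measurableTypeR R)) -> \bar R}) :
    set (d.+1.-tuple (measurableTypeR R)) -> \bar R :=
  pushforward (@lebesgue_measure R \x mu)%E (@pair_cons R d).

Section LebesgueCons.
Context (R : realType) (d : nat).
Variable mu : {sigma_finite_measure set (d.-tuple (measurableTypeR R)) -> \bar R}.

Let lebesgue_cons0 : lebesgue_cons mu set0 = 0%E.
Proof. exact: measure0. Qed.

Let lebesgue_cons_ge0 A : (0 <= lebesgue_cons mu A)%E.
Proof. exact: measure_ge0. Qed.

Let lebesgue_cons_sigma_additive : semi_sigma_additive (lebesgue_cons mu).
Proof. exact: measure_semi_sigma_additive. Qed.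

HB.instance Definition _ := isMeasure.Build _ _ _ (lebesgue_cons mu)
  lebesgue_cons0 lebesgue_cons_ge0 lebesgue_cons_sigma_additive.

Let uncons (t : d.+1.-tuple (measurableTypeR R)) :
    measurableTypeR R * d.-tuple (measurableTypeR R) :=
  (thead t, [tuple of behead t]).

Let lebesgue_cons_sigma_finite : sigma_finite setT (lebesgue_cons mu).
Proof.
have /sigma_finiteP[F [TF ndF Foo]] := sigma_finiteT (@lebesgue_measure R).
have /sigma_finiteP[G [TG ndG Goo]] := sigma_finiteT mu.
have muncons : measurable_fun setT uncons.
  apply/measurable_fun_pair; first exact: measurable_tnth.
  exact: measurable_behead.
exists (fun n => uncons @^-1` (F n `*` G n)).
  apply/esym; rewrite -subTset => t _.
  have [n _ Ft] : (\bigcup_n F n) (thead t) by rewrite -TF.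
  have [m _ Gt] : (\bigcup_m G m) [tuple of behead t] by rewrite -TG.
  exists (maxn n m) => //; split => /=.
    by move: Ft; exact/subsetPset/ndF/leq_maxl.
  by move: Gt; exact/subsetPset/ndG/leq_maxr.
move=> n; have [mF Fn] := Foo n; have [mG Gn] := Goo n; split.
  by rewrite -[X in measurable X]setTI; apply: muncons => //; exact: measurableX.
rewrite /lebesgue_cons /pushforward -comp_preimage.
rewrite (_ : uncons \o _ = id) ?preimage_id; last first.
  by apply/funext => -[x t]; congr pair; exact/val_inj.
by rewrite product_measure1E// lte_mul_pinfty// ge0_fin_numE.
Qed.

HB.instance Definition _ := Measure_isSigmaFinite.Build _ _ _
  (lebesgue_cons mu) lebesgue_cons_sigma_finite.

End LebesgueCons.

Fixpoint lebesgue_tuple (R : realType) (d : nat) :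
    {sigma_finite_measure set (d.-tuple (measurableTypeR R)) -> \bar R} :=
  if d is d'.+1 then lebesgue_cons (lebesgue_tuple R d')
  else \d_([tuple] : 0.-tuple (measurableTypeR R)).

Definition row_of_tuple (R : realType) (d : nat)
    (t : d.-tuple (measurableTypeR R)) : 'rV[R]_d :=
  \row_i tnth t i.

(** * The stable density *)

(* [`|x|] on ['rV[R]_d] is the sup norm, hence a separate definition. *)
Definition euclidean_norm (R : realType) (d : nat) (x : 'rV[R]_d) : R :=
  Num.sqrt (\sum_(i < d) x 0 i ^+ 2).

Definition dotv (R : realType) (d : nat) (x y : 'rV[R]_d) : R :=
  \sum_(i < d) x 0 i * y 0 i.

(* A probability density is only determined up to null sets; [f_alpha] is
   evaluated pointwise on lattices, so the continuous version is meant. *)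
Definition continuous_density (R : realType) (d : nat) (f : 'rV[R]_d -> R) :
    Prop :=
  [/\ continuous f,
      forall x, 0 <= f x,
      measurable_fun setT (fun t => f (row_of_tuple t)) &
      (\int[lebesgue_tuple R d]_t (f (row_of_tuple t))%:E)%E = 1%:E].

(* The integral of f(x) exp(i t.x) dx, by real and imaginary parts. *)
Definition charfun (R : realType) (d : nat) (f : 'rV[R]_d -> R)
    (t : 'rV[R]_d) : R[i] :=
  Complex
    (\int[lebesgue_tuple R d]_x
       (f (row_of_tuple x) * cos (dotv t (row_of_tuple x))))
    (\int[lebesgue_tuple R d]_x
       (f (row_of_tuple x) * sin (dotv t (row_of_tuple x)))).

Definition stable_exponent (R : realType) (d : nat) (alpha c sigma : R)
    (t : 'rV[R]_d) : R :=
  if alpha == 2 then sigma ^+ 2 / 2 * euclidean_norm t ^+ 2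
  else c * euclidean_norm t `^ alpha.

Definition is_stable_density (R : realType) (d : nat) (alpha c sigma : R)
    (f : 'rV[R]_d -> R) : Prop :=
  continuous_density f /\
  forall t, charfun f t = (expR (- stable_exponent alpha c sigma t))%:C%C.

(** * Lattice sums and the theta function *)

Definition zrow (R : realType) (d : nat) (k : 'rV[int]_d) : 'rV[R]_d :=
  map_mx intr k.

(* Only used for nonnegative [g], where [\esum] is the unconditional sum; the
   sums of values of [f_alpha] below are finite, so that [fine] loses nothing. *)
Definition lattice_sum (R : realType) (d : nat) (g : 'rV[R]_d -> R) : R :=
  fine (\esum_(k in [set: 'rV[int]_d]) (g (zrow R k))%:E).

Definition stable_density_at (R : realType) (d : nat) (alpha : R)
    (f : 'rV[R]_d -> R) (x : 'rV[R]_d) (tau : R) : R :=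
  tau `^ (- (d%:R / alpha)) * f (tau `^ (- alpha^-1) *: x).

Definition stable_theta (R : realType) (d : nat) (alpha : R)
    (f : 'rV[R]_d -> R) (x : 'rV[R]_d) (tau : R) : R :=
  lattice_sum (fun k => stable_density_at alpha f (x + k) tau).

(** * The Markov chain *)

(* ['Z_L] is Z/LZ only for [1 < L] (it is Z/2Z for L = 0, 1). *)
Definition torus (L d : nat) := 'rV['Z_L]_d.

(* The representative with coordinates in {0, .., L-1}; every function of it
   below is invariant under translation by L Z^d. *)
Definition torus_rep (R : realType) (L d : nat) (x : torus L d) : 'rV[R]_d :=
  map_mx (fun a : 'Z_L => (nat_of_ord a)%:R) x.

Definition hankel_norm (R : realType) (d : nat) (f : 'rV[R]_d -> R) (W : R) :
    R :=
  lattice_sum (fun k => f (W^-1 *: k)).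

Definition hankel_kernel (R : realType) (d : nat) (f : 'rV[R]_d -> R)
    (L : nat) (W : R) (x0 x y : torus L d) : R :=
  (hankel_norm f W)^-1 *
  lattice_sum (fun k => f (W^-1 *: (torus_rep R (x + y - x0) + L%:R *: k))).

Fixpoint nstep (R : realType) (T : finType) (p : T -> T -> R) (n : nat)
    (x y : T) : R :=
  if n is m.+1 then \sum_(z : T) p x z * nstep p m z y else (x == y)%:R.

(* Main.v *)
(** Poisson summation is used in the symmetrised form
    sum_k P^d (f(x + P k) + f(P k)) = sum_k phi(2 pi k / P) (1 + cos(2 pi k.x / P)),
    phi being the characteristic function, in which all terms are nonnegative.
    No decay of f is known; each inequality follows instead by testing against
    Fejer kernels, which are nonnegative: a finite part of either sum is at most
    a Fejer mean of the other, up to an arbitrarily small error. Testing phi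
    needs Fourier inversion for f, obtained from the transform pair of the
    Laplace kernel exp(-e|t|) and the Cauchy kernel as e tends to 0.

    With h = 2 pi W / L, the kernel is then a function of x + y - x0 on the torus
    whose cosine coefficients are lam(s) = psi(s) / psi(0), where
    psi(s) = sum_j phi(h (s + L j)). Hence p_n has coefficients lam(s)^n, at y - x
    or at x + y - x0 according to the parity of n, while the theta function has
    coefficients sum_j phi(h (s + L j))^n. Both are close to phi(h s)^n: choosing
    |s_i| <= L/2, the aliasing terms j <> 0 satisfy |s_i + L j_i| >= L |j_i| / 2
    and sum up to O(exp(-c W^alpha)). *)
Require Import Defs.
From HB Require Import structures.
From mathcomp Require Import all_boot all_order all_algebra.
From mathcomp Require Import all_classical all_reals all_analysis.
From mathcomp Require Import measurable_realfun ring lra complex.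

Set Implicit Arguments.
Unset Strict Implicit.
Unset Printing Implicit Defensive.

Import Order.TTheory GRing.Theory Num.Theory.
Import numFieldNormedType.Exports.

Local Open Scope classical_set_scope.
Local Open Scope ring_scope.

(** * Integrals and kernels *)

(** Lattice sums are unconditional sums of nonnegative terms in the extended reals, and nothing is
    known about [f] that would justify rearranging signed sums; this forces the weights [1 + cos] in
    place of characters. The extra summand at x = 0 is subtracted only once all sums are known to be
    finite. The order of the two Poisson inequalities is forced. The bound of the [f]-sum by the
    [phi]-sum comes first, and with period 1 it shows that [f] is bounded by some M. Kernel
    concentration yields lower bounds only; applied to M - f it gives the one half of Fourier
    inversion, transform <= (2 pi)^d f, that the reverse inequality uses. In the error,
    nonnegativity of the one-step kernel gives lam <= 1, so that |lam^n - mu^n| <= n |lam - mu| with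
    mu = phi(h s); this is the origin of the factor k. Aliased frequencies lie at distance at least
    h L / 2 = pi W from 0, whence the rate c = ka pi^alpha / 2, the other half of the exponent
    paying for summability. The theta coefficients require n W^alpha >= 1, which follows from n
    (W/L)^alpha -> tau > 0 and L -> oo. *)

Section TupleIntegral.
Context (R : realType).
Implicit Types (d : nat).
Local Notation mu := (@lebesgue_measure R).
Local Notation T d := (d.-tuple (measurableTypeR R)).

Lemma ge0_integral_lebesgue_tuple0 (F : T 0 -> \bar R) :
  (\int[lebesgue_tuple R 0]_t F t = F [tuple])%E.
Proof.
have -> : F = cst (F [tuple]) by apply/funext => t; rewrite /= tuple0.
rewrite integral_dirac ?diracT ?mul1e//.
Qed.

Lemma ge0_integral_lebesgue_tupleS d (F : T d.+1 -> \bar R) :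
  measurable_fun [set: T d.+1] F -> (forall t, 0 <= F t)%E ->
  (\int[lebesgue_tuple R d.+1]_t F t =
   \int[mu]_x \int[lebesgue_tuple R d]_t F [the T d.+1 of x :: t])%E.
Proof.
move=> mF F0; rewrite /= ge0_integral_pushforward//=.
rewrite fubini_tonelli1//.
apply: measurableT_comp => //.
Qed.

Lemma ge0_integral_lebesgue_tuple_prod d (h : 'I_d -> R -> R) :
  (forall i, measurable_fun setT (h i)) -> (forall i x, 0 <= h i x) ->
  (\int[lebesgue_tuple R d]_t (\prod_i h i (tnth t i))%:E =
   \prod_i \int[mu]_x (h i x)%:E)%E.
Proof.
elim: d h => [|d IH] h mh h0.
  by rewrite ge0_integral_lebesgue_tuple0 !big_ord0.
rewrite ge0_integral_lebesgue_tupleS; last 2 first.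
- apply/measurable_EFinP; apply: measurable_prod => i _.
  exact: (measurableT_comp (mh i) (measurable_tnth i)).
- by move=> t; rewrite lee_fin prodr_ge0.
under eq_integral => x _.
  under eq_integral => t _.
    rewrite big_ord_recl tnth0.
    under eq_bigr do rewrite tnthS.
    rewrite EFinM; over.
  rewrite ge0_integralZl_EFin//; last 2 first.
  - by move=> t _; rewrite lee_fin prodr_ge0.
  - apply/measurable_EFinP; apply: measurable_prod => i _.
    exact: (measurableT_comp (mh _) (measurable_tnth i)).
  rewrite (IH (fun i => h (lift ord0 i)))//; over.
rewrite big_ord_recl /=.
rewrite ge0_integralZr//.
- by have /measurable_EFinP := mh ord0.
- by move=> x _; rewrite lee_fin.
- by rewrite prode_ge0// => i _; apply: integral_ge0 => x _; rewrite lee_fin.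
Qed.

End TupleIntegral.

(** * One-dimensional integrals: the Cauchy and Laplace kernels *)

Section LineIntegrals.
Context (R : realType).
Local Notation mu := (@lebesgue_measure R).

Lemma ge0_integral_split0 (f : R -> R) : continuous f -> (forall x, 0 <= f x) ->
  (\int[mu]_x (f x)%:E = \int[mu]_(x in `[0%R, +oo[) (f x)%:E +
   \int[mu]_(x in `[0%R, +oo[) (f (- x))%:E)%E.
Proof.
move=> cf f0.
have mf : measurable_fun [set: R] f by exact: continuous_measurable_fun.
have := @ge0_integral_setU _ _ R mu [set` `[(0:R), +oo[%R] [set` `]-oo, (0:R)[%R]
  (measurable_itv _) (measurable_itv _) (EFin \o f).
rewrite -setCitvr setUv => ->.
- congr (_ + _)%E.
  rewrite setCitvr integral_itv_bndo_bndc; last exact/measurable_EFinP/measurable_funTS.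
  rewrite -{1}oppr0 ge0_integration_by_substitutionNy//.
  exact: continuous_subspaceT.
- exact/measurable_EFinP.
- by move=> x _; rewrite lee_fin.
- exact/disj_setPCl.
Qed.

Lemma ge0_FTC_half (f F : R -> R) (a l : R) : continuous f ->
  (forall x, a <= x -> 0 <= f x) ->
  (forall x : R, is_derive x (1:R) F (f x)) -> F x @[x --> +oo] --> l ->
  (\int[mu]_(x in `[a, +oo[) (f x)%:E = (l - F a)%:E)%E.
Proof.
move=> cf f0 dF Fl.
have cF x : {for x, continuous F}.
  by apply: differentiable_continuous; apply/derivable1_diffP; apply: ex_derive.
rewrite (ge0_continuous_FTC2y f0 _ Fl)//.
- exact: continuous_subspaceT.
- by apply: cvg_at_right_filter; exact: cF.
- by move=> x _; rewrite derive1E; exact: derive_val.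
Qed.

Lemma ge0_FTC_line (f F : R -> R) (l m : R) : continuous f -> (forall x, 0 <= f x) ->
  (forall x : R, is_derive x (1:R) F (f x)) ->
  F x @[x --> +oo] --> l -> F x @[x --> -oo] --> m ->
  (\int[mu]_x (f x)%:E = (l - m)%:E)%E.
Proof.
move=> cf f0 dF Fl Fm.
have dF' (x : R) : is_derive x (1:R) (fun x => - F (- x)) (f (- x)).
  have dFN := dF (- x).
  have H : is_derive x (1:R) (F \o -%R) (f (- x) * - 1) by exact: is_derive1_comp.
  by have := is_deriveN H; rewrite mulrN1 opprK; exact.
have Fm' : - F (- x) @[x --> +oo] --> - m.
  by apply: cvgN; exact: (cvgNy_compNP F (nbhs m)).1 Fm.
have cf' : continuous (fun x => f (- x)).
  by move=> x; apply: continuous_comp; [exact: opp_continuous|exact: cf].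
rewrite ge0_integral_split0// (ge0_FTC_half (a := 0) cf _ dF Fl)//.
rewrite (ge0_FTC_half (a := 0) cf' _ dF' Fm')//.
by rewrite -EFinD oppr0; congr EFin; ring.
Qed.

(** The Cauchy density of scale e centred at c. It is the Fourier transform of [laplace_kernel e]
    divided by 2 pi, and tends to a Dirac mass at c as e -> 0. *)
Definition cauchy_kernel (e c x : R) : R := pi^-1 * (e / (e ^+ 2 + (x - c) ^+ 2)).

Lemma cauchy_den_gt0 (e c x : R) : 0 < e -> 0 < e ^+ 2 + (x - c) ^+ 2.
Proof. by move=> e0; rewrite ltr_wpDr ?sqr_ge0// exprn_gt0. Qed.

Lemma cauchy_kernel_ge0 (e c x : R) : 0 < e -> 0 <= cauchy_kernel e c x.
Proof.
move=> e0; have := pi_gt0 R; have := cauchy_den_gt0 c x e0 => h p0.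
by rewrite /cauchy_kernel mulr_ge0// ?divr_ge0// ?invr_ge0 ltW.
Qed.

Lemma continuous_cauchy_kernel (e c : R) : 0 < e -> continuous (cauchy_kernel e c).
Proof.
move=> e0 x; apply: cvgM; first exact: cvg_cst.
apply: cvgM; first exact: cvg_cst.
apply: cvgV; first by rewrite gt_eqF ?cauchy_den_gt0.
apply: cvgD; first exact: cvg_cst.
by apply: cvgM; (apply: cvgB; [exact: cvg_id|exact: cvg_cst]).
Qed.

Lemma is_derive_affine (a b x : R) : is_derive x (1:R) (fun t => t * a + b) a.
Proof. by apply: is_derive_eq; rewrite ?scaler0 ?add0r ?addr0 /GRing.scale /= ?mulr1. Qed.

Lemma is_derive_cauchy (e c x : R) : 0 < e ->
  is_derive x (1:R) (fun t => pi^-1 * atan (t * e^-1 + - (c / e))) (cauchy_kernel e c x).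
Proof.
move=> e0.
have H := is_derive_affine e^-1 (- (c / e)) x.
have H2 : is_derive x (1:R) (atan \o (fun t => t * e^-1 + - (c / e)))
   ((1 + (x * e^-1 + - (c / e)) ^+ 2)^-1 * e^-1) by exact: is_derive1_comp.
have H3 : is_derive x (1:R) (fun t => pi^-1 * atan (t * e^-1 + - (c / e))) _ :=
  is_deriveZ pi^-1 H2.
apply: is_derive_eq.
rewrite /cauchy_kernel /GRing.scale/=; congr (_ * _).
have := cauchy_den_gt0 c x e0 => h.
have h2 : 0 < 1 + (x * e^-1 + - (c / e)) ^+ 2 by rewrite ltr_wpDr ?sqr_ge0.
by field; rewrite (gt_eqF h) (gt_eqF e0).
Qed.

Lemma cvg_affine_y (a b : R) : 0 < a -> (x * a + b) @[x --> +oo] --> +oo.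
Proof.
move=> a0; apply/cvgryPge => A; near=> x.
rewrite -lerBlDr -ler_pdivrMr//; near: x; exact: nbhs_pinfty_ge.
Unshelve. all: by end_near. Qed.

Lemma integral_cauchy (e c : R) : 0 < e ->
  (\int[mu]_x (cauchy_kernel e c x)%:E = 1%:E)%E.
Proof.
move=> e0; have e0' : 0 < e^-1 by rewrite invr_gt0.
have half : 1 / 2 = pi^-1 * (pi / 2) :> R.
  by rewrite mulrA mulVf// gt_eqF ?pi_gt0.
set F := fun t : R => pi^-1 * atan (t * e^-1 + - (c / e)).
have Fy : F x @[x --> +oo] --> (1 / 2 : R).
  rewrite half; apply: cvgM; first exact: cvg_cst.
  apply: (@cvg_comp _ _ _ _ _ _ (+oo)); last exact: cvgy_atan.
  exact: cvg_affine_y.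
have FNy : F x @[x --> -oo] --> - (1 / 2 : R).
  apply/cvgNy_compNP; rewrite half -mulrN; apply: cvgM; first exact: cvg_cst.
  rewrite [X in X @ _ --> _](_ : _ = (fun x => - atan (x * e^-1 + c / e))).
    apply: cvgN; apply: (@cvg_comp _ _ _ _ _ _ (+oo)); last exact: cvgy_atan.
    exact: cvg_affine_y.
  by apply/funext => x /=; rewrite -atanN; congr atan; ring.
rewrite (ge0_FTC_line (continuous_cauchy_kernel (c := c) e0)
  (fun x => cauchy_kernel_ge0 c x e0) (fun x => is_derive_cauchy c x e0) Fy FNy).
by congr EFin; field.
Qed.

Lemma integral_cauchy_itv (e c r : R) : 0 < e -> 0 < r ->
  (\int[mu]_(x in `[(c - r)%R, (c + r)%R]) (cauchy_kernel e c x)%:E =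
   (pi^-1 * (2 * atan (r / e)))%:E)%E.
Proof.
move=> e0 r0.
rewrite (@continuous_FTC2 _ _ (fun t => pi^-1 * atan (t * e^-1 + - (c / e)))).
- rewrite -EFinD; congr EFin; rewrite -mulrBr; congr (_ * _).
  have -> : (c + r) * e^-1 + - (c / e) = r / e by ring.
  have -> : (c - r) * e^-1 + - (c / e) = - (r / e) by ring.
  by rewrite atanN; ring.
- by lra.
- exact: continuous_subspaceT (continuous_cauchy_kernel e0).
- have cF (x : R) : {for x, continuous (fun t : R => pi^-1 * atan (t * e^-1 + - (c / e)))}.
    apply: differentiable_continuous; apply/derivable1_diffP.
    have := is_derive_cauchy c x e0 => ?; apply: ex_derive.
  split.
  + by move=> x _; have := is_derive_cauchy c x e0 => ?; apply: ex_derive.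
  + exact/cvg_at_right_filter/cF.
  + exact/cvg_at_left_filter/cF.
- move=> x _; rewrite derive1E; have := is_derive_cauchy c x e0 => ?; exact: derive_val.
Qed.

(** For C = 0 the primitive is the real part of B e^((-e + ix)t + ib) / (-e + ix), with the
    denominator made real. *)
Lemma is_derive_laplace (e C B x b t : R) : 0 < e ->
  is_derive t (1:R) (fun t => expR (t * - e + 0) *
     (- (C / e) + B / (e ^+ 2 + x ^+ 2) * (x * sin (t * x + b) - e * cos (t * x + b))))
   (expR (t * - e + 0) * (C + B * cos (t * x + b))).
Proof.
move=> e0.
have H1 := is_derive_affine (- e) 0 t.
have H2 := is_derive_affine x b t.
have E1 : is_derive t (1:R) (expR \o (fun t => t * - e + 0)) _ :=
  is_derive1_comp (is_derive_expR _) H1.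
have S1 : is_derive t (1:R) (sin \o (fun t => t * x + b)) _ :=
  is_derive1_comp (is_derive_sin _) H2.
have C1 : is_derive t (1:R) (cos \o (fun t => t * x + b)) _ :=
  is_derive1_comp (is_derive_cos _) H2.
have D1 := is_deriveB (is_deriveZ x S1) (is_deriveZ e C1).
have D2 := is_deriveD (is_derive_cst (- (C / e)) t (1:R)) (is_deriveZ (B / (e ^+ 2 + x ^+ 2)) D1).
have D3 := is_deriveM E1 D2.
have h : 0 < e ^+ 2 + x ^+ 2 by rewrite ltr_wpDr ?sqr_ge0// exprn_gt0.
apply: (is_derive_eq D3).
transitivity (expR (t * - e + 0) * (0 + B / (e ^+ 2 + x ^+ 2) *
    (x * (cos (t * x + b) * x) - e * (- sin (t * x + b) * x))) +
  (- (C / e) + B / (e ^+ 2 + x ^+ 2) * (x * sin (t * x + b) - e * cos (t * x + b))) *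
  (expR (t * - e + 0) * - e)) => //.
field.
by rewrite (gt_eqF h) (gt_eqF e0).
Qed.

(** The reason for carrying C next to the cosine: under |B| <= C the integrands below are
    nonnegative, so Tonelli and the fundamental theorem for nonnegative functions apply without a
    separate integrability argument. *)
Lemma cos_perturb_ge0 (C B x : R) : `|B| <= C -> 0 <= C + B * cos x.
Proof.
move=> BC; have : `|B * cos x| <= C.
  by rewrite normrM (le_trans _ BC)// ler_piMr ?cos_max.
by rewrite ler_norml => /andP[+ _]; lra.
Qed.

Lemma continuous_laplace_half (e C B x b : R) :
  continuous (fun t : R => expR (t * - e + 0) * (C + B * cos (t * x + b))).
Proof.
move=> t; apply: differentiable_continuous; apply/derivable1_diffP.
have H1 := is_derive_affine (- e) 0 t.
have H2 := is_derive_affine x b t.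
have E1 : is_derive t (1:R) (expR \o (fun t => t * - e + 0)) _ :=
  is_derive1_comp (is_derive_expR _) H1.
have C1 : is_derive t (1:R) (cos \o (fun t => t * x + b)) _ :=
  is_derive1_comp (is_derive_cos _) H2.
have D2 := is_deriveD (is_derive_cst C t (1:R)) (is_deriveZ B C1).
have D3 := is_deriveM E1 D2.
exact: (@ex_derive _ _ _ _ _ _ _ D3).
Qed.

Lemma integral_laplace_half (e C B x b : R) : 0 < e -> `|B| <= C ->
  (\int[mu]_(t in `[0%R, +oo[) (expR (t * - e + 0) * (C + B * cos (t * x + b)))%:E =
   (C / e + B / (e ^+ 2 + x ^+ 2) * (e * cos b - x * sin b))%:E)%E.
Proof.
move=> e0 BC.
set F := fun t : R => expR (t * - e + 0) *
   (- (C / e) + B / (e ^+ 2 + x ^+ 2) * (x * sin (t * x + b) - e * cos (t * x + b))).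
have Fy : F t @[t --> +oo] --> (0 : R).
  pose K := `|C / e| + `|B / (e ^+ 2 + x ^+ 2)| * (`|x| + `|e|).
  have FK t : `|F t| <= K * expR (- (t * e)).
    rewrite /F normrM mulrC (ger0_norm (expR_ge0 _)) addr0 mulrN ler_wpM2r ?expR_ge0//.
    rewrite (le_trans (ler_normD _ _))// normrN lerD// normrM ler_wpM2l//.
    rewrite (le_trans (ler_normB _ _))// !normrM lerD// ler_piMr ?cos_max//.
    by rewrite ler_norml sin_geN1 sin_le1.
  have K0 : (fun t => K * expR (- (t * e))) t @[t --> +oo] --> (0 : R).
    rewrite -(mulr0 K); apply: cvgM; first exact: cvg_cst.
    apply: (@cvg_comp _ _ _ (fun t => t * e) (fun t => expR (- t)) _ (+oo)); last exact: cvgr_expR.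
    have -> : (fun t : R => t * e) = (fun t => t * e + 0) by apply/funext => t; rewrite addr0.
    exact: cvg_affine_y.
  apply: (@squeeze_cvgr _ _ _ _ (fun t => - (K * expR (- (t * e)))) (fun t => K * expR (- (t * e)))) => //.
    by apply: nearW => t; rewrite -ler_norml.
  by rewrite -oppr0; exact: cvgN.
rewrite (ge0_FTC_half (a := 0) (continuous_laplace_half (e:=e) (C:=C) (B:=B) (x:=x) (b:=b)) _
  (fun t => is_derive_laplace C B x b t e0) Fy).
  by congr EFin; rewrite /F !mul0r !add0r expR0; ring.
by move=> t _; rewrite mulr_ge0 ?expR_ge0// cos_perturb_ge0.
Qed.

Definition laplace_kernel (e t : R) : R := expR (- (e * `|t|)).

Lemma continuous_laplace_kernel (e : R) : continuous (laplace_kernel e).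
Proof.
move=> t; apply: continuous_comp; last exact: continuous_expR.
apply: cvgN; apply: cvgM; first exact: cvg_cst.
exact: (@norm_continuous _ R).
Qed.

(** Reflection turns the negative half-line into the half-line integral for -x, so the two terms in
    x sin b cancel and only cos b survives. *)
Lemma integral_laplace (e C B x b : R) : 0 < e -> `|B| <= C ->
  (\int[mu]_t (laplace_kernel e t * (C + B * cos (t * x + b)))%:E =
   (C * (2 / e) + B * cos b * (2 * e / (e ^+ 2 + x ^+ 2)))%:E)%E.
Proof.
move=> e0 BC; rewrite ge0_integral_split0.
- rewrite [X in (X + _)%E](_ : _ = (C / e + B / (e ^+ 2 + x ^+ 2) * (e * cos b - x * sin b))%:E); last first.
    rewrite -integral_laplace_half//; apply: eq_integral => t.
    rewrite inE/= in_itv/= andbT => t0.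
    by rewrite /laplace_kernel ger0_norm//; congr (expR _ * _)%:E; ring.
  rewrite [X in (_ + X)%E](_ : _ = (C / e + B / (e ^+ 2 + (- x) ^+ 2) * (e * cos b - (- x) * sin b))%:E); last first.
    rewrite -integral_laplace_half//; apply: eq_integral => t.
    rewrite inE/= in_itv/= andbT => t0.
    rewrite /laplace_kernel normrN ger0_norm//; congr (expR _ * (C + B * cos _))%:E; ring.
  rewrite -EFinD; congr EFin; field.
  have h : 0 < e ^+ 2 + x ^+ 2 by rewrite ltr_wpDr ?sqr_ge0// exprn_gt0.
  by rewrite (gt_eqF e0) (gt_eqF h).
- move=> t; apply: cvgM; first exact: continuous_laplace_kernel.
  apply: cvgD; first exact: cvg_cst.
  apply: cvgM; first exact: cvg_cst.
  apply: continuous_comp; last exact: continuous_cos.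
  apply: cvgD; last exact: cvg_cst.
  by apply: cvgM; [exact: cvg_id|exact: cvg_cst].
- by move=> t; rewrite mulr_ge0 ?expR_ge0// cos_perturb_ge0.
Qed.

End LineIntegrals.

(** * The Fourier transform of the product Laplace kernel *)

Section LaplaceTuple.
Context (R : realType).
Local Notation T d := (d.-tuple (measurableTypeR R)).

Lemma near_forall_seq (I : eqType) (s : seq I) (U : Type) (F : set_system U)
    {FF : Filter F} (Q : I -> U -> Prop) :
  (forall i, i \in s -> \forall u \near F, Q i u) ->
  \forall u \near F, forall i, i \in s -> Q i u.
Proof.
elim: s => [|a s IH] H; first by apply: nearW => u i; rewrite in_nil.
have Ha := H a (mem_head _ _).
have Hs : \forall u \near F, forall i, i \in s -> Q i u.
  by apply: IH => i si; apply: H; rewrite in_cons si orbT.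
by apply: filterS2 Ha Hs => u Qa Qs i; rewrite in_cons => /predU1P[->|/Qs].
Qed.

Lemma measurable_fun_dot d (x : 'I_d -> R) :
  measurable_fun [set: T d] (fun t : T d => \sum_i tnth t i * x i).
Proof.
apply: measurable_sum => i; apply: measurable_funM => //.
exact: measurable_tnth.
Qed.

Lemma measurable_cos_dot d (x : 'I_d -> R) (b : R) :
  measurable_fun [set: T d] (fun t : T d => cos (\sum_i tnth t i * x i + b)).
Proof.
have m : measurable_fun [set: T d] (fun t : T d => \sum_i tnth t i * x i + b).
  by apply: measurable_funD => //; exact: measurable_fun_dot.
exact: (measurableT_comp (continuous_measurable_fun (@continuous_cos R)) m).
Qed.

Lemma measurable_prod_tnth d (h : 'I_d -> R -> R) :
  (forall i, measurable_fun setT (h i)) ->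
  measurable_fun [set: T d] (fun t : T d => \prod_i h i (tnth t i)).
Proof.
move=> mh; apply: measurable_prod => i _.
exact: (measurableT_comp (mh i) (measurable_tnth i)).
Qed.

Lemma measurable_laplace_prod d (e : R) :
  measurable_fun [set: T d] (fun t : T d => \prod_i laplace_kernel e (tnth t i)).
Proof.
apply: (@measurable_prod_tnth d (fun=> laplace_kernel e)) => i.
apply: continuous_measurable_fun; exact: continuous_laplace_kernel.
Qed.

Lemma laplace_kernel_ge0 (e t : R) : 0 <= laplace_kernel e t.
Proof. exact: expR_ge0. Qed.

(** The upper bound is the value at x = 0. It preserves |B| <= C in the induction on the
    dimension. *)
Lemma laplace_transform_bounds (e x : R) : 0 < e ->
  0 <= 2 * e / (e ^+ 2 + x ^+ 2) <= 2 / e.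
Proof.
move=> e0; have h : 0 < e ^+ 2 + x ^+ 2 by rewrite ltr_wpDr ?sqr_ge0// exprn_gt0.
apply/andP; split; first by rewrite divr_ge0// ltW// mulr_gt0.
rewrite ler_pdivrMr// mulrAC ler_pdivlMr//.
by rewrite -mulrA -expr2 ler_pM2l// lerDl sqr_ge0.
Qed.

(** Integrating all coordinates but the first leaves an integrand of the same shape, with C
    multiplied by [(2 / e) ^+ d], B by the product P of transforms, and the first coordinate
    absorbed in the phase; hence the generality in C, B and b. *)
Lemma integral_laplace_tuple d (e : R) (x : 'I_d -> R) (C B b : R) :
  0 < e -> `|B| <= C ->
  (\int[lebesgue_tuple R d]_t ((\prod_i laplace_kernel e (tnth t i)) *
      (C + B * cos (\sum_i tnth t i * x i + b)))%:E =
   (C * (2 / e) ^+ d + B * cos b * \prod_i (2 * e / (e ^+ 2 + x i ^+ 2)))%:E)%E.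
Proof.
move=> e0; elim: d x C B b => [|d IH] x C B b BC.
  by rewrite ge0_integral_lebesgue_tuple0 !big_ord0 add0r expr0 mul1r !mulr1.
rewrite ge0_integral_lebesgue_tupleS; last 2 first.
- apply/measurable_EFinP; apply: measurable_funM; first exact: measurable_laplace_prod.
  apply: measurable_funD => //; apply: measurable_funM => //.
  exact: measurable_cos_dot.
- move=> t; rewrite lee_fin mulr_ge0 ?cos_perturb_ge0// prodr_ge0// => i _.
  exact: laplace_kernel_ge0.
set P := \prod_i (2 * e / (e ^+ 2 + x (lift ord0 i) ^+ 2)).
have P0 : 0 <= P <= (2 / e) ^+ d.
  rewrite -[X in _ <= _ <= _ ^+ X](card_ord d) -prodr_const prodr_ge0 ?ler_prod//.
    by move=> i _; exact: laplace_transform_bounds.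
  by move=> i _; case/andP: (laplace_transform_bounds (x (lift ord0 i)) e0).
under eq_integral => t0 _.
  rewrite (_ : (fun t => _) = fun t : T d => ((laplace_kernel e t0)%:E *
     ((\prod_i laplace_kernel e (tnth t i)) *
      (C + B * cos (\sum_i tnth t i * x (lift ord0 i) + (t0 * x ord0 + b))))%:E)%E); last first.
    apply/funext => t; rewrite -EFinM; congr EFin.
    rewrite !big_ord_recl !tnth0 -mulrA; congr (_ * (_ * (_ + _ * cos _))).
      by apply: eq_bigr => i _; rewrite tnthS.
    under eq_bigr do rewrite tnthS.
    by rewrite addrCA addrA [X in X + b]addrC.
  rewrite ge0_integralZl_EFin//; last 3 first.
  - move=> t _; rewrite lee_fin mulr_ge0 ?cos_perturb_ge0// prodr_ge0// => i _.
    exact: laplace_kernel_ge0.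
  - apply/measurable_EFinP; apply: measurable_funM; first exact: measurable_laplace_prod.
    apply: measurable_funD => //; apply: measurable_funM => //.
    exact: measurable_cos_dot.
  - exact: laplace_kernel_ge0.
  rewrite IH// -EFinM.
  rewrite -/P (_ : laplace_kernel e t0 * _ = laplace_kernel e t0 *
    (C * (2 / e) ^+ d + (B * P) * cos (t0 * x ord0 + b))); last by ring.
  over.
rewrite integral_laplace//.
  by congr EFin; rewrite big_ord_recl -/P (exprS _ d); ring.
case/andP: P0 => P0 P1.
by rewrite normrM (ger0_norm P0) ler_pM.
Qed.

End LaplaceTuple.

(** * Lower bounds from kernels concentrating near finitely many points *)

Section Concentration.
Context (R : realType) (d : nat).
Local Notation mu := (@lebesgue_measure R).
Local Notation T := (d.-tuple (measurableTypeR R)).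
Implicit Types (g : 'rV[R]_d -> R) (p : 'rV[R]_d).

Definition in_cube (r : R) p (x : 'rV[R]_d) := forall i, `|x 0 i - p 0 i| <= r.

Lemma near_cube_separated (S : seq 'rV[R]_d) :
  \forall r \near 0^'+, forall p q x, p \in S -> q \in S ->
    in_cube r p x -> in_cube r q x -> p = q.
Proof.
have H : \forall r \near 0^'+, forall pq, pq \in [seq (p, q) | p <- S, q <- S] ->
    forall x, in_cube r pq.1 x -> in_cube r pq.2 x -> pq.1 = pq.2.
  apply: near_forall_seq => -[p q] _ /=.
  have [<-|/eqP pq] := eqVneq p q; first by apply: nearW.
  have [i pqi] : exists i, p 0 i != q 0 i.
    apply/existsP; apply: contra_notT pq => /existsPn H.
    by apply/rowP => i; apply/eqP; have := H i; rewrite negbK.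
  near=> r => x /(_ i) + /(_ i).
  have : r < `|p 0 i - q 0 i| / 2.
    by near: r; apply: nbhs_right_lt; rewrite divr_gt0// normr_gt0 subr_eq0.
  move=> rpq xp xq.
  have : `|p 0 i - q 0 i| <= r + r.
    rewrite (le_trans (ler_distD (x 0 i) _ _))// lerD//.
    by rewrite distrC.
  by move=> pqr; exfalso; clear pq; lra.
near=> r => p q x pS qS; apply: (near H r _ (p, q)) => //.
by apply/allpairsP; exists (p, q).
Unshelve. all: by end_near. Qed.

Lemma near_cube_lower g (S : seq 'rV[R]_d) (e : R) : 0 < e -> continuous g ->
  \forall r \near 0^'+, forall p, p \in S -> forall x, in_cube r p x -> g p - e <= g x.
Proof.
move=> e0 cg; apply: near_forall_seq => p _.
have /cvgrPdist_le/(_ e e0) := cg p.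
move=> /nbhs_ballP[s /= s0 sB].
near=> r => x xr.
have : ball p s x.
  split=> // i j; rewrite (ord1 i) /ball /= distrC (le_lt_trans (xr j))//.
by move=> /sB /=; rewrite ler_norml; lra.
Unshelve. all: by end_near. Qed.

Definition cube_indic (r : R) p (i : 'I_d) (t : R) : R :=
  (p 0 i - r <= t <= p 0 i + r)%R%:R.

Lemma cube_indicE (r : R) p i t : cube_indic r p i t = (`|t - p 0 i| <= r)%R%:R.
Proof. by rewrite ler_distl. Qed.

Lemma cube_indic_ge0 (r : R) p i t : 0 <= cube_indic r p i t.
Proof. exact: ler0n. Qed.

Lemma prod_cube_indic (r : R) p (h : 'I_d -> R -> R) (t : T) :
  \prod_i (h i (tnth t i) * cube_indic r p i (tnth t i)) =
  (\prod_i h i (tnth t i)) * `[< in_cube r p (row_of_tuple t) >]%:R.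
Proof.
rewrite big_split /=; congr (_ * _); case: asboolP => [H|H].
  by rewrite big1// => i _; rewrite cube_indicE; have := H i; rewrite mxE => ->.
apply/eqP; rewrite prodf_seq_eq0; move/existsNP: H => [i /negP]; rewrite mxE => Hi.
by apply/hasP; exists i; rewrite ?mem_index_enum//= cube_indicE (negbTE Hi).
Qed.

Lemma measurable_cube_indic (r : R) p i : measurable_fun setT (cube_indic r p i).
Proof.
have -> : cube_indic r p i = \1_[set` `[p 0 i - r, p 0 i + r]%R].
  by apply/funext => t; rewrite indicE mem_setE in_itv.
exact: measurable_indic.
Qed.

Lemma bernoulli_ineq (a : R) n : 0 <= a <= 1 -> 1 - n%:R * a <= (1 - a) ^+ n.
Proof.
move=> /andP[a0 a1]; elim: n => [|n IH]; first by rewrite mul0r subr0 expr0.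
rewrite exprS (le_trans _ (ler_wpM2l _ IH)) ?subr_ge0// mulrBr mulr1.
rewrite -natr1 mulrDl mul1r.
have : 0 <= a * (n%:R * a) by rewrite !mulr_ge0.
by lra.
Qed.

Lemma prode_ge (I : Type) (s : seq I) (c : R) (h : I -> \bar R) : 0 <= c ->
  (forall i, c%:E <= h i)%E -> ((c ^+ size s)%:E <= \prod_(i <- s) h i)%E.
Proof.
move=> c0 ch; elim: s => [|x s IH]; first by rewrite big_nil.
by rewrite big_cons exprS EFinM lee_pmul ?lee_fin ?exprn_ge0.
Qed.

Lemma integral_cube_indic (r : R) p (h : 'I_d -> R -> R) :
  (forall i, measurable_fun setT (h i)) -> (forall i t, 0 <= h i t) ->
  (\int[lebesgue_tuple R d]_t (\prod_i (h i (tnth t i) * cube_indic r p i (tnth t i)))%:E =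
   \prod_i \int[mu]_(x in `[(p 0%R i - r)%R, (p 0%R i + r)%R]) (h i x)%:E)%E.
Proof.
move=> mh h0.
rewrite (@ge0_integral_lebesgue_tuple_prod R d (fun i (t : R) => h i t * cube_indic r p i t)).
- apply: eq_bigr => i _; rewrite [RHS]integral_mkcond; apply: eq_integral => t _.
  rewrite patchE /cube_indic mem_setE in_itv /=.
  by case: (_ && _); rewrite ?mulr1 ?mulr0.
- by move=> i; apply: measurable_funM => //; exact: measurable_cube_indic.
- by move=> i x; rewrite mulr_ge0// cube_indic_ge0.
Qed.

(** Used to choose small constants: the denominator N + 1 stays positive even when N = 0. *)
Lemma mulr_div_succ_le (N a : R) : 0 <= N -> 0 <= a -> N * (a / (N + 1)) <= a.
Proof.
move=> N0 a0; have N1 : 0 < N + 1 by rewrite ltr_wpDl.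
by rewrite mulrA ler_pdivrMr// mulrC ler_wpM2l// lerDl.
Qed.

(* Disjoint small cubes around the points of [S] each carry kernel mass close to 1. *)
Lemma concentration g (kappa : nat -> 'I_d -> R -> R) (S : seq 'rV[R]_d) (e : R) :
  (forall x, 0 <= g x) -> continuous g ->
  measurable_fun [set: T] (fun t => g (row_of_tuple t)) ->
  (forall n i, measurable_fun setT (kappa n i)) ->
  (forall n i t, 0 <= kappa n i t) -> uniq S ->
  (forall p i r a, p \in S -> 0 < r -> 0 < a -> \forall n \near \oo,
    ((1 - a)%:E <= \int[mu]_(x in `[(p 0%R i - r)%R, (p 0%R i + r)%R]) (kappa n i x)%:E)%E) ->
  0 < e -> \forall n \near \oo,
  ((\sum_(p <- S) g p - e)%:E <=
   \int[lebesgue_tuple R d]_t (g (row_of_tuple t) * \prod_i kappa n i (tnth t i))%:E)%E.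
Proof.
move=> g0 cg mg mk k0 uS kS e0.
pose G := \sum_(p <- S) g p.
have G0 : 0 <= G by apply: sumr_ge0.
pose N := (size S)%:R : R.
(* The error e is halved: continuity costs e1 at each of the N points, and incomplete kernel mass
   costs the fraction d a of the total G, because (1 - a)^d >= 1 - d a. The cap 1/2 below keeps a <
   1. *)
have [e1 e10 He1] : exists2 e1 : R, 0 < e1 & N * e1 <= e / 2.
  exists (e / 2 / (N + 1)); first by rewrite !divr_gt0// ltr_wpDl// ler0n.
  by rewrite mulr_div_succ_le ?ler0n// divr_ge0// ltW.
have [a a0 Ha] : exists2 a : R, 0 < a < 1 & d%:R * a * G <= e / 2.
  have K0 : 0 <= d%:R * G by rewrite mulr_ge0.
  exists (Num.min (1 / 2) (e / 2 / (d%:R * G + 1))).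
    rewrite lt_min gt_min !divr_gt0 ?ltr_wpDl//=.
    by apply/orP; left; lra.
  have mle : Num.min (1 / 2) (e / 2 / (d%:R * G + 1)) <= e / 2 / (d%:R * G + 1).
    by rewrite ge_min lexx orbT.
  rewrite mulrAC (le_trans (ler_wpM2l K0 mle))//.
  by rewrite mulr_div_succ_le// divr_ge0// ltW.
have [r [r0 sep low]] : exists r : R, [/\ 0 < r,
    forall p q x, p \in S -> q \in S -> in_cube r p x -> in_cube r q x -> p = q
    & forall p, p \in S -> forall x, in_cube r p x -> g p - e1 <= g x].
  have H1 := near_cube_separated S.
  have H2 := near_cube_lower S e10 cg.
  have H3 : \forall r \near 0^'+, (0 : R) < r by exact: nbhs_right_gt.
  near (at_right (0 : R)) => r; exists r; split; [near: r; exact: H3|near: r; exact: H1|near: r; exact: H2].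
(* Truncation at 0 keeps the minorant nonnegative; it still lies below [g] on the cube because [g]
   is nonnegative. *)
pose m p := Num.max 0 (g p - e1).
have m0 p : 0 <= m p by rewrite le_max lexx.
have : \forall n \near \oo, forall p, p \in S -> forall i, i \in enum 'I_d ->
    ((1 - a)%:E <= \int[mu]_(x in `[(p 0%R i - r)%R, (p 0%R i + r)%R]) (kappa n i x)%:E)%E.
  apply: near_forall_seq => p pS; apply: near_forall_seq => i _.
  by apply: kS => //; case/andP: a0.
apply: filterS => n Hn.
(* [g] is replaced by the step function equal to m p on the cube around p. The cubes are disjoint,
   so at each t at most one summand is nonzero. *)
apply: (@le_trans _ _ (\int[lebesgue_tuple R d]_t
    (\sum_(p <- S) m p * \prod_i (kappa n i (tnth t i) * cube_indic r p i (tnth t i)))%:E)%E); last first.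
  apply: ge0_le_integral => //.
  - move=> t _; rewrite lee_fin sumr_ge0// => p _; rewrite mulr_ge0// prodr_ge0// => i _.
    by rewrite mulr_ge0// cube_indic_ge0.
  - apply/measurable_EFinP; apply: measurable_sum => p; apply: measurable_funM => //.
    apply: (@measurable_prod_tnth R d (fun i (t : R) => kappa n i t * cube_indic r p i t)) => i.
    by apply: measurable_funM => //; exact: measurable_cube_indic.
  - apply/measurable_EFinP; apply: measurable_funM => //; exact: measurable_prod_tnth.
  - move=> t _; rewrite lee_fin.
    rewrite (eq_bigr (fun p => m p * ((\prod_i kappa n i (tnth t i)) *
      `[< in_cube r p (row_of_tuple t) >]%:R))); last first.
      by move=> p _; rewrite (prod_cube_indic r p (kappa n)).
    have : 0 <= \prod_i kappa n i (tnth t i) by exact: prodr_ge0.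
    move: (\prod_i kappa n i (tnth t i)) => K K0.
    have [[p [pS pt]]|H] := pselect (exists p, p \in S /\ in_cube r p (row_of_tuple t)).
      rewrite (bigD1_seq p)//= big1_seq ?addr0; last first.
        move=> q /andP[qp qS]; case: asboolP => [qt|_]; last by rewrite !mulr0.
        by rewrite (sep q p (row_of_tuple t)) ?eqxx in qp.
      rewrite asboolT// mulr1 ler_wpM2r//.
      by rewrite ge_max g0 low.
    rewrite big1_seq ?mulr_ge0// => p /andP[_ pS].
    by rewrite asboolF ?mulr0// => pt; apply: H; exists p.
rewrite (_ : (fun t => _) = fun t : T => (\sum_(p <- S)
    (m p)%:E * (\prod_i (kappa n i (tnth t i) * cube_indic r p i (tnth t i)))%:E)%E); last first.
  by apply/funext => t; rewrite -sumEFin; apply: eq_bigr => p _; rewrite EFinM.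
rewrite ge0_integral_sum//; last 2 first.
- move=> p; apply: emeasurable_funM => //; apply/measurable_EFinP.
  apply: (@measurable_prod_tnth R d (fun i (t : R) => kappa n i t * cube_indic r p i t)) => i.
  by apply: measurable_funM => //; exact: measurable_cube_indic.
- move=> p t _; rewrite mule_ge0 ?lee_fin// prodr_ge0// => i _.
  by rewrite mulr_ge0// cube_indic_ge0.
apply: (@le_trans _ _ (\sum_(p <- S) (m p * (1 - d%:R * a))%:E)%E).
  rewrite sumEFin lee_fin -mulr_suml.
  have M1 : G - e / 2 <= \sum_(p <- S) m p.
    rewrite (le_trans (lerB (lexx _) He1))// /N /G.
    rewrite -sum1_size natr_sum mulr_suml -sumrB; apply: ler_sum => p _.
    by rewrite mul1r le_max lexx orbT.
  have M2 : \sum_(p <- S) m p <= G.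
    by apply: ler_sum => p _; rewrite ge_max g0 gerBl ltW.
  have M3 : d%:R * a * (\sum_(p <- S) m p) <= e / 2.
    case/andP: a0 => a0 _.
    by rewrite (le_trans _ Ha)// ler_wpM2l// mulr_ge0// ltW.
  by move: M1 M3; rewrite -/G; set X := \sum_(p <- S) m p; lra.
rewrite !big_seq; apply: lee_sum => p pS.
rewrite ge0_integralZl_EFin//; last 2 first.
- move=> t _; rewrite lee_fin prodr_ge0// => i _.
  by rewrite mulr_ge0// cube_indic_ge0.
- apply/measurable_EFinP.
  apply: (@measurable_prod_tnth R d (fun i (t : R) => kappa n i t * cube_indic r p i t)) => i.
  by apply: measurable_funM => //; exact: measurable_cube_indic.
rewrite integral_cube_indic// EFinM lee_wpmul2l ?lee_fin//.
have [a0' a1] := andP a0.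
apply: (@le_trans _ _ ((1 - a) ^+ d)%:E).
  by rewrite lee_fin bernoulli_ineq// !ltW.
rewrite -[in leLHS](size_enum_ord d) -big_enum /=.
apply: prode_ge; first by rewrite subr_ge0 ltW.
by move=> i; apply: Hn => //; rewrite mem_enum.
Unshelve. all: by end_near. Qed.

End Concentration.

(** * Fourier inversion *)

Section Inversion.
Context (R : realType) (d : nat) (f phi : 'rV[R]_d -> R).
Local Notation T := (d.-tuple (measurableTypeR R)).
Local Notation mud := (lebesgue_tuple R d).
Local Notation dot t x := (\sum_i tnth t i * x i).

Hypothesis f0 : forall x, 0 <= f x.
Hypothesis cf : continuous f.
Hypothesis mf : measurable_fun [set: T] (fun t => f (row_of_tuple t)).
Hypothesis intf : (\int[mud]_t (f (row_of_tuple t))%:E = 1%:E)%E.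
Hypothesis phi_ge0 : forall x, 0 <= phi x.
Hypothesis mphi : measurable_fun [set: T] (fun t => phi (row_of_tuple t)).
Hypothesis phi_fin : (\int[mud]_t (phi (row_of_tuple t))%:E < +oo)%E.
Hypothesis charf : forall (t : T) b,
  (\int[mud]_x (f (row_of_tuple x) * (1 + cos (dot x (tnth t) + b)))%:E =
   (1 + phi (row_of_tuple t) * cos b)%:E)%E.

Lemma measurable_one_cos (x : 'I_d -> R) (b : R) :
  measurable_fun [set: T] (fun t : T => 1 + cos (dot t x + b)).
Proof. by apply: measurable_funD => //; exact: measurable_cos_dot. Qed.

Lemma one_cos_ge0 (x : R) : 0 <= 1 + cos x.
Proof. by have := cos_perturb_ge0 x (lexx `|1 : R|); rewrite normr1 mul1r. Qed.

(** Unnormalised: the factor (2 pi)^d is kept on the side of [f]. *)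
Definition fourier_inv (x : 'rV[R]_d) : R :=
  \int[mud]_t (phi (row_of_tuple t) * cos (dot t (x 0))).

Lemma integrable_phi : mud.-integrable setT (fun t => (phi (row_of_tuple t))%:E).
Proof.
apply/integrableP; split; first exact/measurable_EFinP.
by under eq_integral do rewrite gee0_abs ?lee_fin//.
Qed.

Lemma integrable_le_phi (h : T -> R) : measurable_fun [set: T] h ->
  (forall t, `|h t| <= phi (row_of_tuple t)) ->
  mud.-integrable setT (fun t => (h t)%:E).
Proof.
move=> mh hphi; apply: (le_integrable _ _ _ integrable_phi) => //.
  exact/measurable_EFinP.
by move=> t _ /=; rewrite lee_fin (ger0_norm (phi_ge0 _)).
Qed.

Lemma measurable_cos_dot0 (x : 'I_d -> R) :
  measurable_fun [set: T] (fun t : T => cos (dot t x)).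
Proof.
have -> : (fun t : T => cos (dot t x)) = (fun t => cos (dot t x + 0)).
  by apply/funext => t; rewrite addr0.
exact: measurable_cos_dot.
Qed.

Lemma integral_laplace_mass (e : R) : 0 < e ->
  (\int[mud]_t (\prod_i laplace_kernel e (tnth t i))%:E = ((2 / e) ^+ d)%:E)%E.
Proof.
move=> e0; have := @integral_laplace_tuple R d e (fun=> 0) 1 0 0 e0.
rewrite normr0 => /(_ ler01); rewrite !mul0r addr0 mul1r => <-.
by apply: eq_integral => t _; rewrite mul0r addr0 mulr1.
Qed.

Lemma prod_cauchy (e : R) (x y : 'I_d -> R) :
  \prod_i (2 * e / (e ^+ 2 + (y i - x i) ^+ 2)) =
  (2 * pi) ^+ d * \prod_i cauchy_kernel e (x i) (y i).
Proof.
have -> : (2 * pi) ^+ d = \prod_(i < d) (2 * pi : R) by rewrite prodr_const card_ord.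
rewrite -big_split /=; apply: eq_bigr => i _.
rewrite /cauchy_kernel mulrA [2 * pi * pi^-1]mulfK ?gt_eqF ?pi_gt0//.
by rewrite mulrA.
Qed.

Lemma measurable_prod_cauchy (e : R) (x : 'I_d -> R) : 0 < e ->
  measurable_fun [set: T] (fun t : T => \prod_i cauchy_kernel e (x i) (tnth t i)).
Proof.
move=> e0; apply: (@measurable_prod_tnth R d (fun i => cauchy_kernel e (x i))) => i.
by apply: continuous_measurable_fun; exact: continuous_cauchy_kernel.
Qed.

(** Both sides are the double integral of f(x) K(t) (1 + cos(t.(x - x0))), K being the Laplace
    product: integrating in t first produces Cauchy kernels, integrating in x first produces [phi].
    The summand 1 is there for nonnegativity. *)
Lemma laplace_tonelli (e : R) (x0 : 'rV[R]_d) : 0 < e ->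
  (\int[mud]_x (f (row_of_tuple x) *
      ((2 / e) ^+ d + (2 * pi) ^+ d * \prod_i cauchy_kernel e (x0 0 i) (tnth x i)))%:E =
   \int[mud]_t ((\prod_i laplace_kernel e (tnth t i)) *
      (1 + phi (row_of_tuple t) * cos (dot t (x0 0))))%:E)%E.
Proof.
move=> e0.
pose F (z : T * T) : \bar R := (f (row_of_tuple z.1) *
   ((\prod_i laplace_kernel e (tnth z.2 i)) *
    (1 + 1 * cos (\sum_i tnth z.2 i * (tnth z.1 i - x0 0 i) + 0))))%:E.
have mF : measurable_fun [set: T * T] F.
  have m1 : measurable_fun [set: T * T] (@fst T T) by exact: measurable_fst.
  have m2 : measurable_fun [set: T * T] (@snd T T) by exact: measurable_snd.
  have m1i i : measurable_fun [set: T * T] (fun z : T * T => tnth z.1 i).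
    exact: (measurableT_comp (measurable_tnth i) m1).
  have m2i i : measurable_fun [set: T * T] (fun z : T * T => tnth z.2 i).
    exact: (measurableT_comp (measurable_tnth i) m2).
  apply/measurable_EFinP; apply: measurable_funM.
    exact: (measurableT_comp mf m1).
  apply: measurable_funM.
    exact: (measurableT_comp (measurable_laplace_prod (d := d) e) m2).
  apply: measurable_funD => //; apply: measurable_funM => //.
  have md : measurable_fun [set: T * T]
      (fun z : T * T => \sum_i tnth z.2 i * (tnth z.1 i - x0 0 i) + 0).
    apply: measurable_funD => //; apply: measurable_sum => i.
    apply: measurable_funM; first exact: m2i.
    by apply: measurable_funB; [exact: m1i|exact: measurable_cst].
  exact: (measurableT_comp (continuous_measurable_fun (@continuous_cos R)) md).
have F0 z : (0 <= F z)%E.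
  rewrite lee_fin mulr_ge0// mulr_ge0 ?mul1r ?one_cos_ge0//.
  by apply: prodr_ge0 => i _; exact: laplace_kernel_ge0.
have := fubini_tonelli (m1 := mud) (m2 := mud) F mF F0.
clear mF F0 => H; apply: etrans (etrans _ H) _; clear H.
- apply: eq_integral => x _.
  rewrite /fubini_F /F /=.
  under eq_integral do rewrite EFinM.
  rewrite ge0_integralZl_EFin; [|exact: measurableT| | |exact: f0]; last 2 first.
  + move=> t _; rewrite lee_fin; apply: mulr_ge0; last by rewrite mul1r one_cos_ge0.
    by apply: prodr_ge0 => i _; exact: laplace_kernel_ge0.
  + apply/measurable_EFinP; apply: measurable_funM; first exact: measurable_laplace_prod.
    apply: measurable_funD => //; apply: measurable_funM => //.
    exact: measurable_cos_dot.
  rewrite integral_laplace_tuple ?normr1//.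
  by rewrite cos0 !mul1r (prod_cauchy e (x0 0) (tnth x)) EFinM.
- apply: eq_integral => t _.
  rewrite /fubini_G /F /=.
  rewrite (_ : (fun x : T => _) = fun x : T => ((\prod_i laplace_kernel e (tnth t i))%:E *
    (f (row_of_tuple x) * (1 + cos (dot x (tnth t) + (- dot t (x0 0)))))%:E)%E); last first.
    apply/funext => x; rewrite -EFinM; congr EFin; rewrite mulrCA mul1r; congr (_ * (_ * (_ + cos _))).
    rewrite addr0 -sumrB; apply: eq_bigr => i _; ring.
  rewrite ge0_integralZl_EFin//; last 3 first.
  + by move=> x _; rewrite lee_fin mulr_ge0// one_cos_ge0.
  + by apply/measurable_EFinP; apply: measurable_funM => //; exact: measurable_one_cos.
  + by apply: prodr_ge0 => i _; exact: laplace_kernel_ge0.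
  by rewrite charf cosN EFinM.
Qed.

Definition eps_seq (n : nat) : R := n.+1%:R^-1.

Lemma eps_seq_gt0 n : 0 < eps_seq n.
Proof. by rewrite invr_gt0. Qed.

Lemma cvg_eps_seq : eps_seq n @[n --> \oo] --> (0 : R).
Proof. exact: cvg_harmonic. Qed.

Definition damped (e : R) (x0 : 'rV[R]_d) (t : T) : R :=
  (\prod_i laplace_kernel e (tnth t i)) * (phi (row_of_tuple t) * cos (dot t (x0 0))).

Lemma laplace_prod_le1 (e : R) (t : T) : 0 < e ->
  0 <= \prod_i laplace_kernel e (tnth t i) <= 1.
Proof.
move=> e0; rewrite prodr_ge0/=; last by move=> i _; exact: laplace_kernel_ge0.
apply: prodr_ile1 => i _; rewrite laplace_kernel_ge0/= -expR0 ler_expR.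
by rewrite oppr_le0 mulr_ge0// ltW.
Qed.

Lemma measurable_damped (e : R) x0 : measurable_fun [set: T] (damped e x0).
Proof.
apply: measurable_funM; first exact: measurable_laplace_prod.
apply: measurable_funM => //; exact: measurable_cos_dot0.
Qed.

Lemma damped_le (e : R) x0 t : 0 < e -> `|damped e x0 t| <= phi (row_of_tuple t).
Proof.
move=> e0; have /andP[h0 h1] := laplace_prod_le1 t e0.
rewrite /damped !normrM (ger0_norm h0) (ger0_norm (phi_ge0 _)).
rewrite -[leRHS]mul1r ler_pM ?mulr_ge0// ler_piMr ?cos_max//.
Qed.

(** The summand 1 contributes the finite mass [(2 / e) ^+ d] to both sides of [laplace_tonelli] and
    is subtracted. The remaining integral is signed, but dominated by [phi]. *)
Lemma integral_f_cauchy (e : R) (x0 : 'rV[R]_d) : 0 < e ->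
  (\int[mud]_x (f (row_of_tuple x) * \prod_i cauchy_kernel e (x0 0 i) (tnth x i))%:E =
   (((2 * pi) ^+ d)^-1 * \int[mud]_t damped e x0 t)%:E)%E.
Proof.
move=> e0; have := laplace_tonelli x0 e0.
have V0 : 0 <= (2 / e) ^+ d by rewrite exprn_ge0// divr_ge0// ltW.
have P0 : 0 < (2 * pi : R) ^+ d by rewrite exprn_gt0// mulr_gt0// pi_gt0.
have X0 (x : T) : 0 <= f (row_of_tuple x) * \prod_i cauchy_kernel e (x0 0 i) (tnth x i).
  by rewrite mulr_ge0// prodr_ge0// => i _; exact: cauchy_kernel_ge0.
have mX : measurable_fun [set: T]
    (fun x => f (row_of_tuple x) * \prod_i cauchy_kernel e (x0 0 i) (tnth x i)).
  by apply: measurable_funM => //; exact: measurable_prod_cauchy.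
under eq_integral do rewrite mulrDr EFinD mulrCA.
rewrite ge0_integralD//; last 4 first.
- by move=> x _; rewrite lee_fin mulr_ge0.
- by apply/measurable_EFinP; apply: measurable_funM.
- by move=> x _; rewrite lee_fin mulr_ge0// ltW.
- by apply/measurable_EFinP; apply: measurable_funM.
under eq_integral do rewrite mulrC EFinM.
rewrite ge0_integralZl_EFin//; last 2 first.
- by move=> x _; rewrite lee_fin.
- exact/measurable_EFinP.
rewrite intf mule1.
under [in X in (_ + X)%E]eq_integral do rewrite EFinM.
rewrite ge0_integralZl_EFin//; last 3 first.
- by move=> x _; rewrite lee_fin.
- exact/measurable_EFinP.
- exact: ltW.
under [in RHS]eq_integral do rewrite mulrDr mulr1 EFinD.
have iK : mud.-integrable setT (fun t => (\prod_i laplace_kernel e (tnth t i))%:E).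
  apply/integrableP; split; first by apply/measurable_EFinP; exact: measurable_laplace_prod.
  rewrite (eq_integral (fun t : T => (\prod_i laplace_kernel e (tnth t i))%:E)).
    by rewrite integral_laplace_mass// ltry.
  move=> t _; rewrite gee0_abs// lee_fin prodr_ge0// => i _.
  exact: laplace_kernel_ge0.
have iD : mud.-integrable setT (fun t => (damped e x0 t)%:E).
  by apply: integrable_le_phi; [exact: measurable_damped|move=> t; exact: damped_le].
rewrite integralD_EFin// integral_laplace_mass//.
move=> /(congr1 (fun z => z - ((2 / e) ^+ d)%:E)%E).
rewrite addeAC subee// add0e addeAC subee// add0e.
rewrite EFinM /Rintegral fineK; last exact: integrable_fin_num.
move=> <-; rewrite muleA -EFinM mulVf ?mul1e//.
by rewrite gt_eqF.
Qed.

(** The mass is (2/pi) atan(r/e), which tends to 1 as e -> 0. *)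
Lemma near_cauchy_mass (c r a : R) : 0 < r -> 0 < a ->
  \forall n \near \oo, ((1 - a)%:E <=
   \int[lebesgue_measure]_(x in `[(c - r)%R, (c + r)%R]) (cauchy_kernel (eps_seq n) c x)%:E)%E.
Proof.
move=> r0 a0.
have lim0 : atan (r / eps_seq n) @[n --> \oo] --> (pi / 2 : R).
  apply: (@cvg_comp _ _ _ _ _ _ (+oo)); last exact: cvgy_atan.
  apply/cvgryPge => A; near=> n.
  rewrite /eps_seq invrK mulrC -ler_pdivrMr// -natr1.
  have : A / r <= n%:R by near: n; exact: nbhs_infty_ger.
  by move=> /le_trans; apply; rewrite lerDl.
have lim : (pi^-1 * (2 * atan (r / eps_seq n))) @[n --> \oo] --> (1 : R).
  have pi1 : pi^-1 * (2 * (pi / 2)) = 1 :> R.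
    by rewrite (mulrCA 2) divff// mulr1 mulVf// gt_eqF ?pi_gt0.
  rewrite -[X in _ --> X]pi1.
  exact: cvgM (cvg_cst _) (cvgM (cvg_cst _) lim0).
have : \forall n \near \oo, 1 - a <= pi^-1 * (2 * atan (r / eps_seq n)).
  by apply: (cvgr_ge _ lim); lra.
by apply: filterS => n; rewrite integral_cauchy_itv ?eps_seq_gt0// lee_fin.
Unshelve. all: by end_near. Qed.

Lemma cvg_damped (x0 : 'rV[R]_d) :
  (\int[mud]_t damped (eps_seq n) x0 t) @[n --> \oo] --> fourier_inv x0.
Proof.
have ptw (t : T) : damped (eps_seq n) x0 t @[n --> \oo] -->
    phi (row_of_tuple t) * cos (dot t (x0 0)).
  rewrite -[X in _ --> X]mul1r; apply: cvgM; last exact: cvg_cst.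
  rewrite -[X in _ --> X](@big1_eq R 1 *%R 'I_d (index_enum _) xpredT).
  apply: cvg_big => [|i _]; first exact: mul_continuous.
  have -> : (1 : R) = laplace_kernel 0 (tnth t i) by rewrite /laplace_kernel mul0r oppr0 expR0.
  apply: (@cvg_comp _ _ _ eps_seq (fun e => laplace_kernel e (tnth t i)) _ (nbhs 0)).
    exact: cvg_eps_seq.
  apply: (@continuous_comp _ _ _ (fun e : R => - (e * `|tnth t i|)) expR); last exact: continuous_expR.
  by apply: cvgN; apply: cvgM; [exact: cvg_id|exact: cvg_cst].
have [] := @dominated_convergence _ T R mud setT measurableT
  (fun n t => (damped (eps_seq n) x0 t)%:E)
  (fun t => (phi (row_of_tuple t) * cos (dot t (x0 0)))%:E)
  (fun t => (phi (row_of_tuple t))%:E).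
- by move=> n; apply/measurable_EFinP; exact: measurable_damped.
- apply/measurable_EFinP; apply: measurable_funM => //; exact: measurable_cos_dot0.
- by apply: aeW => t _; apply: cvg_EFin; [exact: nearW|exact: ptw].
- exact: integrable_phi.
- apply: aeW => t n _; rewrite lee_fin; exact: damped_le (eps_seq_gt0 n).
move=> iG _ H.
rewrite /fourier_inv /Rintegral; apply: fine_cvg.
rewrite fineK; last by exact: integrable_fin_num.
exact: H.
Qed.

(** [concentration] bounds kernel means from below, so it is applied to M - f, nonnegative by the
    bound on [f]. Since the Cauchy kernels have mass 1, this bounds the Cauchy means of [f] from
    above by f x0 + a, and these means tend to the normalised inverse transform. *)
Lemma fourier_inv_le (M : R) (x0 : 'rV[R]_d) : (forall x, f x <= M) ->
  fourier_inv x0 <= (2 * pi) ^+ d * f x0.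
Proof.
move=> fM.
have P0 : 0 < (2 * pi : R) ^+ d by rewrite exprn_gt0// mulr_gt0// pi_gt0.
rewrite mulrC -ler_pdivrMr// mulrC.
apply/ler_addgt0Pl => a a0.
have lim : (((2 * pi) ^+ d)^-1 * \int[mud]_t damped (eps_seq n) x0 t) @[n --> \oo] -->
    ((2 * pi) ^+ d)^-1 * fourier_inv x0.
  by apply: cvgM; [exact: cvg_cst|exact: cvg_damped].
apply: (cvgr_to_le lim).
have mg : measurable_fun [set: T] (fun t => M - f (row_of_tuple t)).
  exact: measurable_funB.
have M0 : 0 <= M by rewrite (le_trans (f0 0)).
have := @concentration R d (fun x => M - f x)
  (fun n i => cauchy_kernel (eps_seq n) (x0 0 i)) [:: x0] a.
have h1 : forall x, 0 <= M - f x by move=> x; rewrite subr_ge0.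
have h2 : continuous (fun x => M - f x).
  move=> x; apply: (@continuous_comp _ _ _ f (fun y => M - y)); first exact: cf.
  by apply: cvgB; [exact: cvg_cst|exact: cvg_id].
have h3 n (i : 'I_d) : measurable_fun setT (cauchy_kernel (eps_seq n) (x0 0 i)).
  by apply: continuous_measurable_fun; apply: continuous_cauchy_kernel; exact: eps_seq_gt0.
have h4 n (i : 'I_d) t : 0 <= cauchy_kernel (eps_seq n) (x0 0 i) t.
  by apply: cauchy_kernel_ge0; exact: eps_seq_gt0.
move=> /(_ h1 h2 mg h3 h4 erefl) H.
have : \forall n \near \oo, ((M - f x0 - a)%:E <= \int[mud]_t ((M - f (row_of_tuple t)) *
     \prod_i cauchy_kernel (eps_seq n) (x0 0%R i) (tnth t i))%:E)%E.
  rewrite big_seq1 in H; apply: H => // p i r b; rewrite inE => /eqP -> r0 b0.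
  exact: near_cauchy_mass.
apply: filterS => n Hn.
have e0 := eps_seq_gt0 n.
have E : (\int[mud]_t ((M - f (row_of_tuple t)) *
     \prod_i cauchy_kernel (eps_seq n) (x0 0%R i) (tnth t i))%:E +
   (((2 * pi) ^+ d)^-1 * \int[mud]_t damped (eps_seq n) x0 t)%:E = M%:E)%E.
  rewrite -integral_f_cauchy// -ge0_integralD//.
  - under eq_integral do rewrite -EFinD -mulrDl subrK EFinM.
    rewrite ge0_integralZl_EFin//.
    + rewrite (@ge0_integral_lebesgue_tuple_prod R d (fun i => cauchy_kernel (eps_seq n) (x0 0 i)))//.
      by rewrite big1 ?mule1// => i _; exact: integral_cauchy.
    + by move=> t _; rewrite lee_fin prodr_ge0.
    + by apply/measurable_EFinP; exact: measurable_prod_cauchy.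
  - by move=> t _; rewrite lee_fin mulr_ge0// prodr_ge0.
  - by apply/measurable_EFinP; apply: measurable_funM => //; exact: measurable_prod_cauchy.
  - by move=> t _; rewrite lee_fin mulr_ge0// prodr_ge0.
  - by apply/measurable_EFinP; apply: measurable_funM => //; exact: measurable_prod_cauchy.
have := leeD Hn (lexx (((2 * pi) ^+ d)^-1 * \int[mud]_t damped (eps_seq n) x0 t)%:E).
rewrite E -EFinD lee_fin.
by set X := _ * (\int[mud]_t _); lra.
Qed.

End Inversion.

(** * Poisson summation *)

Section Fejer.
Context (R : realType).
Local Notation mu := (@lebesgue_measure R).

Lemma near_inf_div_le (M a : R) : 0 <= M -> 0 < a -> \forall n \near \oo, M / n.+1%:R <= a.
Proof.
move=> M0 a0; near=> n; rewrite ler_pdivrMr// mulrC -ler_pdivrMr//.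
have : M / a <= n%:R by near: n; exact: nbhs_infty_ger.
by move=> /le_trans; apply; rewrite ler_nat.
Unshelve. all: by end_near. Qed.

Lemma cos_add2piz (x : R) (m : int) : cos (x + 2 * pi * m%:~R) = cos x.
Proof.
have H (n : nat) (y : R) : cos (y + 2 * pi * n%:R) = cos y.
  by rewrite [2 * pi]mulr_natl mulr_natr (periodicn (@cosD2pi R)).
case: m => n; first exact: H.
rewrite NegzE mulrNz mulrN; have := H n.+1 (x - 2 * pi * n.+1%:R).
by rewrite subrK => <-.
Qed.

(** This is |1 + z + ... + z^n|^2 / (n + 1) with z = e^(i th); as a sum of two real squares it is
    visibly nonnegative. *)
Definition fejer (n : nat) (th : R) : R :=
  n.+1%:R^-1 * ((\sum_(a < n.+1) cos (a%:R * th)) ^+ 2 +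
                (\sum_(a < n.+1) sin (a%:R * th)) ^+ 2).

Lemma fejer_ge0 n th : 0 <= fejer n th.
Proof. by rewrite mulr_ge0 ?invr_ge0// addr_ge0// sqr_ge0. Qed.

Lemma sum_cossin_sqr n (th : R) :
  (\sum_(a < n) cos (a%:R * th)) ^+ 2 + (\sum_(a < n) sin (a%:R * th)) ^+ 2 =
  \sum_(a < n) \sum_(b < n) cos (a%:R * th - b%:R * th).
Proof.
rewrite !expr2 !big_distrlr /= -big_split /=; apply: eq_bigr => a _.
by rewrite -big_split /=; apply: eq_bigr => b _; rewrite cosB.
Qed.

(* D (1 - z) = 1 - z^n for D = 1 + z + ... + z^(n-1), z = e^(i th), whence
   |D|^2 |1 - z|^2 <= 4. *)
Lemma fejer_bound n th : fejer n th * (1 - cos th) <= 2 / n.+1%:R.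
Proof.
have natS_mul k : k.+1%:R * th = k%:R * th + th by rewrite -natr1 mulrDl mul1r.
pose C k := \sum_(a < k) cos (a%:R * th); pose S k := \sum_(a < k) sin (a%:R * th).
have HC k : C k - (C k * cos th - S k * sin th) = 1 - cos (k%:R * th).
  elim: k => [|k IH]; first by rewrite /C /S !big_ord0 !mul0r cos0; ring.
  rewrite /C /S !big_ord_recr /= -/(C k) -/(S k) natS_mul cosD.
  by move: IH; set c := cos (k%:R * th); lra.
have HS k : S k - (C k * sin th + S k * cos th) = - sin (k%:R * th).
  elim: k => [|k IH]; first by rewrite /C /S !big_ord0 !mul0r sin0; ring.
  rewrite /C /S !big_ord_recr /= -/(C k) -/(S k) natS_mul sinD.
  by move: IH; set c := sin (k%:R * th); lra.
rewrite /fejer -/(C _) -/(S _) -mulrA mulrC ler_pM2r ?invr_gt0//.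
have : ((C n.+1) ^+ 2 + (S n.+1) ^+ 2) * (2 - 2 * cos th) =
    (1 - cos (n.+1%:R * th)) ^+ 2 + (- sin (n.+1%:R * th)) ^+ 2.
  rewrite -HC -HS.
  have -> : 2 - 2 * cos th = (1 - cos th) ^+ 2 + sin th ^+ 2.
    by rewrite sin2cos2; ring.
  ring.
have -> : (1 - cos (n.+1%:R * th)) ^+ 2 + (- sin (n.+1%:R * th)) ^+ 2 =
  2 - 2 * cos (n.+1%:R * th) by rewrite sqrrN sin2cos2; ring.
have := cos_geN1 (n.+1%:R * th).
by lra.
Qed.

Lemma cos_affineE (j w c t : R) : cos (j * (w * (t - c))) = cos (t * (j * w) + - (j * w * c)).
Proof. by congr cos; ring. Qed.

Lemma continuous_cos_affine (a b : R) : continuous (fun t : R => cos (t * a + b)).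
Proof.
move=> t; apply: continuous_comp; last exact: continuous_cos.
by apply: cvgD; [apply: cvgM; [exact: cvg_id|exact: cvg_cst]|exact: cvg_cst].
Qed.

Lemma continuous_cos_phase (j w c : R) : continuous (fun t : R => cos (j * (w * (t - c)))).
Proof.
have -> : (fun t : R => cos (j * (w * (t - c)))) =
    (fun t => cos (t * (j * w) + - (j * w * c))).
  by apply/funext => u; rewrite cos_affineE.
exact: continuous_cos_affine.
Qed.

Lemma integral_cos_period (P c q : R) (j : int) : 0 < P ->
  (\int[mu]_(t in `[(q - P / 2)%R, (q + P / 2)%R])
     (cos (j%:~R * (2 * pi / P * (t - c))))%:E = (if j == 0 then P else 0)%:E)%E.
Proof.
move=> P0; case: eqP => [->|/eqP j0].
  under eq_integral do rewrite mulr0z mul0r cos0.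
  rewrite integral_cst//= mul1e lebesgue_measure_itv/= lte_fin.
  rewrite ifT; last by lra.
  by rewrite -EFinD; congr EFin; lra.
set w := 2 * pi / P.
have w0 : j%:~R * w != 0.
  by rewrite mulf_neq0 ?intr_eq0// mulf_neq0 ?invr_eq0 ?gt_eqF// mulr_gt0// pi_gt0.
under eq_integral do rewrite cos_affineE.
pose F (t : R) := (j%:~R * w)^-1 * sin (t * (j%:~R * w) + - (j%:~R * w * c)).
have dF (t : R) : is_derive t (1:R) F (cos (t * (j%:~R * w) + - (j%:~R * w * c))).
  have H1 := is_derive_affine (j%:~R * w) (- (j%:~R * w * c)) t.
  have S1 : is_derive t (1:R) (sin \o (fun t => t * (j%:~R * w) + - (j%:~R * w * c))) _ :=
    is_derive1_comp (is_derive_sin _) H1.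
  have S2 := is_deriveZ (j%:~R * w)^-1 S1.
  apply: (is_derive_eq S2).
  by rewrite /GRing.scale/= mulrCA mulVf ?mulr1.
have cF (t : R) : {for t, continuous F}.
  by apply: differentiable_continuous; apply/derivable1_diffP; apply: ex_derive.
rewrite (@continuous_FTC2 _ _ F).
- rewrite -EFinD; congr EFin; apply/eqP; rewrite subr_eq0; apply/eqP; congr (_ * _).
  have -> : (q + P / 2) * (j%:~R * w) + - (j%:~R * w * c) =
    (q - P / 2) * (j%:~R * w) + - (j%:~R * w * c) + 2 * pi * j%:~R.
    rewrite /w; field; exact: lt0r_neq0.
  (* Sines become cosines shifted by pi/2, so that [cos_add2piz] applies. *)
  rewrite -[LHS]cosBpihalf -[RHS]cosBpihalf -[RHS](cos_add2piz _ j).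
  by congr cos; ring.
- by lra.
- exact: continuous_subspaceT (@continuous_cos_affine _ _).
- split.
  + by move=> t _; apply: ex_derive.
  + exact/cvg_at_right_filter/cF.
  + exact/cvg_at_left_filter/cF.
- by move=> t _; rewrite derive1E; exact: derive_val.
Qed.

(** It has mass 1 on each period and concentrates at every point of c + P Z: on the whole line it
    approximates a Dirac comb, so that testing against it produces lattice sums. *)
Definition fejer_kernel (P c : R) (n : nat) (t : R) : R :=
  P^-1 * fejer n (2 * pi / P * (t - c)).

Lemma fejer_kernel_ge0 (P c : R) n t : 0 < P -> 0 <= fejer_kernel P c n t.
Proof. by move=> P0; rewrite mulr_ge0 ?fejer_ge0// invr_ge0 ltW. Qed.

Lemma fejer_kernelE (P c : R) n t : fejer_kernel P c n t =
  \sum_(a < n.+1) \sum_(b < n.+1)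
    (P^-1 * n.+1%:R^-1) * cos ((a%:Z - b%:Z)%:~R * (2 * pi / P * (t - c))).
Proof.
rewrite /fejer_kernel /fejer sum_cossin_sqr mulrA mulr_sumr; apply: eq_bigr => a _.
by rewrite mulr_sumr; apply: eq_bigr => b _; rewrite intrB mulrBl.
Qed.

Lemma continuous_fejer_kernel (P c : R) n : continuous (fejer_kernel P c n).
Proof.
have -> : fejer_kernel P c n = fun t => \sum_(a < n.+1) \sum_(b < n.+1)
    (P^-1 * n.+1%:R^-1) * cos ((a%:Z - b%:Z)%:~R * (2 * pi / P * (t - c))).
  by apply/funext => t; rewrite fejer_kernelE.
have cadd : continuous (fun x : R * R => x.1 + x.2) by exact: add_continuous.
apply: (continuous_big cadd) => a _; apply: (continuous_big cadd) => b _ t.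
by apply: cvgM; [exact: cvg_cst|exact: continuous_cos_phase].
Qed.

Lemma integral_fejer_period (P c q : R) n : 0 < P ->
  (\int[mu]_(t in `[(q - P / 2)%R, (q + P / 2)%R]) (fejer_kernel P c n t)%:E = 1%:E)%E.
Proof.
move=> P0.
have icos0 (j : int) : mu.-integrable `[(q - P / 2)%R, (q + P / 2)%R]
    (fun t => (cos (j%:~R * (2 * pi / P * (t - c))))%:E).
  apply: continuous_compact_integrable; first exact: segment_compact.
  by apply: continuous_subspaceT; exact: continuous_cos_phase.
have icos (j : int) : mu.-integrable `[(q - P / 2)%R, (q + P / 2)%R]
    (fun t => (P^-1 * n.+1%:R^-1 * cos (j%:~R * (2 * pi / P * (t - c))))%:E).
  exact: (integrableZl _ _ (icos0 j)).
have Icos (j : int) : (\int[mu]_(t in `[(q - P / 2)%R, (q + P / 2)%R])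
    (P^-1 * n.+1%:R^-1 * cos (j%:~R * (2 * pi / P * (t - c))))%:E =
    (P^-1 * n.+1%:R^-1 * (if j == 0 then P else 0))%:E)%E.
  under eq_integral do rewrite EFinM.
  by rewrite integralZl// integral_cos_period.
under eq_integral => t _.
  rewrite fejer_kernelE -sumEFin.
  under eq_bigr do rewrite -sumEFin.
  over.
rewrite integral_sum//; last by move=> a; apply: integrable_sum.
have sum1 (a : 'I_n.+1) : (\int[mu]_(t in `[(q - P / 2)%R, (q + P / 2)%R])
   (\sum_(b < n.+1) (P^-1 * n.+1%:R^-1 * cos ((a%:Z - b%:Z)%:~R * (2 * pi / P * (t - c))))%:E)
   = (n.+1%:R^-1)%:E)%E.
  rewrite integral_sum//.
  rewrite (bigD1 a)//= big1 ?adde0 => [|b ba].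
    rewrite Icos subrr eqxx; congr EFin.
    by rewrite mulrAC mulVf ?mul1r// gt_eqF.
  by rewrite Icos subr_eq0 eqz_nat (inj_eq val_inj) eq_sym (negbTE ba) mulr0.
rewrite (eq_bigr (fun=> (n.+1%:R^-1)%:E)) => [|a _]; last exact: sum1.
by rewrite sumEFin sumr_const card_ord -(mulr_natr n.+1%:R^-1) mulVf.
Qed.

(** In the period centred at q, by [fejer_bound], the kernel at distance more than s from q is at
    most 2 / (K P (n + 1)), K = 1 - cos(2 pi s / P). That part of the mass vanishes as n grows,
    while the whole period has mass 1. *)
Lemma near_fejer_mass (P c r a : R) (m : int) : 0 < P -> 0 < r -> 0 < a ->
  \forall n \near \oo, ((1 - a)%:E <= \int[mu]_(t in
     `[(c + P * m%:~R - r)%R, (c + P * m%:~R + r)%R]) (fejer_kernel P c n t)%:E)%E.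
Proof.
move=> P0 r0 a0; set q := c + P * m%:~R.
(* The cap P/4 keeps the window inside one period and the angle 2 pi s / P at most pi/2, where
   cosine is decreasing; hence K > 0. *)
pose s := Num.min r (P / 4).
have s0 : 0 < s by rewrite lt_min r0 divr_gt0.
have sr : s <= r by rewrite ge_min lexx.
have sP : s <= P / 4 by rewrite ge_min lexx orbT.
pose K := 1 - cos (2 * pi / P * s).
have p0 := pi_gt0 R.
have w0 : 0 < 2 * pi / P by rewrite divr_gt0// mulr_gt0.
have ws : 2 * pi / P * s <= pi / 2.
  rewrite (le_trans (ler_wpM2l (ltW w0) sP))//.
  by rewrite le_eqVlt; apply/orP; left; apply/eqP; field; exact: lt0r_neq0.
have ws0 : 0 < 2 * pi / P * s by rewrite mulr_gt0.
have ws1 : 2 * pi / P * s <= pi by lra.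
have K0 : 0 < K.
  by rewrite subr_gt0 -[X in _ < X](cos0 R) ltr_cos ?in_itv/= ?lexx ?(ltW ws0) ?ws1 ?(ltW p0).
have M0 : 0 <= 2 / K by rewrite divr_ge0// ltW.
apply: filterS (near_inf_div_le M0 a0) => n Hn.
have far t : t \in `[q - P / 2, q + P / 2] -> s < `|t - q| ->
    fejer_kernel P c n t <= P^-1 * a.
  rewrite in_itv /= -ler_distl => tq ts.
  rewrite ler_pM2l ?invr_gt0//; apply: le_trans Hn.
  have tP : 2 * pi / P * `|t - q| <= pi.
    rewrite (le_trans (ler_wpM2l (ltW w0) tq))//.
    by rewrite le_eqVlt; apply/orP; left; apply/eqP; field; exact: lt0r_neq0.
  have cosE : cos (2 * pi / P * (t - c)) = cos (2 * pi / P * `|t - q|).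
    rewrite -[RHS]cos_norm normrM normr_id -normrM cos_norm.
    rewrite -[RHS](cos_add2piz _ m); congr cos; rewrite /q; field; exact: lt0r_neq0.
  have := fejer_bound n (2 * pi / P * (t - c)); rewrite cosE.
  have Kle : K <= 1 - cos (2 * pi / P * `|t - q|).
    have tP0 : 0 <= 2 * pi / P * `|t - q| by rewrite mulr_ge0// ltW.
    rewrite lerB// ltW// ltr_cos ?in_itv/= ?tP ?tP0 ?(ltW ws0) ?ws1//.
    by rewrite ltr_pM2l.
  have := fejer_ge0 n (2 * pi / P * (t - c)).
  move: (fejer n _) => F F0 FK.
  rewrite mulrAC ler_pdivlMr// (le_trans _ FK)//.
  by rewrite ler_wpM2l.
have mF : measurable_fun setT (fejer_kernel P c n).
  by apply: continuous_measurable_fun; exact: continuous_fejer_kernel.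
apply: (@le_trans _ _ (\int[mu]_(t in `[(q - s)%R, (q + s)%R]) (fejer_kernel P c n t)%:E)%E); last first.
  apply: ge0_subset_integral => //=.
  - exact/measurable_EFinP/measurable_funTS.
  - by move=> t _; rewrite lee_fin fejer_kernel_ge0.
  - by apply: subset_itv; rewrite bnd_simp; lra.
(* On the period the kernel is at most its restriction to the window plus the constant a/P, whose
   integral over the period is a. *)
have near1 : (1%:E <= \int[mu]_(t in `[(q - P / 2)%R, (q + P / 2)%R])
    ((fejer_kernel P c n t * \1_[set` `[q - s, q + s]%R] t)%:E + (P^-1 * a)%:E))%E.
  rewrite -(integral_fejer_period c q n P0).
  apply: ge0_le_integral => //=.
  - by move=> t _; rewrite lee_fin fejer_kernel_ge0.
  - exact/measurable_EFinP/measurable_funTS.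
  - by apply: emeasurable_funD => //; apply/measurable_EFinP/measurable_funTS; apply: measurable_funM.
  - move=> t tq; rewrite -EFinD lee_fin indicE mem_setE in_itv/= -ler_distl.
    have [ts|ts] := leP `|t - q| s.
      by rewrite mulr1 lerDl mulr_ge0 ?invr_ge0// ltW.
    by rewrite mulr0 add0r far.
rewrite ge0_integralD//= in near1; last 3 first.
- by move=> t _; rewrite lee_fin mulr_ge0 ?fejer_kernel_ge0.
- by apply/measurable_EFinP/measurable_funTS; apply: measurable_funM.
- by move=> t _; rewrite lee_fin mulr_ge0 ?invr_ge0// ltW.
rewrite integral_cst//= lebesgue_measure_itv/= lte_fin ifT in near1; last by lra.
have PE : (P^-1 * a * (q + P / 2 - (q - P / 2)) = a)%R.
  by field; exact: lt0r_neq0.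
rewrite -EFinD -EFinM PE in near1.
rewrite EFinB leeBlDr//; apply: (le_trans near1); rewrite leeD2r//.
rewrite [leRHS]integral_mkcond.
apply: (@le_trans _ _ (\int[mu]_t
    (fejer_kernel P c n t * \1_[set` `[q - s, q + s]%R] t)%:E)%E).
  apply: ge0_subset_integral => //=.
  - by apply/measurable_EFinP; apply: measurable_funM.
  - by move=> t _; rewrite lee_fin mulr_ge0 ?fejer_kernel_ge0.
apply: ge0_le_integral => //=.
- by move=> t _; rewrite lee_fin mulr_ge0 ?fejer_kernel_ge0.
- by apply/measurable_EFinP; apply: measurable_funM.
- apply/(measurable_restrictT _ _).1 => //.
  by apply/measurable_EFinP/measurable_funTS.
- by move=> t _; rewrite patchE indicE; case: (_ \in _); rewrite ?mulr1 ?mulr0.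
Qed.

End Fejer.

Section Expi.
Context (R : realType).
Local Open Scope complex_scope.

Definition expi (x : R) : R[i] := (cos x +i* sin x)%C.

Lemma expiD x y : expi (x + y) = expi x * expi y.
Proof. by rewrite /expi cosD sinD; simpc; congr (_ +i* _)%C; rewrite addrC. Qed.

Lemma expi0 : expi 0 = 1.
Proof. by rewrite /expi cos0 sin0. Qed.

Lemma expi_sum (I : Type) (r : seq I) (P : pred I) (u : I -> R) :
  expi (\sum_(i <- r | P i) u i) = \prod_(i <- r | P i) expi (u i).
Proof. exact: (big_morph expi expiD expi0). Qed.

Lemma Re_sum (I : Type) (r : seq I) (P : pred I) (u : I -> R[i]) :
  complex.Re (\sum_(i <- r | P i) u i) = \sum_(i <- r | P i) complex.Re (u i).
Proof. by apply: (@big_morph _ _ (@complex.Re R) 0 +%R 0 +%R) => // -[? ?] [? ?]. Qed.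

Lemma sum_expi (J : Type) (r : seq J) (u : J -> R) :
  \sum_(j <- r) expi (u j) = ((\sum_(j <- r) cos (u j)) +i* (\sum_(j <- r) sin (u j)))%C.
Proof. by elim: r => [|j r IH]; rewrite ?big_nil// !big_cons IH. Qed.

(** Each factor is a sum of exponentials times its conjugate. Distributivity turns the product over
    i into sums over the choice functions a and b, and real parts are taken at the end. *)
Lemma prod_cossin_sqr d (J : finType) (u : 'I_d -> J -> R) :
  \prod_i ((\sum_j cos (u i j)) ^+ 2 + (\sum_j sin (u i j)) ^+ 2) =
  \sum_(a : {ffun 'I_d -> J}) \sum_(b : {ffun 'I_d -> J})
     cos (\sum_i (u i (a i) - u i (b i))).
Proof.
have D i : ((\sum_j cos (u i j)) ^+ 2 + (\sum_j sin (u i j)) ^+ 2)%:C =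
    (\sum_j expi (u i j)) * (\sum_j expi (- u i j)).
  rewrite !sum_expi.
  under [X in _ * (X +i* _)%C]eq_bigr do rewrite cosN.
  under [X in _ * (_ +i* X)%C]eq_bigr do rewrite sinN.
  by rewrite sumrN; simpc; congr (_ +i* _)%C; ring.
have K : (\prod_i ((\sum_j cos (u i j)) ^+ 2 + (\sum_j sin (u i j)) ^+ 2))%:C =
  \sum_(a : {ffun 'I_d -> J}) \sum_(b : {ffun 'I_d -> J})
     expi (\sum_i (u i (a i) - u i (b i))).
  rewrite rmorph_prod /=; under eq_bigr do rewrite D.
  rewrite big_split /= !bigA_distr_bigA /= big_distrlr /=.
  apply: eq_bigr => a _; apply: eq_bigr => b _.
  by rewrite -!expi_sum -expiD -big_split.
have /= -> := congr1 (@complex.Re R) K.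
by rewrite Re_sum; apply: eq_bigr => a _; rewrite Re_sum.
Qed.

End Expi.

Section EsumFinite.
Context (R : realType) (T : choiceType).
Implicit Types h : T -> \bar R.

Lemma sum_le_esum h (s : seq T) : uniq s -> (forall x, 0 <= h x)%E ->
  (\sum_(x <- s) h x <= \esum_(x in [set: T]) h x)%E.
Proof.
move=> us h0; apply: esum_ge; exists [set` s]; last by rewrite -fsbig_seq.
by split => //; exact: finite_seq.
Qed.

Lemma sum_inj_le_esum h (I : finType) (e : I -> T) : injective e ->
  (forall x, 0 <= h x)%E -> (\sum_i h (e i) <= \esum_(x in [set: T]) h x)%E.
Proof.
move=> ie h0; rewrite -big_enum -(big_map e xpredT h) sum_le_esum//.
by rewrite map_inj_uniq// enum_uniq.
Qed.

Lemma esum_le_bound h M : (forall s : seq T, uniq s -> \sum_(x <- s) h x <= M)%E ->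
  (\esum_(x in [set: T]) h x <= M)%E.
Proof.
move=> hM; apply: ge_ereal_sup => /= _ [X [finX _] <-].
by rewrite fsbig_finite//=; apply: hM; exact: finmap.fset_uniq.
Qed.

End EsumFinite.

(** * Fejer means against lattice sums *)

Section Duality.
Context (R : realType) (d : nat).
Local Notation T := (d.-tuple (measurableTypeR R)).
Local Notation mud := (lebesgue_tuple R d).

Definition ffdiff n (a b : {ffun 'I_d -> 'I_n}) : 'rV[int]_d :=
  \row_i ((a i)%:Z - (b i)%:Z).

Lemma ffdiff_injr n (a : {ffun 'I_d -> 'I_n}) : injective (ffdiff a).
Proof.
move=> b b' /rowP H; apply/ffunP => i; have := H i; rewrite !mxE => /addrI /oppr_inj.
by move=> [] /val_inj.
Qed.

(** For each of the (n + 1)^d choices of a, the differences a - b are distinct as b varies, so the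
    inner sum is at most the full lattice sum; the normalisation averages over a. The Fejer weights
    never have to be computed. *)
Lemma fejer_mean_le (h : 'rV[int]_d -> R) n : (forall k, 0 <= h k) ->
  (((n.+1%:R ^+ d)^-1 * \sum_(a : {ffun 'I_d -> 'I_n.+1})
     \sum_(b : {ffun 'I_d -> 'I_n.+1}) h (ffdiff a b))%:E <=
   \esum_(k in [set: 'rV[int]_d]) (h k)%:E)%E.
Proof.
move=> h0; set S := (\esum_(k in _) _)%E.
have E0 : (0 <= S)%E by apply: esum_ge0 => k _; rewrite lee_fin.
have [->|Sfin] := eqVneq S +oo%E; first exact: leey.
have SE : S = (fine S)%:E by rewrite fineK// ge0_fin_numE// ltey.
have H a : \sum_(b : {ffun 'I_d -> 'I_n.+1}) h (ffdiff a b) <= fine S.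
  rewrite -lee_fin -SE -sumEFin.
  by apply: (sum_inj_le_esum (h := fun k => (h k)%:E) (@ffdiff_injr _ a)) => k; rewrite lee_fin.
rewrite SE lee_fin mulrC ler_pdivrMr ?exprn_gt0//.
rewrite (le_trans (ler_sum _ (fun a _ => H a)))// sumr_const card_ffun !card_ord.
by rewrite -(mulr_natr (fine S)) natrX.
Qed.

Lemma prod_fejer_kernel (P : R) (c : 'rV[R]_d) n (t : 'I_d -> R) :
  \prod_i fejer_kernel P (c 0 i) n (t i) =
  \sum_(a : {ffun 'I_d -> 'I_n.+1}) \sum_(b : {ffun 'I_d -> 'I_n.+1})
    ((P ^+ d)^-1 * (n.+1%:R ^+ d)^-1) *
    cos (\sum_i (ffdiff a b 0 i)%:~R * (2 * pi / P * (t i - c 0 i))).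
Proof.
rewrite /fejer_kernel /fejer big_split big_split /=.
rewrite !prodr_const card_ord -!exprVn mulrA.
rewrite (prod_cossin_sqr (fun i (j : 'I_n.+1) => j%:R * (2 * pi / P * (t i - c 0 i)))).
rewrite mulr_sumr; apply: eq_bigr => a _; rewrite mulr_sumr; apply: eq_bigr => b _.
congr (_ * cos _); apply: eq_bigr => i _.
by rewrite mxE intrB mulrBl.
Qed.

(** The integral of [g] against the product Fejer kernel is read in two ways: by [concentration] it
    nearly dominates the sum of [g] over a finite part of c + P Z^d, and expanding the kernel turns
    it into a Fejer mean of the Fourier coefficients [cc]. *)
Lemma fejer_lower (g : 'rV[R]_d -> R) (c : 'rV[R]_d) (P : R)
    (cc : 'rV[int]_d -> R) (S : seq 'rV[int]_d) (e : R) :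
  0 < P -> (forall x, 0 <= g x) -> continuous g ->
  measurable_fun [set: T] (fun t => g (row_of_tuple t)) ->
  (forall k : 'rV[int]_d, mud.-integrable setT (fun t => (g (row_of_tuple t) *
     cos (\sum_i (k 0 i)%:~R * (2 * pi / P * (tnth t i - c 0 i))))%:E)) ->
  (forall k : 'rV[int]_d, \int[mud]_t (g (row_of_tuple t) *
     cos (\sum_i (k 0 i)%:~R * (2 * pi / P * (tnth t i - c 0 i)))) = cc k) ->
  uniq S -> 0 < e ->
  \forall n \near \oo, P ^+ d * (\sum_(m <- S) g (c + P *: zrow R m)) - e <=
    (n.+1%:R ^+ d)^-1 * \sum_(a : {ffun 'I_d -> 'I_n.+1})
     \sum_(b : {ffun 'I_d -> 'I_n.+1}) cc (ffdiff a b).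
Proof.
move=> P0 g0 cg mg ig Ig uS e0.
have Pd0 : 0 < P ^+ d by rewrite exprn_gt0.
pose S' := [seq c + P *: zrow R m | m <- S].
have uS' : uniq S'.
  rewrite map_inj_uniq// => m m' /addrI /(scalerI (lt0r_neq0 P0)) /rowP H.
  by apply/rowP => i; have := H i; rewrite !mxE => /intr_inj.
have mk n (i : 'I_d) : measurable_fun setT (fejer_kernel P (c 0 i) n).
  by apply: continuous_measurable_fun; exact: continuous_fejer_kernel.
have k0 n (i : 'I_d) t : 0 <= fejer_kernel P (c 0 i) n t by exact: fejer_kernel_ge0.
have kS : forall (p : 'rV[R]_d) i r a, p \in S' -> 0 < r -> 0 < a -> \forall n \near \oo,
    ((1 - a)%:E <= \int[lebesgue_measure]_(x in `[(p 0%R i - r)%R, (p 0%R i + r)%R])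
      (fejer_kernel P (c 0%R i) n x)%:E)%E.
  move=> p i r a /mapP[m _ ->] r0 a0; rewrite !mxE.
  exact: near_fejer_mass.
have e1 : 0 < e / P ^+ d by rewrite divr_gt0.
have := concentration g0 cg mg mk k0 uS' kS e1.
apply: filterS => n.
rewrite (eq_integral (fun t : T => (\sum_(a : {ffun 'I_d -> 'I_n.+1})
   \sum_(b : {ffun 'I_d -> 'I_n.+1}) ((P ^+ d)^-1 * (n.+1%:R ^+ d)^-1)%:E *
    (g (row_of_tuple t) * cos (\sum_i (ffdiff a b 0%R i)%:~R *
      (2 * pi / P * (tnth t i - c 0%R i))))%:E)%E)); last first.
  move=> t _; rewrite (prod_fejer_kernel P c n (tnth t)) mulr_sumr -sumEFin.
  apply: eq_bigr => a _; rewrite mulr_sumr -sumEFin; apply: eq_bigr => b _.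
  by rewrite -EFinM mulrCA.
rewrite integral_sum//; last first.
  by move=> a; apply: integrable_sum => // b _; exact: integrableZl.
rewrite (eq_bigr (fun a : {ffun 'I_d -> 'I_n.+1} => (\sum_(b : {ffun 'I_d -> 'I_n.+1})
    ((P ^+ d)^-1 * (n.+1%:R ^+ d)^-1) * cc (ffdiff a b))%:E)); last first.
  move=> a _; rewrite integral_sum//; last by move=> b; exact: integrableZl.
  rewrite -sumEFin; apply: eq_bigr => b _; rewrite integralZl// [RHS]EFinM; congr (_ * _)%E.
  by rewrite -Ig /Rintegral fineK// integrable_fin_num.
rewrite sumEFin lee_fin.
rewrite (_ : \sum_(a : {ffun _ -> _}) _ = ((P ^+ d)^-1 * (n.+1%:R ^+ d)^-1) *
    \sum_(a : {ffun 'I_d -> 'I_n.+1}) \sum_(b : {ffun 'I_d -> 'I_n.+1})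
      cc (ffdiff a b)); last first.
  by rewrite mulr_sumr; apply: eq_bigr => a _; rewrite mulr_sumr.
rewrite big_map -mulrA => H.
have := ler_wpM2l (ltW Pd0) H.
by rewrite mulrBr mulVKf ?gt_eqF// [P ^+ d * (e / _)]mulrC divfK ?gt_eqF.
Qed.

End Duality.

(** * The two inequalities of the symmetrised Poisson formula *)

Section Poisson.
Context (R : realType) (d : nat) (f phi : 'rV[R]_d -> R).
Local Notation T := (d.-tuple (measurableTypeR R)).
Local Notation mud := (lebesgue_tuple R d).
Local Notation dot t x := (\sum_i tnth t i * x i).

Hypothesis f0 : forall x, 0 <= f x.
Hypothesis cf : continuous f.
Hypothesis mf : measurable_fun [set: T] (fun t => f (row_of_tuple t)).
Hypothesis intf : (\int[mud]_t (f (row_of_tuple t))%:E = 1%:E)%E.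
Hypothesis phi_ge0 : forall x, 0 <= phi x.
Hypothesis cphi : continuous phi.
Hypothesis mphi : measurable_fun [set: T] (fun t => phi (row_of_tuple t)).
Hypothesis phi_fin : (\int[mud]_t (phi (row_of_tuple t))%:E < +oo)%E.
Hypothesis phi_sum : forall h : R, 0 < h ->
  (\esum_(k in [set: 'rV[int]_d]) (phi (h *: zrow R k))%:E < +oo)%E.
Hypothesis charf : forall (y : 'rV[R]_d) b,
  (\int[mud]_x (f (row_of_tuple x) * (1 + cos (dot x (y 0) + b)))%:E =
   (1 + phi y * cos b)%:E)%E.

Lemma integrable_mul_cos (g : T -> R) (y : 'I_d -> R) b :
  (forall t, 0 <= g t) -> mud.-integrable setT (fun t => (g t)%:E) ->
  mud.-integrable setT (fun t => (g t * cos (dot t y + b))%:E).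
Proof.
move=> g0 ig; apply: (le_integrable _ _ _ ig) => //.
  apply/measurable_EFinP; apply: measurable_funM; last exact: measurable_cos_dot.
  by apply/measurable_EFinP; exact: measurable_int ig.
by move=> t _ /=; rewrite lee_fin normrM ler_piMr ?cos_max.
Qed.

Lemma integrable_f : mud.-integrable setT (fun t => (f (row_of_tuple t))%:E).
Proof.
apply/integrableP; split; first exact/measurable_EFinP.
under eq_integral do rewrite gee0_abs ?lee_fin//.
by rewrite intf ltry.
Qed.

Lemma Rintegral_f_cos (y : 'rV[R]_d) b :
  \int[mud]_x (f (row_of_tuple x) * cos (dot x (y 0) + b)) = phi y * cos b.
Proof.
have := charf y b.
under eq_integral do rewrite mulrDr mulr1 EFinD.
rewrite integralD_EFin//; last 2 first.
- exact: integrable_f.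
- by apply: integrable_mul_cos => //; exact: integrable_f.
rewrite intf => /(congr1 (fun z => z - 1%:E)%E).
rewrite addeAC subee// add0e => H.
by rewrite /Rintegral H /=; ring.
Qed.

Local Notation dotk k w x := (\sum_i ((k : 'rV[int]_d) 0 i)%:~R * (w * (x : 'rV[R]_d) 0 i)).

Lemma fejer_lower_f (x : 'rV[R]_d) (P : R) (S : seq 'rV[int]_d) (e : R) :
  0 < P -> uniq S -> 0 < e ->
  \forall n \near \oo, P ^+ d * (\sum_(m <- S) f (x + P *: zrow R m)) - e <=
    (n.+1%:R ^+ d)^-1 * \sum_(a : {ffun 'I_d -> 'I_n.+1})
     \sum_(b : {ffun 'I_d -> 'I_n.+1})
      (phi ((2 * pi / P) *: zrow R (ffdiff a b)) * cos (dotk (ffdiff a b) (2 * pi / P) x)).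
Proof.
move=> P0 uS e0; set w := 2 * pi / P.
have E (k : 'rV[int]_d) (t : T) : \sum_i (k 0 i)%:~R * (w * (tnth t i - x 0 i)) =
    dot t ((w *: zrow R k) 0) + - dotk k w x.
  by rewrite -sumrB; apply: eq_bigr => i _; rewrite !mxE; ring.
apply: (fejer_lower (cc := fun k => phi (w *: zrow R k) * cos (dotk k w x))) => //.
- move=> k; under eq_fun do rewrite E.
  by apply: integrable_mul_cos => //; exact: integrable_f.
- move=> k; rewrite -[cos (dotk _ _ _)]cosN -Rintegral_f_cos.
  by apply: eq_Rintegral => t _; rewrite E.
Qed.

(** The Fejer bounds at x and at 0, taken for a common n, add up to the weights 1 + cos. These make
    every term nonnegative, as [fejer_mean_le] demands. *)
Lemma lattice_f_le (x : 'rV[R]_d) (P : R) : 0 < P ->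
  (\esum_(k in [set: 'rV[int]_d]) (P ^+ d * (f (x + P *: zrow R k) + f (P *: zrow R k)))%:E <=
   \esum_(k in [set: 'rV[int]_d]) (phi ((2 * pi / P) *: zrow R k) *
      (1 + cos (dotk k (2 * pi / P) x)))%:E)%E.
Proof.
move=> P0; apply: esum_le_bound => S uS; apply/lee_addgt0Pr => e e0.
have e2 : 0 < e / 2 by rewrite divr_gt0.
have [n [H1 H2]] := filter_ex (filterI (fejer_lower_f x P0 uS e2) (fejer_lower_f 0 P0 uS e2)).
have := lerD H1 H2; rewrite -mulrDr.
rewrite (_ : \sum_(a : {ffun _ -> _}) _ + _ = \sum_(a : {ffun 'I_d -> 'I_n.+1})
     \sum_(b : {ffun 'I_d -> 'I_n.+1})
      (phi ((2 * pi / P) *: zrow R (ffdiff a b)) *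
       (1 + cos (dotk (ffdiff a b) (2 * pi / P) x)))); last first.
  rewrite -big_split; apply: eq_bigr => a _; rewrite -big_split; apply: eq_bigr => b _ /=.
  rewrite (_ : dotk (ffdiff a b) (2 * pi / P) 0 = 0) ?cos0; first by ring.
  by rewrite big1// => i _; rewrite !mxE !mulr0.
move=> H3.
have := @fejer_mean_le R d (fun k => phi ((2 * pi / P) *: zrow R k) *
       (1 + cos (dotk k (2 * pi / P) x))) n.
move=> /(_ _) H4.
have {}H4 := H4 (fun k => mulr_ge0 (phi_ge0 _) (one_cos_ge0 _)).
rewrite -leeBlDr//; apply: le_trans H4.
rewrite sumEFin -EFinB lee_fin; apply: le_trans H3.
rewrite -mulr_sumr big_split /= mulrDr.
under [X in _ <= _ + (_ * X - _)]eq_bigr do rewrite add0r.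
by lra.
Qed.

(** With period 1, f x is a single term of the left sum of [lattice_f_le], whose right side is at
    most twice the sum of phi(2 pi k), uniformly in x. *)
Lemma f_bounded : exists M, forall x, f x <= M.
Proof.
have h0 : 0 < 2 * pi / 1 :> R by rewrite divr1 mulr_gt0// pi_gt0.
have := phi_sum h0; set S := (\esum_(k in _) _)%E => Sfin.
exists (2 * fine S) => x.
have S0 : (0 <= S)%E by apply: esum_ge0 => k _; rewrite lee_fin.
rewrite -lee_fin EFinM fineK ?ge0_fin_numE//.
have := lattice_f_le x ltr01; set X := (\esum_(k in _) _)%E => HX.
have fX : ((f x)%:E <= X)%E.
  have H : ((1 ^+ d * (f (x + 1 *: zrow R (0 : 'rV[int]_d)) +
      f (1 *: zrow R (0 : 'rV[int]_d))))%:E <= X)%E.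
    have := @sum_le_esum R 'rV[int]_d
      (fun k => (1 ^+ d * (f (x + 1 *: zrow R k) + f (1 *: zrow R k)))%:E) [:: 0] erefl.
    rewrite big_seq1; apply => k.
    by rewrite lee_fin mulr_ge0 ?addr_ge0// expr1n.
  have Z : zrow R (0 : 'rV[int]_d) = 0 by apply/rowP => i; rewrite !mxE.
  apply: le_trans H; rewrite Z !scaler0 addr0 expr1n mul1r lee_fin.
  by rewrite lerDl.
apply: (le_trans fX); apply: (le_trans HX).
apply: esum_le_bound => s us; rewrite sumEFin.
apply: (@le_trans _ _ (\sum_(k <- s) 2 * phi ((2 * pi / 1) *: zrow R k))%:E).
  rewrite lee_fin; apply: ler_sum => k _; rewrite mulrC ler_wpM2r//.
  by have := cos_le1 (dotk k (2 * pi / 1) x); lra.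
rewrite -mulr_sumr EFinM lee_wpmul2l ?lee_fin// -sumEFin.
by apply: sum_le_esum => // k; rewrite lee_fin.
Qed.

Lemma dot_row (t : T) (y : 'I_d -> R) : dot t y = \sum_i (row_of_tuple t) 0 i * y i.
Proof. by apply: eq_bigr => i _; rewrite mxE. Qed.

Lemma fourier_inv_le_f (x : 'rV[R]_d) : fourier_inv phi x <= (2 * pi) ^+ d * f x.
Proof.
have [M fM] := f_bounded.
apply: (fourier_inv_le f0 cf mf intf phi_ge0 mphi phi_fin _ x fM) => t b.
rewrite -charf; apply: eq_integral => u _; congr (_ * (_ + cos (_ + _)))%:E.
by apply: eq_bigr => i _; rewrite mxE.
Qed.

(** Dual to [fejer_lower_f]: phi(t) (1 + cos(t.x)) is tested with period 2 pi / P, and the product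
    formula for cosines yields inverse transforms at P k and at x + P k, x - P k. *)
Lemma fejer_lower_phi (x : 'rV[R]_d) (P : R) (S : seq 'rV[int]_d) (e : R) :
  0 < P -> uniq S -> 0 < e ->
  \forall n \near \oo, (2 * pi / P) ^+ d * (\sum_(m <- S)
      (phi ((2 * pi / P) *: zrow R m) * (1 + cos (dotk m (2 * pi / P) x)))) - e <=
    (n.+1%:R ^+ d)^-1 * \sum_(a : {ffun 'I_d -> 'I_n.+1})
     \sum_(b : {ffun 'I_d -> 'I_n.+1})
      (fourier_inv phi (P *: zrow R (ffdiff a b)) +
       (fourier_inv phi (x + P *: zrow R (ffdiff a b)) + fourier_inv phi (x - P *: zrow R (ffdiff a b))) / 2).
Proof.
move=> P0 uS e0; set w := 2 * pi / P.
have w0 : 0 < w by rewrite divr_gt0// mulr_gt0// pi_gt0.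
have wP : 2 * pi / w = P.
  by rewrite /w invf_div mulrC divfK// gt_eqF// mulr_gt0// pi_gt0.
pose g (t : 'rV[R]_d) := phi t * (1 + cos (\sum_i t 0 i * x 0 i)).
have g0 t : 0 <= g t by rewrite mulr_ge0// one_cos_ge0.
have cg : continuous g.
  have cadd : continuous (fun x : R * R => x.1 + x.2) by exact: add_continuous.
  have cdot : continuous (fun t : 'rV[R]_d => \sum_i t 0 i * x 0 i).
    apply: (continuous_big cadd) => i _ u.
    apply: (@continuous_comp _ _ _ (fun t : 'rV[R]_d => t 0 i) ( *%R^~ (x 0 i))).
      exact: coord_continuous.
    exact: mulrr_continuous.
  have ccos : continuous (fun t : 'rV[R]_d => 1 + cos (\sum_i t 0 i * x 0 i)).
    move=> t; apply: (@continuous_comp _ _ _ _ (fun y : R => 1 + cos y)); first exact: cdot.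
    by apply: cvgD; [exact: cvg_cst|exact: continuous_cos].
  move=> t; have h1 : {for t, continuous phi} by exact: cphi.
  have h2 : {for t, continuous (fun t : 'rV[R]_d => 1 + cos (\sum_i t 0 i * x 0 i))}.
    exact: ccos.
  exact: continuousM h1 h2.
have ip : mud.-integrable setT (fun t => (phi (row_of_tuple t))%:E).
  exact: integrable_phi.
have ipc y : mud.-integrable setT (fun t => (phi (row_of_tuple t) * cos (dot t y))%:E).
  have -> : (fun t : T => (phi (row_of_tuple t) * cos (dot t y))%:E) =
     (fun t => (phi (row_of_tuple t) * cos (dot t y + 0))%:E).
    by apply/funext => t; rewrite addr0.
  exact: integrable_mul_cos.
have gE (k : 'rV[int]_d) (t : T) : g (row_of_tuple t) *
     cos (\sum_i (k 0 i)%:~R * (2 * pi / w * (tnth t i - (0 : 'rV[R]_d) 0 i))) =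
   phi (row_of_tuple t) * cos (dot t ((P *: zrow R k) 0)) +
   2^-1 * (phi (row_of_tuple t) * cos (dot t ((x + P *: zrow R k) 0))) +
   2^-1 * (phi (row_of_tuple t) * cos (dot t ((x - P *: zrow R k) 0))).
  rewrite wP /g -(dot_row t (x 0)).
  have -> : \sum_i (k 0 i)%:~R * (P * (tnth t i - (0 : 'rV[R]_d) 0 i)) = dot t ((P *: zrow R k) 0).
    by apply: eq_bigr => i _; rewrite !mxE; ring.
  have -> : dot t ((x + P *: zrow R k) 0) = dot t (x 0) + dot t ((P *: zrow R k) 0).
    by rewrite -big_split; apply: eq_bigr => i _ /=; rewrite !mxE; ring.
  have -> : dot t ((x - P *: zrow R k) 0) = dot t (x 0) - dot t ((P *: zrow R k) 0).
    by rewrite -sumrB; apply: eq_bigr => i _ /=; rewrite !mxE; ring.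
  by rewrite cosD cosB; field.
have i1 y := ipc y; have i2 y : mud.-integrable setT
    (fun t => (2^-1 * (phi (row_of_tuple t) * cos (dot t y)))%:E).
  exact: (integrableZl _ _ (ipc y)).
have i3 (k : 'rV[int]_d) : mud.-integrable setT (fun t => (phi (row_of_tuple t) * cos (dot t ((P *: zrow R k) 0)) +
   2^-1 * (phi (row_of_tuple t) * cos (dot t ((x + P *: zrow R k) 0))))%:E).
  exact: (integrableD _ (i1 _) (i2 _)).
have := fejer_lower (g := g) (c := 0) (P := w) (S := S)
  (cc := fun k => fourier_inv phi (P *: zrow R k) +
       (fourier_inv phi (x + P *: zrow R k) + fourier_inv phi (x - P *: zrow R k)) / 2) w0 g0 cg.
move=> /(_ e) H.
have {}H := H _ _ _ uS e0.
rewrite (_ : \sum_(m <- S) _ = \sum_(m <- S) g (0 + w *: zrow R m)); last first.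
  apply: eq_bigr => m _; rewrite add0r /g; congr (_ * (_ + cos _)).
  by apply: eq_bigr => i _; rewrite !mxE; ring.
apply: H.
- apply: measurable_funM => //.
  have -> : (fun t : T => 1 + cos (\sum_i row_of_tuple t 0 i * x 0 i)) =
     (fun t => 1 + cos (dot t (x 0) + 0)).
    by apply/funext => t; rewrite addr0 dot_row.
  exact: measurable_one_cos.
- move=> k; under eq_fun do rewrite gE.
  exact: (integrableD _ (i3 _) (i2 _)).
- move=> k.
  under eq_Rintegral do rewrite gE.
  rewrite RintegralD; [|exact: measurableT|exact: i3|exact: i2].
  rewrite RintegralD; [|exact: measurableT|exact: i1|exact: i2].
  rewrite RintegralZl; [|exact: measurableT|exact: i1].
  rewrite RintegralZl; [|exact: measurableT|exact: i1].
  rewrite /fourier_inv.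
  by field.
Qed.

Lemma ffdiffC n (a b : {ffun 'I_d -> 'I_n}) : ffdiff b a = - ffdiff a b.
Proof. by apply/rowP => i; rewrite !mxE opprB. Qed.

Lemma zrowN (k : 'rV[int]_d) : zrow R (- k) = - zrow R k.
Proof. by apply/rowP => i; rewrite !mxE mulrNz. Qed.

(** The Fejer mean of inverse transforms supplied by [fejer_lower_phi] is bounded by one of values
    of [f] through [fourier_inv_le_f], and then by the lattice sum. The two scales match since (2
    pi)^d = (2 pi / P)^d P^d. *)
Lemma lattice_phi_le (x : 'rV[R]_d) (P : R) : 0 < P ->
  (\esum_(k in [set: 'rV[int]_d]) (phi ((2 * pi / P) *: zrow R k) *
      (1 + cos (dotk k (2 * pi / P) x)))%:E <=
   \esum_(k in [set: 'rV[int]_d]) (P ^+ d * (f (x + P *: zrow R k) + f (P *: zrow R k)))%:E)%E.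
Proof.
move=> P0; apply: esum_le_bound => S uS; apply/lee_addgt0Pr => e e0.
have p0 : 0 < 2 * pi :> R by rewrite mulr_gt0// pi_gt0.
pose c := (2 * pi / P) ^+ d.
have c0 : 0 < c by rewrite exprn_gt0// divr_gt0.
have e2 : 0 < c * e by rewrite mulr_gt0.
have [n H1] := filter_ex (fejer_lower_phi x P0 uS e2).
pose h (k : 'rV[int]_d) := P ^+ d * (f (x + P *: zrow R k) + f (P *: zrow R k)).
have h0 k : 0 <= h k by rewrite mulr_ge0 ?addr_ge0// exprn_ge0// ltW.
rewrite -leeBlDr//; apply: le_trans (fejer_mean_le n h0).
rewrite sumEFin -EFinB lee_fin -(ler_pM2l c0) mulrBr.
apply: (le_trans H1).
rewrite mulrCA ler_wpM2l ?invr_ge0 ?exprn_ge0//.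
(* The factor cos makes [fourier_inv] see the average of f over x and -x, and
   swapping a and b turns one into the other. *)
pose u (k : 'rV[int]_d) := (2 * pi) ^+ d * f (P *: zrow R k).
pose v (k : 'rV[int]_d) := (2 * pi) ^+ d * f (x + P *: zrow R k).
apply: (@le_trans _ _ (\sum_(a : {ffun 'I_d -> 'I_n.+1}) \sum_(b : {ffun 'I_d -> 'I_n.+1})
   (u (ffdiff a b) + (v (ffdiff a b) + v (ffdiff b a)) / 2))).
  apply: ler_sum => a _; apply: ler_sum => b _.
  rewrite lerD ?fourier_inv_le_f// ler_pM2r ?invr_gt0// lerD ?fourier_inv_le_f//.
  by rewrite (ffdiffC a b) /v zrowN scalerN fourier_inv_le_f.
have sw : \sum_(a : {ffun 'I_d -> 'I_n.+1}) \sum_(b : {ffun 'I_d -> 'I_n.+1}) v (ffdiff b a) =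
  \sum_(a : {ffun 'I_d -> 'I_n.+1}) \sum_(b : {ffun 'I_d -> 'I_n.+1}) v (ffdiff a b).
  by rewrite exchange_big.
have -> : \sum_(a : {ffun 'I_d -> 'I_n.+1}) \sum_(b : {ffun 'I_d -> 'I_n.+1})
    (u (ffdiff a b) + (v (ffdiff a b) + v (ffdiff b a)) / 2) =
   \sum_(a : {ffun 'I_d -> 'I_n.+1}) \sum_(b : {ffun 'I_d -> 'I_n.+1})
    (u (ffdiff a b) + v (ffdiff a b)).
  rewrite (eq_bigr (fun a => \sum_b u (ffdiff a b) +
    (\sum_b v (ffdiff a b) + \sum_b v (ffdiff b a)) / 2)); last first.
    by move=> a _; rewrite big_split /= -mulr_suml big_split.
  rewrite big_split /= -mulr_suml big_split /= sw.
  rewrite [RHS](eq_bigr (fun a => \sum_b u (ffdiff a b) + \sum_b v (ffdiff a b))); last first.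
    by move=> a _; rewrite big_split.
  by rewrite big_split /=; field.
rewrite mulr_sumr; apply: ler_sum => a _; rewrite mulr_sumr; apply: ler_sum => b _.
rewrite /u /v /h /c expr_div_n -mulrDr mulrA divfK ?expf_neq0 ?lt0r_neq0//.
by rewrite addrC.
Qed.

Lemma poisson_summation (x : 'rV[R]_d) (P : R) : 0 < P ->
  (\esum_(k in [set: 'rV[int]_d]) (P ^+ d * (f (x + P *: zrow R k) + f (P *: zrow R k)))%:E =
   \esum_(k in [set: 'rV[int]_d]) (phi ((2 * pi / P) *: zrow R k) *
      (1 + cos (dotk k (2 * pi / P) x)))%:E)%E.
Proof. by move=> P0; apply/eqP; rewrite eq_le lattice_f_le ?lattice_phi_le. Qed.

End Poisson.

(** * The stable transform *)

Section PowerContinuity.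
Context (R : realType).

(** Away from 0 the power is differentiable; at 0, where it need not be, the ball of radius e^(1/p)
    serves directly. *)
Lemma continuous_norm_powR (p : R) : 0 < p -> continuous (fun y : R => `|y| `^ p).
Proof.
move=> p0 y; have [->|y0] := eqVneq y 0.
  apply/cvgrPdist_le => e e0; rewrite normr0 powR0 ?lt0r_neq0//.
  near=> z; rewrite sub0r normrN (ger0_norm (powR_ge0 _ _)).
  have zr : `|z| <= e `^ p^-1.
    near: z; apply/nbhs_ballP; exists (e `^ p^-1); first exact: powR_gt0.
    by move=> z; rewrite /ball /= sub0r normrN => /ltW.
  have n1 : `|z| \is Num.nneg by rewrite nnegrE.
  have n2 : e `^ p^-1 \is Num.nneg by rewrite nnegrE powR_ge0.
  have := ge0_ler_powR (ltW p0) n1 n2 zr.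
  by rewrite -powRrM mulVf ?lt0r_neq0// powRr1 ?(ltW e0).
apply: (@continuous_comp _ _ _ (fun y : R => `|y|) (fun z => z `^ p)).
  exact: norm_continuous.
apply: differentiable_continuous; apply/derivable1_diffP; apply: derivable_powR.
by rewrite in_itv /= andbT normr_gt0.
Unshelve. all: by end_near. Qed.

End PowerContinuity.

Section LatticeSums.
Context (R : realType).

Lemma ler_sum_uniq_sub (I : eqType) (s t : seq I) (F : I -> R) :
  uniq s -> uniq t -> {subset s <= t} -> (forall i, 0 <= F i) ->
  \sum_(i <- s) F i <= \sum_(i <- t) F i.
Proof.
move=> us ut st F0; rewrite (perm_big [seq i <- t | i \in s]).
  by rewrite big_filter big_mkcond; apply: ler_sum => i _; case: ifP.
apply: uniq_perm => //; first exact: filter_uniq.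
by move=> i; rewrite mem_filter; case: (boolP (i \in s)) => // /st ->.
Qed.

Lemma sum_inv_sqr_le (N : nat) : \sum_(n < N) ((n.+1%:R : R) ^+ 2)^-1 <= 2.
Proof.
(* Strengthened for the induction: 1/x^2 <= 2/x - 2/(x + 1) for x >= 1, so the bound telescopes. *)
suff : \sum_(n < N) ((n.+1%:R : R) ^+ 2)^-1 <= 2 - 2 / N.+1%:R.
  by move=> /le_trans; apply; rewrite gerBl divr_ge0.
elim: N => [|N IH]; first by rewrite big_ord0 divr1 subrr.
rewrite big_ord_recr /= (le_trans (lerD IH (lexx _)))//.
set x : R := N.+1%:R; have -> : N.+2%:R = x + 1 :> R by rewrite /x natr1.
have x1 : 1 <= x by rewrite /x ler1n.
have x0 : 0 < x by lra.
have x2 : 0 < x + 1 by lra.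
rewrite -addrA lerD2l -subr_ge0.
have -> : - (2 / (x + 1)) - (- (2 / x) + (x ^+ 2)^-1) = (x - 1) / (x ^+ 2 * (x + 1)).
  by field; rewrite !lt0r_neq0.
by rewrite divr_ge0 ?subr_ge0// mulr_ge0 ?exprn_ge0// ltW.
Qed.

Lemma sum_int_rational_le (h C : R) : 0 < h -> 0 < C -> exists2 B : R, 0 <= B &
  forall s : seq int, uniq s -> \sum_(j <- s) C / (1 + (h * j%:~R) ^+ 2) <= B.
Proof.
(* The choice of m gives m (1 + x^2) <= 1 + (h x)^2; with (x + 1)^2 <= 2 (1 + x^2) this compares
   each term with K / (x + 1)^2. *)
move=> h0 C0; pose m := Num.min 1 (h ^+ 2).
have m0 : 0 < m by rewrite lt_min ltr01 exprn_gt0.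
have m1 : m <= 1 by rewrite ge_min lexx.
have mh : m <= h ^+ 2 by rewrite ge_min lexx orbT.
pose K := 2 * C / m; have K0 : 0 < K by rewrite divr_gt0// mulr_gt0.
have r0 (j : int) : 0 <= C / (1 + (h * j%:~R) ^+ 2).
  by rewrite divr_ge0 ?ltW// ltr_wpDr ?sqr_ge0.
have bnd (x : R) : 0 <= x -> C / (1 + (h * x) ^+ 2) <= K * ((x + 1) ^+ 2)^-1.
  move=> x0; have x1 : 0 < (x + 1) ^+ 2 by rewrite exprn_gt0// ltr_wpDl.
  rewrite ler_pdivrMr ?ltr_wpDr ?sqr_ge0// mulrAC ler_pdivlMr//.
  rewrite /K mulrAC ler_pdivlMr// exprMn.
  have H1 : (x + 1) ^+ 2 <= 2 * (1 + x ^+ 2).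
    have := sqr_ge0 (x - 1); rewrite sqrrB1 sqrrD1; lra.
  have H2 : m * (1 + x ^+ 2) <= 1 + h ^+ 2 * x ^+ 2.
    by rewrite mulrDr mulr1 lerD// ler_wpM2r ?sqr_ge0.
  have H3 : m * (x + 1) ^+ 2 <= 2 * (1 + h ^+ 2 * x ^+ 2).
    by rewrite (le_trans (ler_wpM2l (ltW m0) H1))// mulrCA ler_pM2l.
  by rewrite -mulrA [_ * m]mulrC -mulrA mulrCA ler_pM2l.
exists (K * 2 + K * 2); first by rewrite addr_ge0// mulr_ge0// ltW.
move=> s us.
have [N sN] : exists N, forall j, j \in s -> (`|j| < N)%N.
  by exists (\max_(j <- s) `|j|%N).+1 => j js; rewrite ltnS leq_bigmax_seq.
(* [s] is enclosed in [-N, N). As [Negz n] is -(n + 1), either half is at most K times the sum of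
   the 1/(n + 1)^2. *)
pose t := [seq Posz n | n <- iota 0 N] ++ [seq Negz n | n <- iota 0 N].
apply: (@le_trans _ _ (\sum_(j <- t) C / (1 + (h * j%:~R) ^+ 2))).
  apply: ler_sum_uniq_sub => //.
    rewrite cat_uniq !map_inj_uniq ?iota_uniq ?andbT; try by move=> ? ? [].
    by apply/hasPn => j /mapP[n _ ->]; apply/mapP => -[].
  move=> j js; have jN := sN _ js.
  rewrite mem_cat; case: j js jN => n js jN; apply/orP; [left|right];
    apply/mapP; exists n => //; rewrite mem_iota add0n//=.
  by rewrite (leq_trans _ jN).
have iE : iota 0 N = index_iota 0 N by rewrite /index_iota subn0.
rewrite big_cat !big_map /= iE !big_mkord.
apply: lerD.
  apply: (@le_trans _ _ (K * \sum_(n < N) ((n.+1%:R : R) ^+ 2)^-1)).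
    rewrite mulr_sumr; apply: ler_sum => n _.
    by rewrite -natr1 bnd.
  by rewrite ler_pM2l// sum_inv_sqr_le.
apply: (@le_trans _ _ (K * \sum_(n < N) ((n.+1%:R : R) ^+ 2)^-1)).
  rewrite mulr_sumr; apply: ler_sum => n _.
  rewrite NegzE mulrNz mulrN sqrrN; apply: (le_trans (bnd _ _)) => //.
  rewrite ler_pM2l// lef_pV2 ?posrE ?exprn_gt0 ?ltr_wpDl//.
  by rewrite lerXn2r ?nnegrE ?addr_ge0// lerDl.
by rewrite ler_pM2l// sum_inv_sqr_le.
Qed.

(** [S] is enclosed in the box of all rows whose coordinates occur somewhere in [S], and the sum
    over a box factors into one-dimensional sums. *)
Lemma sum_lattice_prod_le d (r : int -> R) (B : R) :
  (forall j, 0 <= r j) -> (forall s, uniq s -> \sum_(j <- s) r j <= B) ->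
  forall S : seq 'rV[int]_d, uniq S ->
    \sum_(k <- S) \prod_i r (k 0 i) <= (2 * B) ^+ d.
Proof.
move=> r0 rB S uS.
pose s := undup (flatten [seq [seq (k : 'rV[int]_d) 0 i | i <- enum 'I_d] | k <- S]).
have us : uniq s by exact: undup_uniq.
have inS k i : k \in S -> k 0 i \in s.
  move=> kS; rewrite mem_undup; apply/flatten_mapP; exists k => //.
  by apply/mapP; exists i => //; rewrite mem_enum.
(* The successor keeps the index type inhabited. The surplus index reads the default coordinate 0
   and adds r 0 <= B, which is why the bound has 2 B. *)
pose e (k : 'rV[int]_d) : {ffun 'I_d -> 'I_(size s).+1} :=
  [ffun i => inord (index (k 0 i) s)].
have eK k i : k \in S -> nth 0 s (e k i) = k 0 i.
  move=> kS; rewrite ffunE inordK ?nth_index ?inS//.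
  by rewrite ltnS index_size.
pose G (a : {ffun 'I_d -> 'I_(size s).+1}) := \prod_i r (nth 0 s (a i)).
rewrite (@eq_big_seq _ _ _ _ _ _ (fun k => G (e k))); last first.
  by move=> k kS; apply: eq_bigr => i _; rewrite eK.
rewrite -(big_map e xpredT G) (le_trans (@ler_sum_uniq_sub _ _ (enum {ffun 'I_d -> 'I_(size s).+1}) _ _ _ _ _))//.
- rewrite map_inj_in_uniq// => k k' kS kS' ek; apply/rowP => i.
  by rewrite -(eK k i kS) -(eK k' i kS') ek.
- exact: enum_uniq.
- by move=> a _; rewrite mem_enum.
- by move=> a; apply: prodr_ge0.
rewrite big_enum /= (eq_bigl xpredT)// /G.
rewrite -(bigA_distr_bigA (fun (i : 'I_d) (j : 'I_(size s).+1) => r (nth 0 s j))).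
have bB : \sum_(j < (size s).+1) r (nth 0 s j) <= 2 * B.
  rewrite big_ord_recr /= -(big_mkord xpredT (fun j => r (nth 0 s j))) -(big_nth 0 xpredT).
  rewrite nth_default// mulr_natl mulr2n lerD ?rB//.
  by have := rB [:: 0] erefl; rewrite big_seq1.
rewrite -[X in _ ^+ X](card_ord d) -prodr_const; apply: ler_prod => i _.
by rewrite sumr_ge0.
Qed.

End LatticeSums.

Section StableTransform.
Context (R : realType) (d : nat).
Local Notation T := (d.-tuple (measurableTypeR R)).
Local Notation mud := (lebesgue_tuple R d).

Definition sqnorm (t : 'rV[R]_d) : R := \sum_i t 0 i ^+ 2.

Lemma sqnorm_ge0 t : 0 <= sqnorm t.
Proof. by apply: sumr_ge0 => i _; exact: sqr_ge0. Qed.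

Lemma sqnormZ (h : R) t : sqnorm (h *: t) = h ^+ 2 * sqnorm t.
Proof. by rewrite /sqnorm mulr_sumr; apply: eq_bigr => i _; rewrite mxE exprMn. Qed.

(** In terms of the squared norm, q = alpha / 2 treats the Gaussian case alpha = 2 and the others by
    one formula. *)
Definition stable_transform (ka q : R) (t : 'rV[R]_d) : R :=
  expR (- (ka * sqnorm t `^ q)).

Lemma stable_exponentE (alpha c sigma : R) : 0 < alpha -> 0 < c -> 0 < sigma ->
  exists2 ka : R, 0 < ka &
    forall t, stable_exponent alpha c sigma t = ka * sqnorm t `^ (alpha / 2).
Proof.
move=> a0 c0 s0; rewrite /stable_exponent /euclidean_norm; case: eqP => [->|_].
  exists (sigma ^+ 2 / 2) => [|t]; first by rewrite divr_gt0// exprn_gt0.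
  by rewrite divff// powRr1 ?sqnorm_ge0// sqr_sqrtr// sqnorm_ge0.
exists c => // t; rewrite -/(sqnorm t) -powR12_sqrt ?sqnorm_ge0// -powRrM.
by rewrite [alpha / 2]mulrC.
Qed.

Variables (ka q : R).
Hypothesis ka0 : 0 < ka.
Hypothesis q0 : 0 < q.
Local Notation phi := (stable_transform ka q).

Lemma stable_transform_ge0 t : 0 <= phi t. Proof. exact: expR_ge0. Qed.

Lemma continuous_stable_transform : continuous phi.
Proof.
have cadd : continuous (fun x : R * R => x.1 + x.2) by exact: add_continuous.
have csq : continuous sqnorm.
  apply: (continuous_big cadd) => i _ u.
  apply: (@continuous_comp _ _ _ (fun t : 'rV[R]_d => t 0 i) (fun y : R => y ^+ 2)).
    exact: coord_continuous.
  exact: exprn_continuous.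
have -> : phi = (fun t => expR (- (ka * `|sqnorm t| `^ q))).
  by apply/funext => t; rewrite (ger0_norm (sqnorm_ge0 t)).
move=> t; apply: (@continuous_comp _ _ _ sqnorm (fun y => expR (- (ka * `|y| `^ q)))).
  exact: csq.
apply: (@continuous_comp _ _ _ (fun y : R => - (ka * `|y| `^ q)) expR); last exact: continuous_expR.
by apply: cvgN; apply: cvgM; [exact: cvg_cst|exact: continuous_norm_powR].
Qed.

Lemma measurable_stable_transform :
  measurable_fun [set: T] (fun t => phi (row_of_tuple t)).
Proof.
have msq : measurable_fun [set: T] (fun t => sqnorm (row_of_tuple t)).
  have -> : (fun t : T => sqnorm (row_of_tuple t)) = (fun t => \sum_i (tnth t i) ^+ 2).
    by apply/funext => t; apply: eq_bigr => i _; rewrite mxE.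
  apply: measurable_sum => i; apply: measurable_funX; exact: measurable_tnth.
have mE : measurable_fun setT (fun y : R => expR (- (ka * `|y| `^ q))).
  apply: continuous_measurable_fun => y.
  apply: (@continuous_comp _ _ _ (fun y : R => - (ka * `|y| `^ q)) expR); last exact: continuous_expR.
  by apply: cvgN; apply: cvgM; [exact: cvg_cst|exact: continuous_norm_powR].
have -> : (fun t : T => phi (row_of_tuple t)) =
    (fun y : R => expR (- (ka * `|y| `^ q))) \o (fun t : T => sqnorm (row_of_tuple t)).
  by apply/funext => t /=; rewrite (ger0_norm (sqnorm_ge0 _)).
exact: (measurableT_comp mE msq).
Qed.

(** For s^2 > 1 the inequality e^u >= u^(N+1) / (N+1)! is used with q (N+1) >= 1, so that u^(N+1)
    dominates a multiple of s^2; the summand 2 of the constant covers s^2 <= 1. *)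
Lemma expRN_powR_le (b : R) : 0 < b ->
  exists2 C : R, 0 < C & forall s : R, expR (- (b * (s ^+ 2) `^ q)) <= C / (1 + s ^+ 2).
Proof.
move=> b0; have [N qN] : exists N : nat, 1 <= q * N.+1%:R.
  exists (Num.truncn q^-1); rewrite -ler_pdivrMl// mulr1 ltW//.
  exact: truncnS_gt.
exists (2 + 2 * (N.+1`!%:R / b ^+ N.+1)).
  by rewrite addr_gt0// mulr_gt0// divr_gt0 ?exprn_gt0// ltr0n fact_gt0.
move=> s; have s1 : 0 < 1 + s ^+ 2 by rewrite ltr_wpDr ?sqr_ge0.
rewrite ler_pdivlMr//.
have K0 : 0 <= N.+1`!%:R / b ^+ N.+1 :> R by rewrite divr_ge0 ?exprn_ge0 ?ler0n// ltW.
set u := b * _; have u0 : 0 <= u by rewrite mulr_ge0 ?powR_ge0// ltW.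
have e1 : expR (- u) <= 1 by rewrite -expR0 ler_expR oppr_le0.
have e0 := expR_ge0 (- u).
have [s2|s2] := leP (s ^+ 2) 1.
  apply: (@le_trans _ _ 2); last by rewrite lerDl mulr_ge0.
  rewrite -[leRHS]mul1r ler_pM ?(ltW s1)//; lra.
apply: (@le_trans _ _ (expR (- u) * (2 * s ^+ 2))).
  by rewrite ler_wpM2l//; lra.
apply: (@le_trans _ _ (2 * (N.+1`!%:R / b ^+ N.+1))); last by rewrite lerDr.
rewrite mulrCA ler_pM2l//.
have H : b ^+ N.+1 * s ^+ 2 <= u ^+ N.+1.
  rewrite /u exprMn ler_pM2l ?exprn_gt0// -(powR_mulrn N.+1 (powR_ge0 _ _)) -powRrM.
  rewrite -[leLHS]powRr1 ?sqr_ge0// ler_powR// ltW//.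
have F0 : 0 < N.+1`!%:R :> R by rewrite ltr0n fact_gt0.
have H2 : b ^+ N.+1 * s ^+ 2 / N.+1`!%:R <= expR u.
  have := expR_ge1Dxn N u0; have : b ^+ N.+1 * s ^+ 2 / N.+1`!%:R <= u ^+ N.+1 / N.+1`!%:R.
    by rewrite ler_pM2r// invr_gt0.
  by lra.
rewrite expRN mulrC ler_pdivrMr ?expR_gt0//.
rewrite mulrAC ler_pdivlMr ?exprn_gt0// mulrC.
by move: H2; rewrite ler_pdivrMr// [expR u * _]mulrC.
Qed.

Hypothesis d0 : (0 < d)%N.

(** The q-th power of the squared norm is at least that of each squared coordinate, hence at least
    their average, which splits the exponential into d factors. A product bound reduces
    integrability and summability to dimension one. *)
Lemma stable_transform_prod_le : exists2 C : R, 0 < C &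
  forall t : 'rV[R]_d, phi t <= \prod_i (C / (1 + (t 0 i) ^+ 2)).
Proof.
have dR : 0 < d%:R :> R by rewrite ltr0n.
have b0 : 0 < ka / d%:R by rewrite divr_gt0.
have [C C0 HC] := expRN_powR_le b0.
exists C => // t.
apply: (@le_trans _ _ (\prod_(i < d) expR (- (ka / d%:R * (t 0 i ^+ 2) `^ q)))); last first.
  by apply: ler_prod => i _; rewrite expR_ge0 HC.
rewrite -expR_sum ler_expR sumrN lerN2 -mulr_sumr -mulrA ler_pM2l// mulrC ler_pdivrMr//.
rewrite (@le_trans _ _ (\sum_(i < d) sqnorm t `^ q))//; last first.
  by rewrite sumr_const card_ord mulr_natr.
apply: ler_sum => i _; apply: ge0_ler_powR; rewrite ?nnegrE ?sqr_ge0 ?sqnorm_ge0 ?(ltW q0)//.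
by rewrite /sqnorm (bigD1 i)//= lerDl sumr_ge0// => j _; exact: sqr_ge0.
Qed.

Lemma integral_stable_transform_fin :
  (\int[mud]_t (phi (row_of_tuple t))%:E < +oo)%E.
Proof.
have [C C0 HC] := stable_transform_prod_le.
have cE (s : R) : C / (1 + s ^+ 2) = C * pi * cauchy_kernel 1 0 s.
  rewrite /cauchy_kernel subr0 expr1n mulrA mulfK ?gt_eqF ?pi_gt0//.
  by rewrite mul1r.
have mc : measurable_fun setT (fun s : R => C / (1 + s ^+ 2)).
  have -> : (fun s : R => C / (1 + s ^+ 2)) = (fun s => C * pi * cauchy_kernel 1 0 s).
    exact/funext.
  apply: measurable_funM => //; apply: continuous_measurable_fun.
  exact: continuous_cauchy_kernel.
have c0 (s : R) : 0 <= C / (1 + s ^+ 2).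
  by rewrite divr_ge0 ?ltW// ltr_wpDr ?sqr_ge0.
apply: (@le_lt_trans _ _ (\int[mud]_t (\prod_i (C / (1 + (tnth t i) ^+ 2)))%:E)%E).
  apply: ge0_le_integral => //.
  - by move=> t _; rewrite lee_fin stable_transform_ge0.
  - by apply/measurable_EFinP; exact: measurable_stable_transform.
  - apply/measurable_EFinP.
    exact: (@measurable_prod_tnth R d (fun i s => C / (1 + s ^+ 2))).
  - move=> t _; rewrite lee_fin (le_trans (HC _))//.
    by under eq_bigr do rewrite mxE.
rewrite (@ge0_integral_lebesgue_tuple_prod R d (fun i s => C / (1 + s ^+ 2)))//.
rewrite (eq_bigr (fun=> (C * pi)%:E)).
  by rewrite prodEFin ltry.
move=> i _; under eq_integral do rewrite cE EFinM.
rewrite ge0_integralZl_EFin//.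
- by rewrite integral_cauchy// mule1.
- by move=> s _; rewrite lee_fin cauchy_kernel_ge0.
- by apply/measurable_EFinP; apply: continuous_measurable_fun; exact: continuous_cauchy_kernel.
- by rewrite mulr_ge0// ltW// pi_gt0.
Qed.

Lemma sum_stable_transform_fin (h : R) : 0 < h ->
  (\esum_(k in [set: 'rV[int]_d]) (phi (h *: zrow R k))%:E < +oo)%E.
Proof.
move=> h0; have [C C0 HC] := stable_transform_prod_le.
have [B B0 HB] := sum_int_rational_le h0 C0.
apply: (@le_lt_trans _ _ ((2 * B) ^+ d)%:E); last exact: ltry.
apply: esum_le_bound => S uS; rewrite sumEFin lee_fin.
have r0 (j : int) : 0 <= C / (1 + (h * j%:~R) ^+ 2).
  by rewrite divr_ge0 ?ltW// ltr_wpDr ?sqr_ge0.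
apply: le_trans (sum_lattice_prod_le r0 HB uS).
apply: ler_sum => k _; rewrite (le_trans (HC _))//.
by under eq_bigr do rewrite !mxE.
Qed.

End StableTransform.

Section StablePoisson.
Context (R : realType) (d : nat) (alpha c sigma : R) (f : 'rV[R]_d -> R).
Local Notation T := (d.-tuple (measurableTypeR R)).
Local Notation mud := (lebesgue_tuple R d).
Local Notation dot t x := (\sum_i tnth t i * x i).

(** A real characteristic function means that the sine integral vanishes, so only the term with cos
    b remains in the addition formula. *)
Lemma charfun_one_cos (phi : 'rV[R]_d -> R) : continuous_density f ->
  (forall t, charfun f t = (phi t)%:C%C) -> forall (y : 'rV[R]_d) b,
  (\int[mud]_x (f (row_of_tuple x) * (1 + cos (dot x (y 0) + b)))%:E =
   (1 + phi y * cos b)%:E)%E.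
Proof.
move=> [cf f0 mf intf] H y b.
have dotE (x : T) : dotv y (row_of_tuple x) = dot x (y 0).
  by apply: eq_bigr => i _; rewrite mxE mulrC.
have iF := integrable_f f0 mf intf.
have icos b' := integrable_mul_cos (y 0) b' (fun t => f0 (row_of_tuple t)) iF.
have [Hc Hs] : \int[mud]_x (f (row_of_tuple x) * cos (dot x (y 0))) = phi y /\
    \int[mud]_x (f (row_of_tuple x) * sin (dot x (y 0))) = 0.
  have := H y; rewrite /charfun => -[e1 e2].
  split; [rewrite -[RHS]e1|rewrite -[RHS]e2]; apply: eq_Rintegral => x _;
    by rewrite dotE.
have icos0 : mud.-integrable setT (fun t => (f (row_of_tuple t) * cos (dot t (y 0)))%:E).
  by apply: (eq_integrable measurableT _ _ _ (icos 0)) => // t _; rewrite addr0.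
have isin0 : mud.-integrable setT (fun t => (f (row_of_tuple t) * sin (dot t (y 0)))%:E).
  by apply: (eq_integrable measurableT _ _ _ (icos (- (pi / 2)))) => // t _; rewrite cosBpihalf.
have E x : (f (row_of_tuple x) * (1 + cos (dot x (y 0) + b)))%:E =
   ((f (row_of_tuple x))%:E + ((cos b)%:E * (f (row_of_tuple x) * cos (dot x (y 0)))%:E +
    (- sin b)%:E * (f (row_of_tuple x) * sin (dot x (y 0)))%:E))%E.
  by rewrite -!EFinM -!EFinD cosD; congr EFin; ring.
under eq_integral do rewrite E.
rewrite integralD//; last by apply: integrableD => //; exact: integrableZl.
rewrite integralD//; [|exact: integrableZl|exact: integrableZl].
rewrite !integralZl// intf.
have -> : (\int[mud]_x (f (row_of_tuple x) * cos (dot x (y 0)))%:E = (phi y)%:E)%E.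
  by rewrite -Hc /Rintegral fineK// integrable_fin_num.
have -> : (\int[mud]_x (f (row_of_tuple x) * sin (dot x (y 0)))%:E = 0%:E)%E.
  by apply: etrans (congr1 EFin Hs); rewrite /Rintegral fineK// integrable_fin_num.
by rewrite -!EFinM -!EFinD; congr EFin; ring.
Qed.

Lemma stable_poisson : (0 < d)%N -> 0 < alpha -> 0 < c -> 0 < sigma ->
  is_stable_density alpha c sigma f ->
  exists2 ka : R, 0 < ka & forall (x : 'rV[R]_d) (P : R), 0 < P ->
  (\esum_(k in [set: 'rV[int]_d]) (P ^+ d * (f (x + P *: zrow R k) + f (P *: zrow R k)))%:E =
   \esum_(k in [set: 'rV[int]_d])
     (stable_transform ka (alpha / 2) ((2 * pi / P) *: zrow R k) *
      (1 + cos (\sum_i (k 0%R i)%:~R * (2 * pi / P * x 0%R i))))%:E)%E.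
Proof.
move=> d0 a0 c0 s0 [fd fchar].
have [ka ka0 kaE] := @stable_exponentE R d alpha c sigma a0 c0 s0.
have q0 : 0 < alpha / 2 by rewrite divr_gt0.
exists ka => // x P P0; have [cf f0 mf intf] := fd.
apply: poisson_summation => //.
- by move=> t; exact: stable_transform_ge0.
- exact: continuous_stable_transform.
- exact: measurable_stable_transform.
- exact: integral_stable_transform_fin.
- by move=> h h0; exact: sum_stable_transform_fin.
- apply: charfun_one_cos => // t.
  by rewrite fchar kaE.
Qed.

End StablePoisson.

(** * Fourier analysis on the torus *)

Section TorusFourier.
Context (R : realType) (L d : nat).
Hypothesis L1 : (1 < L)%N.
Implicit Types (m : 'rV[int]_d) (u v z s : torus L d).

Let L0 : 0 < L%:R :> R. Proof. by rewrite ltr0n ltnW. Qed.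

(** Representatives wrap around at L, so only the class modulo 2 pi respects addition on the torus.
    Hence the lemmas concern [cos (phase m u + c)], where the free c also covers sines. *)
Definition phase m u : R := \sum_i 2 * pi / L%:R * (m 0 i)%:~R * (nat_of_ord (u 0 i))%:R.

Lemma ltn_Zp (a : 'Z_L) : (a < L)%N.
Proof. by have := ltn_ord a; rewrite [X in (_ < X)%N]Zp_cast. Qed.

Lemma phaseDl m m' u : phase (m + m') u = phase m u + phase m' u.
Proof.
rewrite -big_split; apply: eq_bigr => i _ /=.
by rewrite mxE intrD; ring.
Qed.

Lemma phaseNl m u : phase (- m) u = - phase m u.
Proof. by rewrite -sumrN; apply: eq_bigr => i _; rewrite mxE mulrNz; ring. Qed.

Lemma phase_dvd m u : (forall i, (L %| m 0%R i)%Z) -> exists n : int, phase m u = 2 * pi * n%:~R.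
Proof.
move=> Lm; exists (\sum_i (m 0%R i %/ L)%Z * (nat_of_ord (u 0 i))%:Z).
rewrite rmorph_sum mulr_sumr; apply: eq_bigr => i _ /=.
rewrite rmorphM /= -[in LHS](divzK (Lm i)) rmorphM /= -!pmulrn.
by field; exact: lt0r_neq0.
Qed.

Lemma cos_phase_dvd m m' u c : (forall i, (L %| m 0%R i - m' 0%R i)%Z) ->
  cos (phase m u + c) = cos (phase m' u + c).
Proof.
move=> H; have [|n nE] := @phase_dvd (m - m') u; first by move=> i; rewrite !mxE.
rewrite -[m](subrK m') phaseDl nE -[RHS](cos_add2piz _ n); congr cos; ring.
Qed.

Lemma cos_phaseD m u v c : cos (phase m (u + v) + c) = cos (phase m u + phase m v + c).
Proof.
(* Counts the coordinates of u + v that wrap around, weighted by m. *)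
pose n : int := \sum_i m 0 i * ((nat_of_ord (u 0%R i) + nat_of_ord (v 0%R i)) %/ L)%N%:Z.
rewrite -[LHS](cos_add2piz _ n); congr cos.
rewrite addrAC; congr (_ + _).
rewrite /n rmorph_sum mulr_sumr -!big_split; apply: eq_bigr => i _ /=.
have -> : nat_of_ord ((u + v) 0 i) = ((nat_of_ord (u 0%R i) + nat_of_ord (v 0%R i)) %% L)%N.
  by rewrite mxE /=; congr (_ %% _)%N; exact: Zp_cast.
rewrite rmorphM /= -pmulrn.
have := divn_eq (nat_of_ord (u 0%R i) + nat_of_ord (v 0%R i))%N L => /(congr1 (fun k : nat => k%:R : R)).
rewrite !natrD natrM => E; rewrite -[in RHS]mulrDr E.
by field; exact: lt0r_neq0.
Qed.

Lemma phase0r m : phase m 0 = 0.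
Proof. by rewrite /phase big1// => i _; rewrite mxE mulr0. Qed.

Lemma cos_phaseN m u c : cos (phase m (- u) + c) = cos (- phase m u + c).
Proof.
have -> : phase m (- u) + c = phase m u + phase m (- u) + (c - phase m u) by ring.
by rewrite -cos_phaseD subrr phase0r; congr cos; ring.
Qed.

Lemma dvdz_intr_Zp (n : int) : (L %| n)%Z = (n%:~R == 0 :> 'Z_L).
Proof.
have H (k : nat) : (L %| k)%N = (k%:R == 0 :> 'Z_L).
  by rewrite -(inj_eq val_inj) /= Zp_nat /= Zp_cast.
case: n => k; first exact: H.
by rewrite NegzE mulrNz oppr_eq0 -pmulrn -H dvdzE abszN.
Qed.

(* Representative with coordinates in (-L/2, L/2], unlike [torus_rep]. *)
Definition crep (s : torus L d) : 'rV[int]_d :=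
  \row_i (let a := nat_of_ord (s 0 i) in if (a.*2 <= L)%N then a%:Z else a%:Z - L%:Z).

Lemma crep_intr s i : (crep s 0 i)%:~R = s 0 i :> 'Z_L.
Proof.
rewrite mxE /=; case: ifP => _; rewrite ?rmorphB /= -?pmulrn ?natr_Zp//.
have -> : L%:R = 0 :> 'Z_L.
  by apply/eqP; rewrite pmulrn -dvdz_intr_Zp dvdzz.
by rewrite subr0.
Qed.

Lemma crep_bound s i : `|(crep s 0 i)%:~R| <= L%:R / 2 :> R.
Proof.
have aL := ltn_Zp (s 0 i).
have aLR : (nat_of_ord (s 0 i))%:R <= L%:R :> R by rewrite ler_nat ltnW.
rewrite mxE /=; case: leqP => H.
  rewrite -pmulrn ger0_norm// ler_pdivlMr// -natrM ler_nat.
  by rewrite muln2.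
rewrite rmorphB /= -!pmulrn distrC ger0_norm ?subr_ge0//.
have : L%:R < (nat_of_ord (s 0 i)).*2%:R :> R by rewrite ltr_nat.
by rewrite -muln2 natrM; lra.
Qed.

Lemma crep0 : crep 0 = 0.
Proof. by apply/rowP => i; rewrite !mxE. Qed.

Lemma dvd_crepB s s' : (forall i, (L %| crep s 0%R i - crep s' 0%R i)%Z) <-> s = s'.
Proof.
split=> [H|-> i]; last by rewrite subrr dvdz0.
apply/rowP => i; have := H i.
by rewrite dvdz_intr_Zp rmorphB /= !crep_intr subr_eq0 => /eqP.
Qed.

Lemma dvd_crepD s s' : (forall i, (L %| crep s 0%R i + crep s' 0%R i)%Z) <-> s' = - s.
Proof.
split=> [H|-> i].
  apply/rowP => i; have := H i.
  by rewrite dvdz_intr_Zp rmorphD /= !crep_intr addrC addr_eq0 mxE => /eqP.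
by rewrite dvdz_intr_Zp rmorphD /= !crep_intr mxE subrr.
Qed.

(** With r the remainder of n, the cosine is 1 - 2 sin^2(pi r / L), and pi r / L lies strictly
    between 0 and pi. *)
Lemma cos_2pi_frac_neq1 (n : int) : ~~ (L %| n)%Z -> cos (2 * pi / L%:R * n%:~R) != 1 :> R.
Proof.
move=> Ln; pose r := (n %% L)%Z; pose x : R := pi / L%:R * r%:~R.
have LZ : (L%:Z != 0) by rewrite eqz_nat -lt0n ltnW.
have r0 : 0 < r.
  rewrite lt_neqAle modz_ge0// andbT eq_sym; apply: contra Ln => /eqP.
  by move/dvdz_mod0P.
have rL : r < L by rewrite ltz_mod.
have xE : cos (2 * pi / L%:R * n%:~R) = cos (x *+ 2).
  rewrite [in LHS](divz_eq n L) rmorphD rmorphM /= -[RHS](cos_add2piz _ (n %/ L)%Z).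
  by congr cos; rewrite /x -mulr_natr -pmulrn /r; field; exact: lt0r_neq0.
rewrite xE cos_mulr2n cos2sin2.
have : 0 < sin x.
  apply: sin_gt0_pi; rewrite /x mulr_gt0 ?ltr0z// ?divr_gt0 ?pi_gt0//=.
  rewrite mulrAC ltr_pdivrMr// ltr_pM2l ?pi_gt0//.
  by rewrite [L%:R]pmulrn ltr_int.
move=> s0; apply/eqP => H.
have : 0 < sin x ^+ 2 by rewrite exprn_gt0.
by lra.
Qed.

(** If L does not divide the i-th frequency, translation by the i-th unit vector shows that shifting
    the phase by eta leaves the sum X unchanged. Adding the shifts by eta and -eta gives 2 X = 2
    cos(eta) X with cos(eta) != 1. *)
Lemma sum_cos_phase m c :
  \sum_(z : torus L d) cos (phase m z + c) =
  if [forall i, (L %| m 0%R i)%Z] then L%:R ^+ d * cos c else 0.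
Proof.
case: ifPn => [/forallP H|].
  rewrite (eq_bigr (fun=> cos c)).
    by rewrite sumr_const card_mx mul1n card_ord Zp_cast// -[LHS]mulr_natl natrX.
  move=> z _; have [n ->] := phase_dvd z H.
  by rewrite addrC cos_add2piz.
rewrite negb_forall => /existsP[i Lm].
pose e : torus L d := delta_mx 0 i.
pose eta : R := 2 * pi / L%:R * (m 0 i)%:~R.
have pe : phase m e = eta.
  rewrite /phase (bigD1 i)//= big1 ?addr0.
    rewrite mxE !eqxx /= -/eta.
    by rewrite mulr1.
  by move=> j ji; rewrite mxE (negbTE ji) andbF mulr0.
have shift c' : \sum_(z : torus L d) cos (phase m z + c') =
    \sum_(z : torus L d) cos (phase m z + (c' + eta)).
  rewrite (reindex_inj (addIr e)) /=; apply: eq_bigr => z _.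
  by rewrite cos_phaseD pe; congr cos; ring.
have two : \sum_(z : torus L d) cos (phase m z + (c + eta)) +
   \sum_(z : torus L d) cos (phase m z + (c - eta)) =
   2 * cos eta * \sum_(z : torus L d) cos (phase m z + c).
  rewrite -big_split mulr_sumr; apply: eq_bigr => z _ /=.
  by rewrite !addrA (cosD _ eta) (cosB _ eta); ring.
move: two; rewrite (shift (c - eta)) subrK -shift.
set X := \sum_z _ => H.
have : (1 - cos eta) * X = 0 by lra.
move/eqP; rewrite mulf_eq0 subr_eq0 eq_sym (negbTE (cos_2pi_frac_neq1 Lm)) /=.
by move/eqP.
Qed.

(** The inverse discrete Fourier transform for even [lam], where the sine terms cancel in pairs. *)
Definition torus_fourier (lam : torus L d -> R) (u : torus L d) : R :=
  (L%:R ^+ d)^-1 * \sum_s lam s * cos (phase (crep s) u).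

Lemma torus_fourierN lam u : torus_fourier lam (- u) = torus_fourier lam u.
Proof.
congr (_ * _); apply: eq_bigr => s _; congr (_ * _).
by have := cos_phaseN (crep s) u 0; rewrite !addr0 cosN.
Qed.

Lemma sum_cos_phase_crep (s s' : torus L d) (c c' : R) :
  \sum_(z : torus L d) cos (phase (crep s) z + c) * cos (phase (crep s') z + c') =
  L%:R ^+ d / 2 * ((s' == s)%:R * cos (c - c') + (s' == - s)%:R * cos (c + c')).
Proof.
rewrite (eq_bigr (fun z => 2^-1 * cos (phase (crep s - crep s') z + (c - c')) +
   2^-1 * cos (phase (crep s + crep s') z + (c + c')))); last first.
  move=> z _; rewrite !phaseDl phaseNl.
  have -> : phase (crep s) z - phase (crep s') z + (c - c') =
    (phase (crep s) z + c) - (phase (crep s') z + c') by ring.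
  have -> : phase (crep s) z + phase (crep s') z + (c + c') =
    (phase (crep s) z + c) + (phase (crep s') z + c') by ring.
  move: (phase (crep s) z + c) (phase (crep s') z + c') => A B.
  by rewrite cosB cosD; field.
rewrite big_split /= -!mulr_sumr !sum_cos_phase.
have -> : [forall i, (L %| (crep s - crep s') 0%R i)%Z] = (s' == s).
  apply/forallP/eqP => [H|-> i]; last by rewrite subrr mxE dvdz0.
  by apply/esym/dvd_crepB => i; have := H i; rewrite !mxE.
have -> : [forall i, (L %| (crep s + crep s') 0%R i)%Z] = (s' == - s).
  apply/forallP/eqP => [H|E i]; first by apply/dvd_crepD => i; have := H i; rewrite !mxE.
  by have := (dvd_crepD s s').2 E i; rewrite !mxE.
by do 2 case: (s' == _); rewrite ?mul1r ?mul0r ?mulr0 ?addr0 ?add0r; field.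
Qed.

(** By orthogonality only s' = s and s' = -s contribute. Evenness makes both contributions equal,
    which cancels the factor 1/2. *)
Lemma torus_fourier_conv (lam lam' : torus L d -> R) (a b : torus L d) :
  (forall s, lam (- s) = lam s) -> (forall s, lam' (- s) = lam' s) ->
  \sum_z torus_fourier lam (z + a) * torus_fourier lam' (b - z) =
  torus_fourier (fun s => lam s * lam' s) (a + b).
Proof.
move=> ev ev'.
have Ld : (L%:R ^+ d : R) != 0 by rewrite expf_neq0// lt0r_neq0.
transitivity ((L%:R ^+ d)^-1 * (L%:R ^+ d)^-1 * \sum_s \sum_s' lam s * lam' s' *
   (\sum_z cos (phase (crep s) z + phase (crep s) a) *
           cos (phase (crep s') z + - phase (crep s') b))).
  transitivity (\sum_z (L%:R ^+ d)^-1 * (L%:R ^+ d)^-1 * \sum_s \sum_s'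
     lam s * lam' s' * (cos (phase (crep s) z + phase (crep s) a) *
           cos (phase (crep s') z + - phase (crep s') b))).
    apply: eq_bigr => z _; rewrite /torus_fourier mulrACA; congr (_ * _).
    rewrite big_distrlr /=; apply: eq_bigr => s _; apply: eq_bigr => s' _.
    rewrite mulrACA; congr (_ * _ * (_ * _)).
      by have := cos_phaseD (crep s) z a 0; rewrite !addr0.
    have := cos_phaseD (crep s') b (- z) 0; rewrite !addr0 => ->.
    by rewrite addrC cos_phaseN -cosN; congr cos; ring.
  rewrite -mulr_sumr; congr (_ * _); rewrite exchange_big; apply: eq_bigr => s _ /=.
  by rewrite exchange_big; apply: eq_bigr => s' _ /=; rewrite mulr_sumr.
rewrite /torus_fourier -mulrA; congr (_ * _); rewrite mulr_sumr; apply: eq_bigr => s _.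
rewrite (eq_bigr (fun s' => L%:R ^+ d / 2 * (lam s * ((s' == s)%:R * (lam' s' *
    cos (phase (crep s) a + phase (crep s') b)))) +
   L%:R ^+ d / 2 * (lam s * ((s' == - s)%:R * (lam' s' *
    cos (phase (crep s) a - phase (crep s') b)))))); last first.
  by move=> s' _; rewrite sum_cos_phase_crep opprK; ring.
rewrite big_split /= -!mulr_sumr.
have pick (t : torus L d) (F : torus L d -> R) : \sum_s' (s' == t)%:R * F s' = F t.
  rewrite (bigD1 t)//= eqxx mul1r big1 ?addr0// => s' /negbTE ->.
  by rewrite mul0r.
rewrite (pick s (fun s' => lam' s' * cos (phase (crep s) a + phase (crep s') b))).
rewrite (pick (- s) (fun s' => lam' s' * cos (phase (crep s) a - phase (crep s') b))).
rewrite ev'.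
have -> : cos (phase (crep s) a - phase (crep (- s)) b) = cos (phase (crep s) a + phase (crep s) b).
  rewrite -cosN opprB [LHS](@cos_phase_dvd _ (- crep s)) ?phaseNl.
    by rewrite -[LHS]cosN; congr cos; ring.
  move=> i; have := (dvd_crepD s (- s)).2 erefl i.
  by rewrite !mxE opprK addrC.
have -> : cos (phase (crep s) (a + b)) = cos (phase (crep s) a + phase (crep s) b).
  by have := cos_phaseD (crep s) a b 0; rewrite !addr0.
by field.
Qed.

(** Position and frequency change roles: u is read as an integer frequency, so that the sum over s
    falls under [sum_cos_phase]. *)
Lemma torus_fourier1 u : torus_fourier (fun=> 1) u = (u == 0)%:R.
Proof.
pose m : 'rV[int]_d := \row_i (nat_of_ord (u 0 i))%:Z.
have -> : torus_fourier (fun=> 1) u = (L%:R ^+ d)^-1 * \sum_s cos (phase m s + 0).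
  congr (_ * _); apply: eq_bigr => s _; rewrite mul1r.
  (* Corrects between the centred representative [crep s] and the representative in {0, .., L-1}
     used by [phase m s]; the difference is a multiple of 2 pi. *)
  pose e : 'rV[int]_d := \row_i (if ((s 0%R i).*2 <= L)%N then 0 else 1).
  pose n : int := \sum_i e 0 i * (nat_of_ord (u 0 i))%:Z.
  rewrite -[LHS](cos_add2piz _ n) addr0; congr cos.
  rewrite /n rmorph_sum mulr_sumr -big_split; apply: eq_bigr => i _ /=.
  rewrite !mxE rmorphM /= -!pmulrn; case: ifP => _ /=; rewrite -?pmulrn ?rmorphB /= -?pmulrn.
    by ring.
  by field; exact: lt0r_neq0.
rewrite sum_cos_phase cos0 mulr1.
have -> : [forall i, (L %| m 0%R i)%Z] = (u == 0).
  apply/forallP/eqP => [H|u0 i]; last by rewrite mxE u0 mxE dvdz0.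
  apply/rowP => i; have := H i.
  by rewrite dvdz_intr_Zp !mxE -pmulrn natr_Zp => /eqP.
by case: eqP => _; rewrite ?mulr0// mulVf// expf_neq0// lt0r_neq0.
Qed.

Lemma torus_fourier_coef lam s : (forall s, lam (- s) = lam s) ->
  \sum_u torus_fourier lam u * cos (phase (crep s) u) = lam s.
Proof.
move=> ev.
have Ld : (L%:R ^+ d : R) != 0 by rewrite expf_neq0// lt0r_neq0.
transitivity ((L%:R ^+ d)^-1 * \sum_s' lam s' *
   \sum_u cos (phase (crep s') u + 0) * cos (phase (crep s) u + 0)).
  transitivity (\sum_u (L%:R ^+ d)^-1 * \sum_s'
     lam s' * (cos (phase (crep s') u + 0) * cos (phase (crep s) u + 0))).
    apply: eq_bigr => u _; rewrite /torus_fourier -mulrA; congr (_ * _).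
    by rewrite mulr_suml; apply: eq_bigr => s' _; rewrite !addr0 mulrA.
  rewrite -mulr_sumr; congr (_ * _); rewrite exchange_big; apply: eq_bigr => s' _ /=.
  by rewrite mulr_sumr.
under eq_bigr do rewrite sum_cos_phase_crep subrr addr0 cos0 !mulr1.
rewrite (eq_bigr (fun s' => L%:R ^+ d / 2 * ((s == s')%:R * lam s') +
   L%:R ^+ d / 2 * ((s == - s')%:R * lam s'))); last by move=> s' _; ring.
rewrite big_split /= -!mulr_sumr.
rewrite (bigD1 s)//= eqxx mul1r big1 ?addr0; last first.
  by move=> s' /negbTE; rewrite eq_sym => ->; rewrite mul0r.
rewrite (bigD1 (- s))//= opprK eqxx mul1r big1 ?addr0; last first.
  move=> s' s's; rewrite (_ : (s == - s') = false) ?mul0r//.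
  by apply/negP => /eqP E; move: s's; rewrite E opprK eqxx.
by rewrite ev; field.
Qed.

End TorusFourier.

Section EsumScale.
Context (R : realType) (T : choiceType).

Let esumZr_le (h : T -> R) (c : R) : (forall x, 0 <= h x) -> 0 <= c ->
  (\esum_(x in [set: T]) (h x * c)%:E <= (\esum_(x in [set: T]) (h x)%:E) * c%:E)%E.
Proof.
move=> h0 c0; apply: esum_le_bound => s us.
rewrite sumEFin -mulr_suml EFinM -sumEFin lee_wpmul2r ?lee_fin//.
by apply: sum_le_esum => // x; rewrite lee_fin.
Qed.

Lemma esumZr (h : T -> R) (c : R) : (forall x, 0 <= h x) -> 0 <= c ->
  (\esum_(x in [set: T]) (h x * c)%:E = (\esum_(x in [set: T]) (h x)%:E) * c%:E)%E.
Proof.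
move=> h0; rewrite le_eqVlt => /predU1P[<-|c0].
  by rewrite mule0 esum1// => x _; rewrite mulr0.
apply/eqP; rewrite eq_le esumZr_le ?(ltW c0)//=.
rewrite -lee_pdivlMr// (le_trans _ (esumZr_le _ _)) ?invr_ge0 ?(ltW c0)//.
  by under [leRHS]eq_esum do rewrite mulfK ?gt_eqF//.
by move=> x; rewrite mulr_ge0// ltW.
Qed.

(** Valid also for an infinite sum: both sides are then 0 by the convention of [fine]. *)
Lemma fine_esumZr (h : T -> R) (c : R) : (forall x, 0 <= h x) -> 0 <= c ->
  fine (\esum_(x in [set: T]) (h x * c)%:E)%E = fine (\esum_(x in [set: T]) (h x)%:E)%E * c.
Proof.
move=> h0 c0; rewrite esumZr//.
have : (0 <= \esum_(x in [set: T]) (h x)%:E)%E by apply: esum_ge0 => x _; rewrite lee_fin.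
case: (\esum_(x in _) _)%E => //= _; rewrite mul0r.
by case: ltgtP c0 => // [c0|<-] _; rewrite ?mule0// gt0_mulye.
Qed.

End EsumScale.

(** * Grouping frequencies by their class modulo L *)

Section Aliasing.
Context (R : realType) (L d : nat).
Hypothesis L1 : (1 < L)%N.
Implicit Types (g : 'rV[int]_d -> R) (s u : torus L d) (j k : 'rV[int]_d).

Lemma mulrn_rowE k (n : nat) i : (k *+ n) 0 i = k 0 i * n%:Z.
Proof. by rewrite mulmxnE -mulr_natr natz. Qed.

Lemma crep_addE s j i : (crep s + j *+ L) 0 i = crep s 0 i + j 0 i * L%:Z.
Proof. by rewrite mxE mulrn_rowE. Qed.

Lemma bij_crep : set_bij [set: torus L d * 'rV[int]_d] [set: 'rV[int]_d]
  (fun p => crep p.1 + p.2 *+ L).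
Proof.
have L0 : (L%:Z != 0)%R by rewrite -lt0n ltnW.
split => //.
  move=> [s j] [s' j'] _ _ /= E.
  have ss' : s = s'.
    apply/(dvd_crepB L1) => i; have /rowP/(_ i) := E.
    rewrite (crep_addE s) (crep_addE s') => {}E.
    by apply/dvdzP; exists (j' 0 i - j 0 i); move: E; rewrite mulrBl; lra.
  move: E; rewrite ss' => /addrI /rowP E; congr pair; apply/rowP => i.
  have := E i; rewrite (mulrn_rowE j) (mulrn_rowE j') => /mulIf; exact.
move=> k _; pose s : torus L d := \row_i (k 0 i)%:~R.
have D i : (L %| k 0%R i - crep s 0%R i)%Z.
  by rewrite (dvdz_intr_Zp L1) rmorphB /= crep_intr// mxE subrr.
exists (s, \row_i ((k 0%R i - crep s 0%R i) %/ L)%Z) => //=.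
apply/rowP => i; rewrite [LHS]crep_addE mxE divzK//.
by rewrite addrC subrK.
Qed.

Lemma esum_torus (F : 'rV[int]_d -> \bar R) : (forall k, 0 <= F k)%E ->
  (\esum_(k in [set: 'rV[int]_d]) F k =
   \sum_(s : torus L d) \esum_(j in [set: 'rV[int]_d]) F (crep s + j *+ L)%R)%E.
Proof.
move=> F0; rewrite (reindex_esum _ _ _ _ bij_crep).
have -> : [set: torus L d * 'rV[int]_d] = setT `*`` (fun=> setT) by apply/seteqP.
rewrite -(esum_esum (a := fun s j => F (crep s + j *+ L)%R))//.
have -> : [set: torus L d] = [set` enum (torus L d)].
  by apply/seteqP; split => // s _; rewrite /= mem_enum.
rewrite esum_fset//; last by move=> s _; exact: esum_ge0.
rewrite -fsbig_seq ?enum_uniq//.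
by rewrite big_enum.
Qed.

(** All frequencies of one class modulo L give the same character of the torus; this is their total
    weight. *)
Definition aliased g s : R := fine (\esum_(j in [set: 'rV[int]_d]) (g (crep s + j *+ L))%:E).

Lemma eq_aliased g g' : g =1 g' -> aliased g =1 aliased g'.
Proof. by move=> gg' s; congr fine; apply: eq_esum => j _; rewrite gg'. Qed.

Lemma aliasedE g s : (forall k, 0 <= g k) ->
  (\esum_(k in [set: 'rV[int]_d]) (g k)%:E < +oo)%E ->
  (\esum_(j in [set: 'rV[int]_d]) (g (crep s + j *+ L))%:E = (aliased g s)%:E)%E.
Proof.
move=> g0 gfin; rewrite fineK// ge0_fin_numE; last by apply: esum_ge0 => j _; rewrite lee_fin.
apply: le_lt_trans gfin; rewrite (esum_torus (F := fun k => (g k)%:E)); last first.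
  by move=> k; rewrite lee_fin.
rewrite (bigD1 s)//= leeDl// sume_ge0// => t _.
by apply: esum_ge0 => j _; rewrite lee_fin.
Qed.

(** [crep (- s)] can differ from [- crep s] at coordinates equal to L/2. The difference is a
    multiple t L, absorbed by the reindexing j -> -t - j. *)
Lemma aliasedN g s : (forall k, g (- k) = g k) -> aliased g (- s) = aliased g s.
Proof.
move=> ev; pose t : 'rV[int]_d := \row_i ((crep s 0%R i + crep (- s) 0%R i) %/ L)%Z.
have tE : crep (- s) = t *+ L - crep s.
  apply/rowP => i; rewrite [RHS]mxE (mulrn_rowE t) [t _ _]mxE divzK.
    by rewrite [(- crep s) _ _]mxE addrAC subrr add0r.
  exact: (dvd_crepD L1 s (- s)).2.
congr fine; rewrite (reindex_esum [set: 'rV[int]_d] [set: 'rV[int]_d] (fun j => - t - j)).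
  apply: eq_esum => j _; rewrite -ev tE; congr (g _)%:E.
  by rewrite mulrnBl mulNrn; apply/rowP => i; rewrite !mxE; ring.
split=> //; first by move=> j j' _ _ /addrI /oppr_inj.
by move=> j _; exists (- t - j) => //; rewrite opprD !opprK addKr.
Qed.

Lemma esum_aliased_cos g u : (forall k, 0 <= g k) ->
  (\esum_(k in [set: 'rV[int]_d]) (g k)%:E < +oo)%E ->
  (\esum_(k in [set: 'rV[int]_d]) (g k * (1 + cos (phase R k u)))%:E =
   (\sum_(s : torus L d) aliased g s * (1 + cos (phase R (crep s) u)))%:E)%E.
Proof.
move=> g0 gfin.
have c0 (x : R) : 0 <= 1 + cos x by have := cos_geN1 x; lra.
rewrite esum_torus; last by move=> k; rewrite lee_fin mulr_ge0.
rewrite -sumEFin; apply: eq_bigr => s _.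
rewrite EFinM -aliasedE// -esumZr//.
apply: eq_esum => j _; congr (_ * (1 + _))%:E.
have := @cos_phase_dvd R L d L1 (crep s + j *+ L) (crep s) u 0; rewrite !addr0; apply.
by move=> i; rewrite crep_addE addrAC subrr add0r dvdz_mull.
Qed.

End Aliasing.

(** * Kernel and theta function as Fourier series on the torus *)

Section TorusPoisson.
Context (R : realType) (L d : nat) (alpha ka : R) (f : 'rV[R]_d -> R).
Hypothesis L1 : (1 < L)%N.
Hypothesis d0 : (0 < d)%N.
Hypothesis alpha0 : 0 < alpha.
Hypothesis ka0 : 0 < ka.
Hypothesis f0 : forall x, 0 <= f x.
Local Notation phi := (stable_transform ka (alpha / 2)).
Hypothesis poisson : forall (x : 'rV[R]_d) (P : R), 0 < P ->
  (\esum_(k in [set: 'rV[int]_d]) (P ^+ d * (f (x + P *: zrow R k) + f (P *: zrow R k)))%:E =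
   \esum_(k in [set: 'rV[int]_d])
     (phi ((2 * pi / P) *: zrow R k) *
      (1 + cos (\sum_i (k 0%R i)%:~R * (2 * pi / P * x 0%R i))))%:E)%E.

Let L0 : 0 < L%:R :> R. Proof. by rewrite ltr0n ltnW. Qed.
Let q0 : 0 < alpha / 2. Proof. by rewrite divr_gt0. Qed.

Definition stable_dual (h : R) (k : 'rV[int]_d) : R := phi (h *: zrow R k).

Lemma stable_dual_ge0 h k : 0 <= stable_dual h k.
Proof. exact: stable_transform_ge0. Qed.

(** Undoes the symmetrisation: Poisson gives A u + A 0, and at u = 0 it gives 2 A 0. All these sums
    are finite, so A u follows by subtraction. *)
Lemma esum_density_torus (u : torus L d) (P : R) : 0 < P ->
  (\esum_(k in [set: 'rV[int]_d])
     (P ^+ d * f (P *: (L%:R^-1 *: torus_rep R u + zrow R k)))%:E =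
   (\sum_(s : torus L d) aliased (stable_dual (2 * pi / P)) s * cos (phase R (crep s) u))%:E)%E.
Proof.
move=> P0; have Pd : 0 <= P ^+ d by rewrite exprn_ge0 ?ltW.
have h0 : 0 < 2 * pi / P by rewrite divr_gt0 ?mulr_gt0 ?pi_gt0.
pose A (v : torus L d) := (\esum_(k in [set: 'rV[int]_d])
     (P ^+ d * f (P *: (L%:R^-1 *: torus_rep R v + zrow R k)))%:E)%E.
pose psi := aliased (L := L) (stable_dual (2 * pi / P)).
have rep0 : torus_rep R (0 : torus L d) = 0 by apply/rowP => i; rewrite !mxE.
have AA v : (A v + A 0%R = (\sum_(s : torus L d) psi s * (1 + cos (phase R (crep s) v)))%:E)%E.
  rewrite -esumD; try by move=> k _; rewrite lee_fin mulr_ge0.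
  rewrite -esum_aliased_cos//; last 2 first.
  - by move=> k; exact: stable_dual_ge0.
  - exact: sum_stable_transform_fin.
  transitivity (\esum_(k in [set: 'rV[int]_d]) (P ^+ d *
      (f (P *: (L%:R^-1 *: torus_rep R v) + P *: zrow R k) + f (P *: zrow R k)))%:E)%E.
    apply: eq_esum => k _; rewrite -EFinD mulrDr; congr (_ * f _ + _ * f _)%:E.
      by rewrite scalerDr.
    by rewrite rep0 scaler0 add0r.
  rewrite poisson//; apply: eq_esum => k _; congr (_ * (1 + cos _))%:E.
  by apply: eq_bigr => i _; rewrite !mxE; field; rewrite !lt0r_neq0.
have A0 v : (0 <= A v)%E by apply: esum_ge0 => k _; rewrite lee_fin mulr_ge0.
have Afin v : A v \is a fin_num.
  rewrite ge0_fin_numE// (@le_lt_trans _ _ (A v + A 0%R)%E) ?leeDl//.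
  by rewrite AA ltry.
have /(congr1 fine) /= := AA u; rewrite fineD//.
have /(congr1 fine) /= := AA 0; rewrite fineD//.
rewrite -/(A u) -/psi -[in X in _ -> _ -> X](fineK (Afin u)) => E0 E; congr EFin.
have S v : \sum_(s : torus L d) psi s * (1 + cos (phase R (crep s) v)) =
    \sum_(s : torus L d) psi s + \sum_(s : torus L d) psi s * cos (phase R (crep s) v).
  by rewrite -big_split; apply: eq_bigr => s _ /=; rewrite mulrDr mulr1.
have S0 : \sum_(s : torus L d) psi s * cos (phase R (crep s) (0 : torus L d)) = \sum_(s : torus L d) psi s.
  by apply: eq_bigr => s _; rewrite phase0r cos0 mulr1.
by move: E0 E; rewrite !S S0; lra.
Qed.

Lemma esum_dual_lattice (P : R) : 0 < P ->
  (\esum_(k in [set: 'rV[int]_d]) (P ^+ d * f (P *: zrow R k))%:E =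
   \esum_(k in [set: 'rV[int]_d]) (stable_dual (2 * pi / P) k)%:E)%E.
Proof.
move=> P0; have Pd : 0 <= P ^+ d by rewrite exprn_ge0 ?ltW.
have h0 : 0 < 2 * pi / P by rewrite divr_gt0 ?mulr_gt0 ?pi_gt0.
have := poisson 0 P0.
set A := (X in _ -> X = _); set B := (X in _ -> _ = X).
have -> : (\esum_(k in [set: 'rV[int]_d]) (P ^+ d * (f (0 + P *: zrow R k) + f (P *: zrow R k)))%:E = A * 2%:E)%E.
  rewrite -esumZr//; last by move=> k; rewrite mulr_ge0.
  by apply: eq_esum => k _; rewrite add0r; congr EFin; ring.
have -> : (\esum_(k in [set: 'rV[int]_d]) (phi ((2 * pi / P) *: zrow R k) *
      (1 + cos (\sum_i (k 0%R i)%:~R * (2 * pi / P * (0 : 'rV[R]_d) 0%R i))))%:E = B * 2%:E)%E.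
  rewrite -esumZr//; last exact: stable_dual_ge0.
  apply: eq_esum => k _; rewrite big1 ?cos0// => i _.
  by rewrite mxE !mulr0.
have A0 : (0 <= A)%E by apply: esum_ge0 => k _; rewrite lee_fin mulr_ge0.
have Bfin : B \is a fin_num.
  rewrite ge0_fin_numE; first exact: sum_stable_transform_fin.
  by apply: esum_ge0 => k _; rewrite lee_fin stable_dual_ge0.
move=> E; have Afin : A \is a fin_num.
  rewrite ge0_fin_numE// (@le_lt_trans _ _ (A * 2%:E)%E) ?lee_pemulr// ?lee_fin ?ler1n//.
  by rewrite E -(fineK Bfin) -EFinM ltry.
move: E; rewrite -(fineK Afin) -(fineK Bfin) -!EFinM => -[E]; congr EFin.
by lra.
Qed.

Lemma stable_dualE (h : R) k : 0 <= h ->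
  stable_dual h k = expR (- (ka * h `^ alpha * sqnorm (zrow R k) `^ (alpha / 2))).
Proof.
move=> h0; rewrite /stable_dual /stable_transform sqnormZ powRM ?sqr_ge0 ?sqnorm_ge0//.
have -> : (h ^+ 2) `^ (alpha / 2) = h `^ alpha.
  by rewrite -powR_mulrn// -powRrM mulrC divfK.
by rewrite mulrA.
Qed.

(** Stability of the law, phi(n^(1/alpha) t) = phi(t)^n: this ties n steps of the chain to the theta
    function at time n (W/L)^alpha. *)
Lemma stable_dualX (h : R) k (n : nat) : 0 <= h ->
  stable_dual (h * n%:R `^ alpha^-1) k = stable_dual h k ^+ n.
Proof.
move=> h0; rewrite !stable_dualE ?mulr_ge0 ?powR_ge0// -expRM_natl; congr expR.
rewrite powRM ?powR_ge0// -powRrM mulVf ?gt_eqF// powRr1//.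
by ring.
Qed.

(** The dual lattice of spacing 2 pi W consists of the frequencies h L j, which are exactly those
    aliased to 0. Hence the kernel has coefficient 1 at 0. *)
Lemma hankel_normE (W : R) : 0 < W ->
  hankel_norm f W = W ^+ d * aliased (L := L) (stable_dual (2 * pi * (W / L%:R))) 0.
Proof.
move=> W0; rewrite /aliased crep0.
have -> : (\esum_(j in [set: 'rV[int]_d])
    (stable_dual (2 * pi * (W / L%:R)) (0 + j *+ L))%:E =
    \esum_(j in [set: 'rV[int]_d]) (stable_dual (2 * pi / W^-1) j)%:E)%E.
  apply: eq_esum => j _; congr (phi _)%:E; apply/rowP => i.
  rewrite !mxE add0r mulrn_rowE intrM -pmulrn.
  by field; rewrite !lt0r_neq0.
rewrite -esum_dual_lattice ?invr_gt0//.
under eq_esum do rewrite mulrC.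
rewrite fine_esumZr ?exprn_ge0 ?invr_ge0 ?(ltW W0)//.
by rewrite mulrCA -exprMn mulfV ?lt0r_neq0// expr1n mulr1.
Qed.

Lemma hankel_kernelE (W : R) (x0 x y : torus L d) : 0 < W ->
  let g := stable_dual (2 * pi * (W / L%:R)) in
  hankel_kernel f W x0 x y =
  torus_fourier (fun s => aliased g s / aliased g (0 : torus L d)) (x + y - x0).
Proof.
move=> W0 g; have P0 : 0 < L%:R / W by rewrite divr_gt0.
have := esum_density_torus (x + y - x0) P0.
have -> : 2 * pi / (L%:R / W) = 2 * pi * (W / L%:R) by rewrite invf_div.
under eq_esum do rewrite mulrC.
move=> /(congr1 fine) /=; rewrite fine_esumZr ?exprn_ge0 ?(ltW P0)//.
rewrite /hankel_kernel hankel_normE// -/g => E.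
rewrite /torus_fourier.
have -> : lattice_sum (fun k => f (W^-1 *: (torus_rep R (x + y - x0) + L%:R *: k))) =
  ((L%:R / W) ^+ d)^-1 * \sum_(s : torus L d) aliased g s * cos (phase R (crep s) (x + y - x0)).
  rewrite -E mulrC mulfK ?expf_neq0 ?lt0r_neq0//.
  congr fine; apply: eq_esum => k _; congr (f _)%:E; apply/rowP => i.
  by rewrite !mxE; field; rewrite !lt0r_neq0.
rewrite [in RHS](eq_bigr (fun s => (aliased g (0 : torus L d))^-1 * (aliased g s * cos (phase R (crep s) (x + y - x0))))).
  rewrite -mulr_sumr expr_div_n !invfM invrK.
  have Wd : W ^+ d != 0 by rewrite expf_neq0// lt0r_neq0.
  move: (aliased g 0)^-1 (\sum_s _) => a b.
  by field; rewrite Wd expf_neq0// lt0r_neq0.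
by move=> s _; rewrite mulrAC mulrC.
Qed.

(** Poisson with P = tau^(-1/alpha) for tau = n t^alpha: then P^d is the scaling factor of the
    density, and 2 pi / P = 2 pi t n^(1/alpha) yields n-th powers by [stable_dualX]. *)
Lemma stable_thetaE (t : R) (n : nat) (u : torus L d) : 0 < t -> (0 < n)%N ->
  (L%:R ^+ d)^-1 * stable_theta alpha f (L%:R^-1 *: torus_rep R u) (n%:R * t `^ alpha) =
  torus_fourier (aliased (fun k => stable_dual (2 * pi * t) k ^+ n)) u.
Proof.
move=> t0 n0; congr (_ * _).
have nt0 : 0 < n%:R * t `^ alpha by rewrite mulr_gt0 ?ltr0n ?powR_gt0.
pose P := (n%:R * t `^ alpha) `^ (- alpha^-1).
have P0 : 0 < P by rewrite powR_gt0.
have PE : 2 * pi / P = 2 * pi * t * n%:R `^ alpha^-1.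
  rewrite /P powRN invrK powRM ?powR_ge0// -powRrM mulfV ?gt_eqF// powRr1 ?(ltW t0)//.
  by ring.
have Pd : (n%:R * t `^ alpha) `^ (- (d%:R / alpha)) = P ^+ d.
  by rewrite -powR_mulrn ?powR_ge0// -powRrM; congr (_ `^ _); ring.
have := esum_density_torus u P0; rewrite PE => /(congr1 fine) /= E.
rewrite /stable_theta /stable_density_at /lattice_sum Pd; apply: etrans E _.
apply: eq_bigr => s _; congr (_ * _); apply: eq_aliased => k.
by rewrite stable_dualX// !mulr_ge0 ?pi_ge0 ?ltW.
Qed.

End TorusPoisson.

(** * Powers of a Hankel kernel on the torus *)

Section HankelChain.
Context (R : realType) (L d : nat).
Hypothesis L1 : (1 < L)%N.
Implicit Types (lam : torus L d -> R) (s u x y : torus L d).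

Let L0 : 0 < L%:R :> R. Proof. by rewrite ltr0n ltnW. Qed.

Lemma eq_torus_fourier lam lam' : lam =1 lam' -> torus_fourier lam =1 torus_fourier lam'.
Proof. by move=> E u; congr (_ * _); apply: eq_bigr => s _; rewrite E. Qed.

(** One step convolves and reflects. When n is odd, evenness rewrites the argument z + y - x0 as (x0
    - y) - z, so that in both parities the convolution arguments have the form required by
    [torus_fourier_conv]. *)
Lemma nstep_hankel lam (p : torus L d -> torus L d -> R) x0 :
  (forall s, lam (- s) = lam s) ->
  (forall x y, p x y = torus_fourier lam (x + y - x0)) ->
  forall n x y, nstep p n x y =
    torus_fourier (fun s => lam s ^+ n) (if odd n then x + y - x0 else y - x).
Proof.
move=> ev pE; elim=> [|n IH] x y.
  rewrite /= (eq_torus_fourier (lam' := fun=> 1))//.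
  by rewrite torus_fourier1// subr_eq0 eq_sym.
rewrite [LHS]/=; under eq_bigr do rewrite pE IH.
rewrite (eq_torus_fourier (lam' := fun s => lam s * lam s ^+ n)); last first.
  by move=> s; rewrite exprS.
have evn s : lam (- s) ^+ n = lam s ^+ n by rewrite ev.
rewrite /=; case: (odd n) => /=; last first.
  transitivity (\sum_z torus_fourier lam (z + (x - x0)) *
      torus_fourier (fun s => lam s ^+ n) (y - z)).
    apply: eq_bigr => z _; congr (torus_fourier _ _ * _).
    by rewrite addrCA addrA.
  by rewrite torus_fourier_conv//; congr torus_fourier; rewrite addrAC.
transitivity (\sum_z torus_fourier lam (z + (x - x0)) *
    torus_fourier (fun s => lam s ^+ n) ((x0 - y) - z)).
  apply: eq_bigr => z _; congr (torus_fourier _ _ * _).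
    by rewrite addrCA addrA.
  by rewrite -(torus_fourierN _ _ (x0 - y - z))// !opprB addrA.
by rewrite torus_fourier_conv// -[RHS]torus_fourierN// opprB subrKA.
Qed.

(** The normalisation cancels the number of frequencies, so no power of L is lost. *)
Lemma ler_torus_fourier_dist lam lam' u (e : R) : (forall s, `|lam s - lam' s| <= e) ->
  `|torus_fourier lam u - torus_fourier lam' u| <= e.
Proof.
move=> H; rewrite /torus_fourier -mulrBr -sumrB normrM ger0_norm ?invr_ge0 ?exprn_ge0 ?(ltW L0)//.
rewrite ler_pdivrMl ?exprn_gt0// (le_trans (ler_norm_sum _ _ _))//.
rewrite (le_trans (ler_sum _ (G := fun=> e) _)) => [//| s _ |].
  rewrite -mulrBl normrM (le_trans _ (H s))// ler_piMr// ler_norml.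
  by rewrite cos_geN1 cos_le1.
by rewrite sumr_const card_mx mul1n card_ord Zp_cast// -[_ *+ _]mulr_natl natrX.
Qed.

(** A coefficient of a nonnegative function is at most its total mass, since cosine is at most 1.
    For the chain this bounds the coefficients by 1. *)
Lemma torus_fourier_coef_le lam s : (forall s, lam (- s) = lam s) ->
  (forall u, 0 <= torus_fourier lam u) -> lam s <= lam 0.
Proof.
move=> ev ge0; rewrite -(torus_fourier_coef L1 s ev) -(torus_fourier_coef L1 0 ev).
apply: ler_sum => u _; rewrite ler_wpM2l// (le_trans (cos_le1 _))//.
by rewrite crep0 /phase big1 ?cos0// => i _; rewrite mxE mulr0 mul0r.
Qed.

End HankelChain.

(** * The aliasing error *)

Section PowerError.
Variable R : realType.

Lemma ler_dist_expr (a b : R) (n : nat) : 0 <= a <= 1 -> 0 <= b <= 1 ->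
  `|a ^+ n - b ^+ n| <= n%:R * `|a - b|.
Proof.
move=> /andP[a0 a1] /andP[b0 b1]; elim: n => [|n IH].
  by rewrite !expr0 subrr normr0 mul0r.
have -> : a ^+ n.+1 - b ^+ n.+1 = a * (a ^+ n - b ^+ n) + (a - b) * b ^+ n.
  by rewrite !exprS; ring.
rewrite (le_trans (ler_normD _ _))// -(natr1 n) (mulrDl n%:R 1) mul1r lerD//.
  by rewrite normrM (le_trans _ IH)// ger0_norm// ler_piMl.
by rewrite normrM ler_piMr// ger0_norm ?exprn_ge0// exprn_ile1.
Qed.

(* For [A = psi s], [A0 = psi 0], [mu = phi (h s)] and [E = expR (- c W^alpha)];
   the case [1 <= X * E] is that of small [W], where the bound is trivial. *)
Lemma quotient_power_error (A A0 B mu K X E : R) (n : nat) : (0 < n)%N ->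
  0 <= mu <= 1 -> mu <= A -> A <= A0 -> 1 <= A0 -> 0 <= K -> 0 <= X -> 0 <= E ->
  `|mu ^+ n - B| <= K * E ->
  (A <= mu + K * E /\ A0 <= 1 + K * E) \/ 1 <= X * E ->
  `|(A / A0) ^+ n - B| <= n%:R * ((2 * K + X) * E).
Proof.
move=> n0 mu01 muA AA0 A0ge1 K0 X0 E0 muB H; have [mu0 mu1] := andP mu01.
have n1 : 1 <= n%:R :> R by rewrite ler1n.
have A0gt0 : 0 < A0 by lra.
have KE : 0 <= K * E by rewrite mulr_ge0.
have XE : 0 <= X * E by rewrite mulr_ge0.
have lam0 : 0 <= A / A0 by rewrite divr_ge0; lra.
have lam1 : A / A0 <= 1 by rewrite ler_pdivrMr// mul1r.
have lammu : `|A / A0 - mu| <= (K + X) * E.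
  (* In the second case both numbers lie in [0, 1], so their distance is at most 1 <= X E. *)
  case: H => [[Ale A0le]|XE1]; last by rewrite ler_norml; apply/andP; split; lra.
  apply: (@le_trans _ _ (K * E)); last by lra.
  have -> : A / A0 - mu = (A - mu * A0) / A0 by field; lra.
  rewrite normrM (ger0_norm (_ : 0 <= A0^-1)) ?invr_ge0; last by lra.
  rewrite ler_pdivrMr// (@le_trans _ _ (K * E))//; last exact: ler_peMr.
  by rewrite ler_norml; apply/andP; split; nra.
apply: (le_trans (ler_distD (mu ^+ n) _ _)).
have H1 : `|(A / A0) ^+ n - mu ^+ n| <= n%:R * `|A / A0 - mu|.
  by apply: ler_dist_expr => //; rewrite lam0.
have H2 : n%:R * `|A / A0 - mu| <= n%:R * ((K + X) * E) by rewrite ler_wpM2l.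
(* Absorbs the distance from mu^n to B, using n >= 1; this is the second K in the constant. *)
have H3 : K * E <= n%:R * (K * E) by rewrite ler_peMl.
lra.
Qed.

End PowerError.

Section AliasingError.
Context (R : realType) (L d : nat) (alpha ka W : R).
Hypothesis L1 : (1 < L)%N.
Hypothesis d0 : (0 < d)%N.
Hypothesis alpha0 : 0 < alpha.
Hypothesis ka0 : 0 < ka.
Hypothesis W0 : 0 < W.
Local Notation g := (stable_dual alpha ka (2 * pi * (W / L%:R))).
Implicit Types (s : torus L d) (j k : 'rV[int]_d).

Let L0 : 0 < L%:R :> R. Proof. by rewrite ltr0n ltnW. Qed.
Let q0 : 0 < alpha / 2. Proof. by rewrite divr_gt0. Qed.
Let wl0 : 0 < 2 * pi * (W / L%:R).
Proof. by rewrite !mulr_gt0 ?pi_gt0 ?invr_gt0. Qed.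

(* Half of the decay rate at distance L/2: the other half is spent on the
   convergence of the sum over [j]. *)
Definition tail_rate : R := ka * pi `^ alpha / 2.

Lemma tail_rate_gt0 : 0 < tail_rate.
Proof. by rewrite divr_gt0// mulr_gt0// powR_gt0// pi_gt0. Qed.

(** The sum at unit spacing depends on neither L nor W, which makes the aliasing bound uniform. *)
Definition tail_const : R :=
  fine (\esum_(j in [set: 'rV[int]_d])
    (stable_transform tail_rate (alpha / 2) (1 *: zrow R j))%:E).

Lemma tail_const_ge0 : 0 <= tail_const.
Proof. by apply/fine_ge0/esum_ge0 => j _; rewrite lee_fin stable_transform_ge0. Qed.

Lemma stable_dual_le1 k : g k <= 1.
Proof. by rewrite -expR0 ler_expR oppr_le0 mulr_ge0 ?powR_ge0 ?(ltW ka0). Qed.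

Lemma stable_dual0 : g (0 : 'rV[int]_d) = 1.
Proof.
rewrite /stable_dual /stable_transform /sqnorm big1 ?powR0 ?mulr0 ?oppr0 ?expR0//.
  by rewrite gt_eqF.
by move=> i _; rewrite !mxE mulr0 expr0n.
Qed.

Lemma stable_dualN k : g (- k) = g k.
Proof.
have E : sqnorm (2 * pi * (W / L%:R) *: zrow R (- k)) = sqnorm (2 * pi * (W / L%:R) *: zrow R k).
  by apply: eq_bigr => i _; rewrite !mxE mulrNz mulrN sqrrN.
by rewrite /stable_dual /stable_transform E.
Qed.

Lemma sqnorm_int_ge1 j : j != 0 -> 1 <= sqnorm (zrow R j).
Proof.
move=> j0; have [i ji] : exists i, j 0 i != 0.
  apply/existsP; apply: contraNT j0; rewrite negb_exists => /forallP H.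
  by apply/eqP/rowP => i; rewrite mxE; apply/eqP; have := H i; rewrite negbK.
rewrite /sqnorm (bigD1 i)//= (@le_trans _ _ ((zrow R j) 0 i ^+ 2))//.
  rewrite mxE -rmorphXn /= ler1z -gtz0_ge1 lt_neqAle sqr_ge0 andbT eq_sym.
  by rewrite expf_neq0.
by rewrite lerDl sumr_ge0// => *; exact: sqr_ge0.
Qed.

(** Coordinatewise, |a| <= L/2 and |j| >= 1 give |a + j L| >= |j| L - L/2 >= |j| L/2; coordinates
    with j = 0 are trivial. *)
Lemma sqnorm_crep_shift s j :
  (L%:R / 2) ^+ 2 * sqnorm (zrow R j) <= sqnorm (zrow R (crep s + j *+ L)).
Proof.
rewrite mulr_sumr; apply: ler_sum => i _; rewrite -exprMn.
rewrite -(real_normK (num_real (_ * _))) -(real_normK (num_real (zrow R (_ + _) _ _))).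
rewrite ler_sqr ?nnegrE// mxE [X in _ <= `|X|]mxE crep_addE.
have := crep_bound R L1 s i; move: (crep s 0 i) => a.
have [->|ji0] := eqVneq (j 0 i) 0; first by rewrite !mulr0 normr0.
have ji1 : 1 <= `|(j 0 i)%:~R| :> R.
  by rewrite -intr_norm ler1z -gtz0_ge1 normr_gt0.
rewrite intrD intrM -pmulrn => aL.
have : `|(j 0 i)%:~R * L%:R : R| <= `|a%:~R + (j 0 i)%:~R * L%:R| + `|a%:~R : R|.
  by rewrite -[X in `|X| <= _](addKr a%:~R) addrC (le_trans (ler_normD _ _))// normrN.
rewrite (normrM _ L%:R) (ger0_norm (ltW L0)) => tri.
rewrite normrM (ger0_norm (divr_ge0 (ltW L0) _))//.
have : L%:R * 1 <= L%:R * `|(j 0 i)%:~R| :> R by rewrite ler_pM2l.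
by move: aL tri; lra.
Qed.

(** Since h L/2 = pi W, the exponent is at least 2 b y J with b the tail rate, y = m W^alpha and J =
    |j|^alpha. For y, J >= 1 one has 2 y J >= J + y, which separates a summable factor from the
    decay. *)
Lemma stable_dual_shift_le s j (m : nat) : j != 0 -> 1 <= m%:R * W `^ alpha ->
  g (crep s + j *+ L) ^+ m <=
  stable_transform tail_rate (alpha / 2) (1 *: zrow R j) *
  expR (- (tail_rate * (m%:R * W `^ alpha))).
Proof.
move=> j0 y1; rewrite scale1r /stable_transform -expRD stable_dualE ?(ltW wl0)//.
rewrite -expRM_natl ler_expR -opprD mulrN lerN2.
have J1 : 1 <= sqnorm (zrow R j) `^ (alpha / 2).
  have {1}<- : 1 `^ (alpha / 2) = 1 :> R by rewrite powR1.
  by apply: ge0_ler_powR; rewrite ?nnegrE ?(ltW q0) ?sqnorm_ge0// sqnorm_int_ge1.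
set J := sqnorm (zrow R j) `^ (alpha / 2) in J1 *.
set y := m%:R * W `^ alpha in y1 *.
have SJ : (L%:R / 2) `^ alpha * J <= sqnorm (zrow R (crep s + j *+ L)) `^ (alpha / 2).
  have -> : (L%:R / 2) `^ alpha * J = ((L%:R / 2) ^+ 2 * sqnorm (zrow R j)) `^ (alpha / 2).
    rewrite [RHS]powRM ?sqr_ge0 ?sqnorm_ge0//; congr (_ * _).
    by rewrite -powR_mulrn ?divr_ge0 ?(ltW L0)// -powRrM (mulrC _ (alpha / 2)) divfK.
  by apply: ge0_ler_powR; rewrite ?nnegrE ?(ltW q0) ?mulr_ge0 ?sqr_ge0 ?sqnorm_ge0// sqnorm_crep_shift.
have hE : (2 * pi * (W / L%:R)) `^ alpha * (L%:R / 2) `^ alpha = pi `^ alpha * W `^ alpha.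
  rewrite -!powRM ?(ltW wl0) ?divr_ge0 ?(ltW L0) ?(ltW W0) ?pi_ge0//.
  by congr (_ `^ _); field; exact: lt0r_neq0.
apply: (@le_trans _ _ (m%:R * (ka * (2 * pi * (W / L%:R)) `^ alpha * ((L%:R / 2) `^ alpha * J)))); last first.
  by rewrite ler_wpM2l// ler_wpM2l// mulr_ge0 ?powR_ge0 ?(ltW ka0).
have -> : m%:R * (ka * (2 * pi * (W / L%:R)) `^ alpha * ((L%:R / 2) `^ alpha * J)) =
   tail_rate * (2 * y * J).
  transitivity (m%:R * ka * ((2 * pi * (W / L%:R)) `^ alpha * (L%:R / 2) `^ alpha) * J); first by ring.
  by rewrite hE /tail_rate /y; field.
rewrite -mulrDr ler_pM2l ?tail_rate_gt0//.
by nra.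
Qed.

Lemma stable_dualX_fin (m : nat) : (0 < m)%N ->
  (\esum_(k in [set: 'rV[int]_d]) (g k ^+ m)%:E < +oo)%E.
Proof.
move=> m0; apply: le_lt_trans (sum_stable_transform_fin ka0 q0 d0 wl0).
apply: le_esum => k _; rewrite lee_fin -/(stable_dual alpha ka _ k).
by rewrite -[leRHS]expr1 ler_wiXn2l// ?stable_dual_ge0// stable_dual_le1.
Qed.

Lemma aliased_stable_dual_ge s (m : nat) : (0 < m)%N ->
  g (crep s) ^+ m <= aliased (fun k => g k ^+ m) s.
Proof.
move=> m0; have gm0 k : 0 <= g k ^+ m by rewrite exprn_ge0// stable_dual_ge0.
rewrite -lee_fin -aliasedE//; last exact: stable_dualX_fin.
pose h j := (g (crep s + j *+ L) ^+ m)%:E.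
have h0 j : (0 <= h j)%E by rewrite lee_fin.
have := sum_le_esum (s := [:: 0]) isT h0.
by rewrite big_seq1 {1}/h mul0rn addr0.
Qed.

Lemma aliased_stable_dual_le s (m : nat) : (0 < m)%N -> 1 <= m%:R * W `^ alpha ->
  aliased (fun k => g k ^+ m) s <=
  g (crep s) ^+ m + tail_const * expR (- (tail_rate * (m%:R * W `^ alpha))).
Proof.
move=> m0 y1; have gm0 k : 0 <= g k ^+ m by rewrite exprn_ge0// stable_dual_ge0.
rewrite -lee_fin -aliasedE//; last exact: stable_dualX_fin.
set y := m%:R * W `^ alpha.
have E0 : 0 <= expR (- (tail_rate * y)) by exact: expR_ge0.
have tfin := sum_stable_transform_fin tail_rate_gt0 q0 d0 (@ltr01 R).
have tail (r : seq 'rV[int]_d) : uniq r -> 0 \notin r ->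
    \sum_(j <- r) g (crep s + j *+ L) ^+ m <= tail_const * expR (- (tail_rate * y)).
  move=> ur r0.
  apply: (@le_trans _ _ (\sum_(j <- r)
      stable_transform tail_rate (alpha / 2) (1 *: zrow R j) * expR (- (tail_rate * y)))).
    rewrite big_seq [leRHS]big_seq; apply: ler_sum => j jr.
    by apply: stable_dual_shift_le => //; apply: contraNneq r0 => <-.
  rewrite -mulr_suml ler_wpM2r// -lee_fin /tail_const fineK; last first.
    rewrite ge0_fin_numE//; apply: esum_ge0 => j _.
    by rewrite lee_fin stable_transform_ge0.
  rewrite -sumEFin; apply: sum_le_esum => // j.
  by rewrite lee_fin stable_transform_ge0.
apply: esum_le_bound => r ur; rewrite sumEFin lee_fin.
have [r0|r0] := boolP (0 \in r); last first.
  by rewrite (le_trans (tail r ur r0))// lerDr.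
rewrite (big_rem 0)//= mul0rn addr0 lerD2l tail ?rem_uniq//.
by rewrite mem_rem_uniqF.
Qed.

Lemma le_aliased_stable_dual s : g (crep s) <= aliased g s.
Proof.
have -> : aliased g s = aliased (fun k => g k ^+ 1) s.
  by apply: eq_aliased => k; rewrite expr1.
by rewrite (le_trans _ (aliased_stable_dual_ge s _)).
Qed.

Lemma aliased_stable_dual0_ge1 : 1 <= aliased g (0 : torus L d).
Proof. by have := le_aliased_stable_dual 0; rewrite crep0 stable_dual0. Qed.

(** The aliasing bound is used with exponent n for the theta coefficient and with exponent 1 for the
    eigenvalue. The latter requires W^alpha >= 1; otherwise e^b e^(-b W^alpha) >= 1 makes the claim
    trivial, which explains [expR tail_rate] in the constant. *)
Lemma eigenvalue_error s (n : nat) : (0 < n)%N -> 1 <= n%:R * W `^ alpha ->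
  aliased g s <= aliased g (0 : torus L d) ->
  `|(aliased g s / aliased g (0 : torus L d)) ^+ n - aliased (fun k => g k ^+ n) s| <=
  n%:R * ((2 * tail_const + expR tail_rate) * expR (- (tail_rate * W `^ alpha))).
Proof.
move=> n0 ny1 As.
have e1 (t : torus L d) : aliased g t = aliased (fun k => g k ^+ 1) t.
  by apply: eq_aliased => k; rewrite expr1.
have leq1 (t : torus L d) : 1 <= W `^ alpha ->
    aliased g t <= g (crep t) + tail_const * expR (- (tail_rate * W `^ alpha)).
  move=> y1; rewrite e1 (le_trans (aliased_stable_dual_le t _ _))// ?mul1r//.
apply: (quotient_power_error (mu := g (crep s))).
- exact: n0.
- by rewrite stable_dual_ge0 stable_dual_le1.
- exact: le_aliased_stable_dual.
- exact: As.
- exact: aliased_stable_dual0_ge1.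
- exact: tail_const_ge0.
- exact: expR_ge0.
- exact: expR_ge0.
- rewrite distrC ger0_norm ?subr_ge0; last exact: aliased_stable_dual_ge.
  rewrite lerBlDl (le_trans (aliased_stable_dual_le s n0 ny1))// lerD2l.
  apply: ler_wpM2l; first exact: tail_const_ge0.
  rewrite ler_expR lerN2 ler_pM2l; last exact: tail_rate_gt0.
  by rewrite ler_peMl ?powR_ge0// ler1n.
have [y1|y1] := leP 1 (W `^ alpha).
  left; split; first exact: leq1 y1.
  by have := leq1 0 y1; rewrite crep0 stable_dual0.
right; rewrite -expRD -expR0 ler_expR subr_ge0 ler_piMr ?(ltW y1)//.
by rewrite ltW// tail_rate_gt0.
Qed.
End AliasingError.

Lemma hankel_kernel_ge0 (R : realType) (d L : nat) (f : 'rV[R]_d -> R) (W : R)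
    (x0 x y : torus L d) :
  (forall z, 0 <= f z) -> 0 <= hankel_kernel f W x0 x y.
Proof.
move=> f0; rewrite mulr_ge0 ?invr_ge0//; apply/fine_ge0/esum_ge0 => k _;
  by rewrite lee_fin.
Qed.

Lemma nstep_hankel_error (R : realType) (d L : nat) (alpha ka W : R) (f : 'rV[R]_d -> R)
    (n : nat) (x0 x y : torus L d) :
  (1 < L)%N -> (0 < d)%N -> 0 < alpha -> 0 < ka -> 0 < W ->
  (forall z, 0 <= f z) ->
  (forall (x : 'rV[R]_d) (P : R), 0 < P ->
  (\esum_(k in [set: 'rV[int]_d]) (P ^+ d * (f (x + P *: zrow R k) + f (P *: zrow R k)))%:E =
   \esum_(k in [set: 'rV[int]_d])
     (stable_transform ka (alpha / 2) ((2 * pi / P) *: zrow R k) *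
      (1 + cos (\sum_i (k 0%R i)%:~R * (2 * pi / P * x 0%R i))))%:E)%E) ->
  (0 < n)%N -> 1 <= n%:R * W `^ alpha ->
  `|nstep (hankel_kernel f W x0) n x y - (L%:R ^+ d)^-1 *
     stable_theta alpha f (L%:R^-1 *: torus_rep R (if odd n then x + y - x0 else y - x))
       (n%:R * (W / L%:R) `^ alpha)| <=
  n%:R * ((2 * tail_const d alpha ka + expR (tail_rate alpha ka)) *
    expR (- (tail_rate alpha ka * W `^ alpha))).
Proof.
move=> L1 d0 alpha0 ka0 W0 f0 poisson n0 ny1.
have t0 : 0 < W / L%:R by rewrite divr_gt0// ltr0n ltnW.
have kE := hankel_kernelE L1 d0 alpha0 ka0 f0 poisson.
pose lam (s : torus L d) := aliased (stable_dual alpha ka (2 * pi * (W / L%:R))) s /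
  aliased (stable_dual alpha ka (2 * pi * (W / L%:R))) (0 : torus L d).
have ev s : lam (- s) = lam s.
  by rewrite /lam (aliasedN L1 s (stable_dualN L alpha ka W)).
rewrite (stable_thetaE L1 d0 alpha0 ka0 f0 poisson _ t0 n0).
have pE u v : hankel_kernel f W x0 u v = torus_fourier lam (u + v - x0) by exact: kE.
rewrite (nstep_hankel L1 ev pE n).
apply: ler_torus_fourier_dist => // s.
apply: eigenvalue_error; [exact: L1|exact: d0|exact: alpha0|exact: ka0|exact: W0|exact: n0|exact: ny1|].
have A0 := @aliased_stable_dual0_ge1 R L d alpha ka W L1 d0 alpha0 ka0 W0.
(* For x0 = y = 0 the kernel at x = u is the Fourier series itself; its nonnegativity makes the
   coefficient at 0 the largest. *)
have tf0 u : 0 <= torus_fourier lam u.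
  have := hankel_kernel_ge0 W 0 u 0 f0; rewrite kE; last exact: W0.
  by rewrite addr0 subr0.
have cancel_den (X Y : R) : 1 <= Y -> X / Y <= Y / Y -> X <= Y.
  move=> Y1; have Y0 : 0 < Y := lt_le_trans ltr01 Y1.
  by rewrite divff ?gt_eqF// ler_pdivrMr// mul1r.
exact: (cancel_den _ _ A0 (torus_fourier_coef_le L1 s ev tf0)).
Qed.

(** The rate is [tail_rate alpha ka], fixed before the sequences. The limits serve to reach,
    eventually, n W^alpha >= 1 for [nstep_hankel_error], and n >= 2. *)
Theorem lemma5p6 (R : realType) (d : nat) (alpha c_alpha sigma : R)
    (f : 'rV[R]_d -> R) :
  (0 < d)%N -> 0 < alpha -> alpha <= 2 -> 0 < c_alpha -> 0 < sigma ->
  is_stable_density alpha c_alpha sigma f ->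
  exists2 c : R, 0 < c &
  forall (L : nat -> nat) (W : nat -> R) (n : nat -> nat) (tau : R),
  (L j ^ d)%N @[j --> \oo] --> \oo ->
  (forall j, 0 < W j) ->
  W j / (L j)%:R @[j --> \oo] --> (0 : R) ->
  0 < tau ->
  (n j)%:R * (W j / (L j)%:R) `^ alpha @[j --> \oo] --> tau ->
  exists C : R, \forall j \near \oo,
  forall x0 x y : torus (L j) d,
  let p := nstep (hankel_kernel f (W j) x0) in
  let theta := stable_theta alpha f in
  (forall k : nat, n j = k.*2 ->
     `|p k.*2 x y
       - ((L j)%:R ^+ d)^-1
         * theta ((L j)%:R^-1 *: torus_rep R (y - x))
                 (k.*2%:R * (W j / (L j)%:R) `^ alpha)|
     <= C * (k%:R * expR (- (c * W j `^ alpha))))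
  /\
  (forall k : nat, n j = k.*2.+1 ->
     `|p k.*2.+1 x y
       - ((L j)%:R ^+ d)^-1
         * theta ((L j)%:R^-1 *: torus_rep R (y + x - x0))
                 (k.*2.+1%:R * (W j / (L j)%:R) `^ alpha)|
     <= C * (k%:R * expR (- (c * W j `^ alpha)))).
Proof.
move=> d0 a0 a2 c0 s0 fdens.
(* [nstep_hankel_error] has the factor n where the claim has k. Both 2k and, for k >= 1, 2k + 1 are
   at most 3k, whence the 3 in C. *)
have double_le3 k : (k.*2 <= 3 * k)%N by rewrite -mul2n leq_mul2r orbT.
have doubleS_le3 k : (1 < k.*2.+1)%N -> (k.*2.+1 <= 3 * k)%N.
  by case: k => // k _; rewrite (mulSn 2) mul2n -[leqLHS]add1n leq_add2r.
have [[_ f0 _ _] _] := fdens.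
have [ka ka0 poisson] := stable_poisson d0 a0 c0 s0 fdens.
exists (tail_rate alpha ka); first exact: tail_rate_gt0.
move=> L W n tau Loo W0 WL0 tau0 ntau.
set b := tail_rate alpha ka; set K := tail_const d alpha ka.
have D0 : 0 <= 2 * K + expR b.
  by rewrite addr_ge0 ?expR_ge0 ?mulr_ge0 ?tail_const_ge0.
exists (3 * (2 * K + expR b)).
(* L >= N gives L^alpha >= 2/tau; multiplied by n (W/L)^alpha > tau/2 this yields n W^alpha >= 1. *)
pose N := (Num.truncn ((2 / tau) `^ alpha^-1)).+1.
have NL : \forall j \near \oo, (N.+1 < L j)%N.
  have : \forall j \near \oo, (N.+1 ^ d < L j ^ d)%N by exact: (Loo _ (nbhs_infty_gt _)).
  by apply: filterS => j; rewrite ltn_exp2r.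
have nt : \forall j \near \oo, tau / 2 < (n j)%:R * (W j / (L j)%:R) `^ alpha.
  by apply: (cvgr_gt _ ntau); lra.
(* With (W/L)^alpha < tau/4, the lower bound tau/2 for n (W/L)^alpha excludes n <= 1. In the odd
   case this gives k >= 1, without which the error bound would be 0. *)
have wt : \forall j \near \oo, W j / (L j)%:R < (tau / 4) `^ alpha^-1.
  by apply: (cvgr_lt _ WL0); rewrite powR_gt0; lra.
near=> j; have NLj : (N.+1 < L j)%N by near: j.
have ntj : tau / 2 < (n j)%:R * (W j / (L j)%:R) `^ alpha by near: j.
have wtj : W j / (L j)%:R < (tau / 4) `^ alpha^-1 by near: j.
move=> x0 x y; set p := nstep _; set theta := stable_theta _ _.
have L1 : (1 < L j)%N by exact: leq_ltn_trans NLj.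
have L0 : 0 < (L j)%:R :> R by rewrite ltr0n ltnW.
have t0 : 0 < W j / (L j)%:R by rewrite divr_gt0.
have powK (z : R) : 0 < z -> (z `^ alpha^-1) `^ alpha = z.
  by move=> z0; rewrite -powRrM mulVf ?gt_eqF// powRr1// ltW.
have ta : (W j / (L j)%:R) `^ alpha < tau / 4.
  have t4 : 0 < tau / 4 by lra.
  rewrite -[ltRHS]powK//; apply: gt0_ltr_powR => //; rewrite nnegrE ?powR_ge0//.
  exact: ltW.
have n2 : (2 <= n j)%N.
  rewrite leqNgt; apply/negP => n1.
  have : (n j)%:R <= 1 :> R by rewrite lern1.
  have := powR_ge0 (W j / (L j)%:R) alpha.
  by move: ntj ta; nra.
have La : 2 / tau <= (L j)%:R `^ alpha.
  have t2 : 0 < 2 / tau by rewrite divr_gt0.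
  rewrite -[leLHS]powK//; apply: ge0_ler_powR; rewrite ?nnegrE ?powR_ge0 ?(ltW a0) ?(ltW L0)//.
  rewrite (le_trans (ltW (truncnS_gt _)))// ler_nat.
  by rewrite ltnW// ltnW.
have ny1 : 1 <= (n j)%:R * W j `^ alpha.
  have -> : W j `^ alpha = (W j / (L j)%:R) `^ alpha * (L j)%:R `^ alpha.
    by rewrite -powRM ?(ltW t0) ?(ltW L0)// divfK ?gt_eqF.
  rewrite mulrA.
  have h1 : 0 <= tau / 2 by rewrite divr_ge0 ?(ltW tau0).
  have h2 : 0 <= 2 / tau by rewrite divr_ge0 ?(ltW tau0).
  have e : tau / 2 * (2 / tau) = 1 by field; rewrite gt_eqF.
  by rewrite -[leLHS]e; exact: ler_pM h1 h2 (ltW ntj) La.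
have H m (mn : n j = m) u v : `|p m u v - ((L j)%:R ^+ d)^-1 *
     theta ((L j)%:R^-1 *: torus_rep R (if odd m then u + v - x0 else v - u))
       (m%:R * (W j / (L j)%:R) `^ alpha)| <=
   m%:R * ((2 * K + expR b) * expR (- (b * W j `^ alpha))).
  by rewrite -mn; exact: (nstep_hankel_error x0 u v L1 d0 a0 ka0 (W0 j) f0 poisson (ltnW n2) ny1).
have E0 : 0 <= (2 * K + expR b) * expR (- (b * W j `^ alpha)).
  by rewrite mulr_ge0 ?expR_ge0.
have close m k : (m <= 3 * k)%N ->
    m%:R * ((2 * K + expR b) * expR (- (b * W j `^ alpha))) <=
    3 * (2 * K + expR b) * (k%:R * expR (- (b * W j `^ alpha))).
  move=> mk; have -> : 3 * (2 * K + expR b) * (k%:R * expR (- (b * W j `^ alpha))) =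
    (3 * k)%:R * ((2 * K + expR b) * expR (- (b * W j `^ alpha))) by rewrite natrM; ring.
  by rewrite ler_wpM2r// ler_nat.
split=> k nk; rewrite nk in n2.
  have := H _ nk x y; rewrite odd_double => /le_trans; apply.
  exact: close (double_le3 k).
have := H _ nk x y; rewrite oddS odd_double (addrC y x) => /le_trans; apply.
exact: close (doubleS_le3 k n2).
Unshelve. all: by end_near.
Qed.
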